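(* Let $\mathcal C$ be a ring centered at $0$ in $\mathbb R^3$. There exist two positive constants $c$ and $C$ such that, for any $p\in[1,\infty]$ and any couple $(t,\lambda)$ of positive real numbers, if $\operatorname{supp}\hat u\subset\lambda\mathcal C$, then $$\|\mathcal G(x,t)u\|_{L^p}\le Ce^{-c\lambda^2t}\|u\|_{L^p}.$$
   Context: A ring centered at $0$ is a set $\{\xi\in\mathbb R^3: r_1\le|\xi|\le r_2\}$ with $0<r_1<r_2$. $\mathcal G(x,t)$ is the Green matrix of the linear system $$\partial_tu_A-\Delta u_A-\Lambda\omega_\Omega=0,\qquad \partial_t\omega_\Omega-\Delta\omega_\Omega+2\omega_\Omega-\Lambda u_A=0,\qquad \Lambda=\mathcal F^{-1}|\xi|\mathcal F,$$ i.e. the solution with data $(u_{0,A},\omega_{0,\Omega})$ is $\mathcal G(x,t)(u_{0,A},\omega_{0,\Omega})$. Here $u=(u^{(1)},u^{(2)})$ is a pair of (scalar-, vector- or matrix-valued, the action being entrywise) functions on $\mathbb R^3$ and $\mathcal G(x,t)u$ is defined by $\widehat{\mathcal G u}(\xi,t)=\widehat{\mathcal G}(\xi,t)\hat u(\xi)$, where $\widehat{\mathcal G}(\xi,t)$ is the $2\times2$ matrix $$\widehat{\mathcal G}(\xi,t)=e^{-|\xi|^2t}\Big(\mathcal A(\xi,t)\begin{pmatrix}-1&-|\xi|\\-|\xi|&1\end{pmatrix}+\mathcal B(\xi,t)I\Big),$$ $$\mathcal A(\xi,t)=\frac{e^{(-1-\sqrt{1+|\xi|^2})t}-e^{(-1+\sqrt{1+|\xi|^2})t}}{2\sqrt{1+|\xi|^2}},\qquad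 \mathcal B(\xi,t)=\frac{e^{(-1-\sqrt{1+|\xi|^2})t}+e^{(-1+\sqrt{1+|\xi|^2})t}}2.$$ $L^p$ norms of pairs, vectors or matrices are sums of the $L^p$ norms of the entries. *)

(* Defs.v *)
From HB Require Import structures.
From mathcomp Require Import all_boot all_order all_algebra.
From mathcomp Require Import complex.
From mathcomp Require Import all_classical all_reals all_analysis.

Set Implicit Arguments.
Unset Strict Implicit.
Unset Printing Implicit Defensive.

Import Order.TTheory GRing.Theory Num.Theory.
Import numFieldNormedType.Exports.

Local Open Scope classical_set_scope.
Local Open Scope ring_scope.
Local Open Scope complex_scope.

Notation R3 R := (R * R * R)%type.

(* The same carrier with the product Borel sigma-algebra, phrased through
   [measurableTypeR], the measurable type on which [lebesgue_measure] lives. *)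
Notation mR3 R := (measurableTypeR R * measurableTypeR R * measurableTypeR R)%type.

Section Definitions.
Context {R : realType}.

Definition mu3 : set (mR3 R) -> \bar R :=
  ((@lebesgue_measure R \x @lebesgue_measure R) \x @lebesgue_measure R)%E.

HB.instance Definition _ := Measure.on mu3.

Definition dot3 (x y : R3 R) : R :=
  x.1.1 * y.1.1 + x.1.2 * y.1.2 + x.2 * y.2.

(* The norm that [R3 R] carries as a product of normed modules is the max norm;
   the symbols below involve the Euclidean norm. *)
Definition enorm (x : R3 R) : R := Num.sqrt (dot3 x x).

Definition ring3 (r1 r2 : R) : set (R3 R) :=
  [set x | r1 <= enorm x <= r2].

Definition scale_set (l : R) (A : set (R3 R)) : set (R3 R) :=
  [set l *: x | x in A].

Definition iter_derive (s : seq (R3 R)) (f : R3 R -> R) : R3 R -> R :=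
  foldr (fun v g => fun x => 'D_v g x) f s.

(* Frechet differentiability of every iterated directional derivative. *)
Definition smooth (f : R3 R -> R) : Prop :=
  forall (s : seq (R3 R)) (x : R3 R), differentiable (iter_derive s f) x.

Definition rapidly_decreasing (f : R3 R -> R) : Prop :=
  forall (s : seq (R3 R)) (k : nat), exists M : R,
    forall x, enorm x ^+ k * `|iter_derive s f x| <= M.

Definition smoothC (f : R3 R -> R[i]) : Prop :=
  smooth (fun x => complex.Re (f x)) /\ smooth (fun x => complex.Im (f x)).

Definition schwartz (f : R3 R -> R[i]) : Prop :=
  [/\ smoothC f,
      rapidly_decreasing (fun x => complex.Re (f x)) &
      rapidly_decreasing (fun x => complex.Im (f x))].

Definition supp {V : nmodType} (f : R3 R -> V) : set (R3 R) :=
  closure [set x | f x != 0].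

Definition test_function (f : R3 R -> R[i]) : Prop :=
  smoothC f /\ compact (supp f).

Definition integralC (f : R3 R -> R[i]) : R[i] :=
  (\int[mu3]_x complex.Re (f x))
  +i* (\int[mu3]_x complex.Im (f x)).

Definition expi (a : R) : R[i] := cos a +i* sin a.

(* With this normalization, [- Laplacian] has symbol [enorm xi ^+ 2]. *)
Definition fourier (f : R3 R -> R[i]) (xi : R3 R) : R[i] :=
  integralC (fun x => expi (- dot3 x xi) * f x).

(* Tempered distributions, as functionals applied to Schwartz functions. *)
Definition distr := (R3 R -> R[i]) -> R[i].

Definition distr_of (f : R3 R -> R[i]) : distr :=
  fun phi => integralC (fun x => f x * phi x).

Definition dfourier (T : distr) : distr := fun phi => T (fourier phi).

Definition dmul (m : R3 R -> R) (T : distr) : distr :=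
  fun phi => T (fun xi => (m xi)%:C * phi xi).

Definition vanishes_on (T : distr) (U : set (R3 R)) : Prop :=
  forall phi, test_function phi -> supp phi `<=` U -> T phi = 0.

Definition dsupp (T : distr) : set (R3 R) :=
  ~` \bigcup_(U in [set U | open U /\ vanishes_on T U]) U.

Definition hat (f : R3 R -> R[i]) : distr := dfourier (distr_of f).

Definition normLp (p : \bar R) (f : R3 R -> R[i]) : \bar R :=
  Lnorm mu3 p (fun x : mR3 R => (Normc.normc (f x))%:E).

Definition in_Lp (p : \bar R) (f : R3 R -> R[i]) : Prop :=
  [/\ measurable_fun setT (fun x : mR3 R => complex.Re (f x)),
      measurable_fun setT (fun x : mR3 R => complex.Im (f x)) &
      (normLp p f < +oo)%E].

Definition calA (xi : R3 R) (t : R) : R :=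
  let s := Num.sqrt (1 + enorm xi ^+ 2) in
  (expR ((-1 - s) * t) - expR ((-1 + s) * t)) / (2 * s).

Definition calB (xi : R3 R) (t : R) : R :=
  let s := Num.sqrt (1 + enorm xi ^+ 2) in
  (expR ((-1 - s) * t) + expR ((-1 + s) * t)) / 2.

(* The matrix with rows (-1, -|xi|) and (-|xi|, 1). *)
Definition coupling (xi : R3 R) : 'M[R]_2 :=
  \matrix_(i, j) if i == j then (if i == 0 then -1 else 1) else - enorm xi.

Definition Ghat (xi : R3 R) (t : R) : 'M[R]_2 :=
  expR (- enorm xi ^+ 2 * t) *:
    (calA xi t *: coupling xi + (calB xi t)%:M).

(* [Ghat] is smooth only away from the origin, so its product with
   distributions T whose support is a compact set avoiding 0 means
   (chi * Ghat) T with chi a cutoff equal to 1 near that support; two cutoffs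
   give the same product, as they agree near the support of T. *)
Definition cutoff_near (K : set (R3 R)) (chi : R3 R -> R) : Prop :=
  [/\ smooth chi, compact (supp chi), ~ supp chi 0 &
      forall xi, K xi -> \forall y \near xi, chi y = 1].

(* v = G(., t) u for a pair u of scalar functions, i.e. hat v = Ghat (hat u). *)
Definition green_scalar (t : R) (u v : 'I_2 -> R3 R -> R[i]) : Prop :=
  exists2 chi, cutoff_near (\bigcup_j dsupp (hat (u j))) chi &
    forall (i : 'I_2) (phi : R3 R -> R[i]), schwartz phi ->
      hat (v i) phi =
      \sum_(j < 2) dmul (fun xi => chi xi * Ghat xi t i j) (hat (u j)) phi.

Section MatrixValued.
Variables (m n : nat).
Implicit Types u v : 'I_2 -> R3 R -> 'M[R[i]]_(m, n).

Definition entry u (a : 'I_m) (b : 'I_n) : 'I_2 -> R3 R -> R[i] :=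
  fun j x => u j x a b.

(* v = G(., t) u, the action being entrywise. *)
Definition green (t : R) u v : Prop :=
  forall a b, green_scalar t (entry u a b) (entry v a b).

Definition pair_in_Lp (p : \bar R) u : Prop :=
  forall j a b, in_Lp p (entry u a b j).

Definition pair_normLp (p : \bar R) u : \bar R :=
  (\sum_(j < 2) \sum_(a < m) \sum_(b < n) normLp p (entry u a b j))%E.

Definition spectrum_in u (K : set (R3 R)) : Prop :=
  forall j a b, dsupp (hat (entry u a b j)) `<=` K.

End MatrixValued.

End Definitions.

(* Main.v *)
(* Scale the frequency by [lambda]: multiplied by a cutoff to the ring [A / 4 <= r <= 4 B]
   in [r = |eta|^2 = |xi|^2 / lambda^2], where [A = r1^2] and [B = r2^2], the symbol
   factors as [e^{- kap lambda^2 t}], [kap = A / 32], times a function of [eta] whose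
   derivatives are bounded uniformly in [t] and [lambda].  Indeed its two
   exponentials have exponent at most
   [- (1 + |xi|^2 - sqrt (1 + |xi|^2)) t <= - |xi|^2 t / 2], so they absorb any power
   of [|xi|^2 t] produced by differentiation and still leave the factor
   [e^{- kap lambda^2 t}].  Hence the inverse transform [K] of the localized symbol
   satisfies
   [|K x| <= C lambda^3 e^{- kap lambda^2 t} / prod_i (1 + (lambda x_i)^2)], so that
   [int |K| <= C' e^{- kap lambda^2 t}].  The solution is the convolution of [K] with
   the datum, and Young's inequality gives the estimate for all [p] at once.

   As the symbol is real and even, only cosine transforms are needed.  Their decay is
   read off sixth-order finite differences, and the inversion formula is obtained by
   testing against the Cauchy kernel.  The transform of a Schwartz function is
   integrable and bounded, so for [u] in [L^p] the identity
   [hat (K * u) phi = (m hat u) phi] is an application of Fubini's theorem. *)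
Require Import Defs.
From HB Require Import structures.
From mathcomp Require Import all_boot all_order all_algebra.
From mathcomp Require Import complex.
From mathcomp Require Import all_classical all_reals all_analysis.
From mathcomp Require Import measurable_realfun ess_sup_inf.
From mathcomp Require Import ring lra.
Set Implicit Arguments.
Unset Strict Implicit.
Unset Printing Implicit Defensive.
Import Order.TTheory GRing.Theory Num.Theory.
Import numFieldNormedType.Exports.
Local Open Scope classical_set_scope.
Local Open Scope ring_scope.

(** * Lebesgue measure on [R^3] *)

(** The bounds on the symbol are proved in one real variable. A difference with step [pi / |x_v|]
    along an axis multiplies the cosine transform at [x] by [-2]; decay in [x_v] thus follows from
    bounds along the axes alone, with no integration by parts in space. Order six matches the three
    axes: with [y = lambda x], each axis yields a bound by [(1 + y_v^2)^-3], and the geometric mean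
    of the three is the integrable product of the [(1 + y_v^2)^-1]. The obstacle to uniformity is
    that differentiating the symbol brings out [lambda^2] and [t]. It is met by expressing
    derivatives through bounded generators: [lambda^2] is traded for the square root
    [sqrt (1 + |xi|^2)], and [t] occurs only in the product [|xi|^2 t]. As [p = +oo] is included,
    the datum is never approximated by nicer functions. The kernel is moved onto the transform of
    the test function instead; that this transform is integrable comes from the same decay lemma as
    the kernel estimate. *)

Section measure_preserving.
Context d {T : measurableType d} {R : realType} (mu : {measure set T -> \bar R}).
Variable phi : T -> T.
Hypothesis mphi : measurable_fun setT phi.
Hypothesis phiP : forall A, measurable A -> mu (phi @^-1` A) = mu A.

(** The image measure of [mu] under [phi] is [mu], so this is the image-measure formula. It is used
    for the translations and the reflection of [R^3]. *)
Lemma ge0_integral_preserving (f : T -> \bar R) :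
  measurable_fun setT f -> (forall x, 0 <= f x)%E ->
  (\int[mu]_x f (phi x) = \int[mu]_x f x)%E.
Proof.
move=> mf f0.
rewrite [RHS](eq_measure_integral (pushforward mu phi)); last first.
  by move=> A mA _; rewrite /= /pushforward phiP.
by rewrite (ge0_integral_pushforward mphi mu measurableT)// => *; exact: f0.
Qed.

Lemma integral_preserving (f : T -> \bar R) :
  measurable_fun setT f -> (\int[mu]_x f (phi x) = \int[mu]_x f x)%E.
Proof.
move=> mf; rewrite [LHS]integralE [RHS]integralE.
rewrite (funepos_comp f phi) (funeneg_comp f phi).
have mp := measurable_funepos mf; have mn := measurable_funeneg mf.
by rewrite (ge0_integral_preserving mp (@funepos_ge0 _ _ f))
  (ge0_integral_preserving mn (@funeneg_ge0 _ _ f)).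
Qed.

Lemma Rintegral_preserving (f : T -> R) :
  measurable_fun setT f -> \int[mu]_x f (phi x) = \int[mu]_x f x.
Proof.
move=> mf; rewrite /Rintegral; congr fine.
by apply: (@integral_preserving (EFin \o f)); exact/measurable_EFinP.
Qed.

Lemma integrable_preserving (f : T -> \bar R) :
  mu.-integrable setT f -> mu.-integrable setT (fun x => f (phi x)).
Proof.
move=> /integrableP[mf fi]; apply/integrableP; split.
  exact: measurableT_comp.
rewrite (@ge0_integral_preserving (fun x => `|f x|)%E)//.
exact: measurableT_comp.
Qed.

End measure_preserving.

(** Monotone exhaustions of the factors are paired at equal indices; monotonicity puts a point of
    [F i] times [G j] in the rectangle of index [maxn i j]. *)
Lemma sigma_finite_product d1 d2 (T1 : measurableType d1)
    (T2 : measurableType d2) (R : realType)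
    (m1 : {sigma_finite_measure set T1 -> \bar R})
    (m2 : {sigma_finite_measure set T2 -> \bar R}) :
  sigma_finite setT (m1 \x m2)%E.
Proof.
have /sigma_finiteP[F [FT Fnd Ffin]] := sigma_finiteT m1.
have /sigma_finiteP[G [GT Gnd Gfin]] := sigma_finiteT m2.
exists (fun n => F n `*` G n) => [|n]; last first.
  have [[mF F1] [mG G1]] := (Ffin n, Gfin n); split; first exact: measurableX.
  by rewrite product_measure1E// lte_mul_pinfty// ge0_fin_numE.
apply/seteqP; split=> // -[x y] _.
have [i _ Fx] : (\bigcup_n F n) x by rewrite -FT.
have [j _ Gy] : (\bigcup_n G n) y by rewrite -GT.
exists (maxn i j) => //; split => /=.
- exact: (subsetPset _ _ (Fnd _ _ (leq_maxl i j))).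
- exact: (subsetPset _ _ (Gnd _ _ (leq_maxr i j))).
Qed.

Section lebesgue_products.
Context {R : realType}.
Notation leb := (@lebesgue_measure R).
Notation mR := (measurableTypeR R).

(** [mu3] is by definition the product of this measure with [leb]; naming the inner product and
    making it sigma-finite lets Fubini's theorem peel off the last coordinate. *)
Definition mu2 : set (mR * mR) -> \bar R := (leb \x leb)%E.

HB.instance Definition _ := Measure.on mu2.

HB.instance Definition _ := Measure_isSigmaFinite.Build _ _ _ mu2
  (sigma_finite_product leb leb).

HB.instance Definition _ := Measure_isSigmaFinite.Build _ _ _ (@mu3 R)
  (sigma_finite_product mu2 leb).

End lebesgue_products.

Section translation.
Context {R : realType}.
Notation leb := (@lebesgue_measure R).
Notation mR := (measurableTypeR R).

Lemma measurable_addr (a : R) : measurable_fun setT (fun x : mR => x + a : mR).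
Proof. exact: measurable_funD. Qed.

(** Lebesgue measure is determined by half-open intervals, on which the translated measure agrees
    with it. *)
Lemma lebesgue_measure_translate (a : R) (A : set mR) :
  measurable A -> leb ((fun x => x + a) @^-1` A) = leb A.
Proof.
move=> mA; have ma := measurable_addr a.
apply/esym; apply: (@lebesgue_measure_unique R (pushforward leb (fun x : mR => x + a : mR))) mA => _ [[b c]] _ <-.
rewrite [RHS]/=/pushforward/=.
have -> : (fun x : R => x + a) @^-1` `]b, c]%classic = `]b - a, c - a]%classic.
  by apply/seteqP; split=> x /=; rewrite !in_itv/= ltrBlDr lerBrDr.
rewrite !lebesgue_measure_itv/= !lte_fin ltrD2r.
by case: ifP => // _; rewrite -!EFinB; congr EFin; ring.
Qed.

Definition translate3 (a x : mR3 R) : mR3 R :=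
  (x.1.1 + a.1.1, x.1.2 + a.1.2, x.2 + a.2).

Lemma measurable_translate3 a : measurable_fun setT (translate3 a).
Proof.
apply/measurable_fun_pair; first apply/measurable_fun_pair.
- by apply: measurable_funD => //; exact: measurableT_comp.
- by apply: measurable_funD => //; exact: measurableT_comp.
- by apply: measurable_funD => //; exact: measurableT_comp.
Qed.

(** Two measures in [X] are compared on rectangles, which determine a product of sigma-finite
    measures. *)
Lemma product_measure_preserving d1 d2 (T1 : measurableType d1)
    (T2 : measurableType d2) (m1 : {sigma_finite_measure set T1 -> \bar R})
    (m2 : {sigma_finite_measure set T2 -> \bar R}) (f1 : T1 -> T1) (f2 : T2 -> T2) :
  measurable_fun setT f1 -> measurable_fun setT f2 ->
  (forall A, measurable A -> m1 (f1 @^-1` A) = m1 A) ->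
  (forall A, measurable A -> m2 (f2 @^-1` A) = m2 A) ->
  forall X, measurable X ->
    (m1 \x m2)%E ((fun x => (f1 x.1, f2 x.2)) @^-1` X) = (m1 \x m2)%E X.
Proof.
move=> mf1 mf2 p1 p2 X mX.
have mf : measurable_fun setT (fun x : T1 * T2 => (f1 x.1, f2 x.2)).
  by apply/measurable_fun_pair; apply: measurableT_comp.
apply/esym.
apply: (@product_measure_unique _ _ _ _ _ m1 m2
  (pushforward (m1 \x m2)%E (fun x : T1 * T2 => (f1 x.1, f2 x.2)))) => // A B mA mB.
rewrite [LHS]/=/pushforward/=.
have -> : (fun x : T1 * T2 => (f1 x.1, f2 x.2)) @^-1` (A `*` B) =
  (f1 @^-1` A) `*` (f2 @^-1` B) by [].
have m1A : measurable (f1 @^-1` A) by rewrite -[X in measurable X]setTI; exact: mf1.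
have m2B : measurable (f2 @^-1` B) by rewrite -[X in measurable X]setTI; exact: mf2.
by rewrite product_measure1E//; congr (_ * _)%E; [exact: p1|exact: p2].
Qed.

Lemma mu3_translate a (A : set (mR3 R)) : measurable A ->
  mu3 (translate3 a @^-1` A) = mu3 A.
Proof.
move=> mA.
have mf b := measurable_addr b.
have p b := @lebesgue_measure_translate b.
have m2 : measurable_fun setT (fun x : mR * mR => (x.1 + a.1.1, x.2 + a.1.2)).
  by apply/measurable_fun_pair; apply: measurable_funD => //.
refine (@product_measure_preserving _ _ _ _ mu2 leb
   _ _ m2 (mf a.2) _ (p a.2) _ mA).
exact: (product_measure_preserving (mf a.1.1) (mf a.1.2) (p a.1.1) (p a.1.2)).
Qed.

Lemma mu3_opp (A : set (mR3 R)) : measurable A ->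
  mu3 ((fun x : mR3 R => (- x.1.1, - x.1.2, - x.2) : mR3 R) @^-1` A) = mu3 A.
Proof.
move=> mA.
have mf : measurable_fun setT (fun x : mR => - x : mR) by exact: oppr_measurable.
have p := @lebesgue_measureN R.
have m2 : measurable_fun setT (fun x : mR * mR => (- x.1, - x.2)).
  by apply/measurable_fun_pair; apply: measurableT_comp.
refine (@product_measure_preserving _ _ _ _ mu2 leb
   _ _ m2 mf _ p _ mA).
exact: (product_measure_preserving mf mf p p).
Qed.

End translation.

(** * Fubini's theorem for real-valued integrals *)

Section Rfubini.
Context d1 d2 (T1 : measurableType d1) (T2 : measurableType d2) (R : realType).
Variable m1 : {sigma_finite_measure set T1 -> \bar R}.
Variable m2 : {sigma_finite_measure set T2 -> \bar R}.
Variable f : T1 * T2 -> R.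

(** The real integral is [fine] of a difference of two Tonelli integrals, each measurable in [x],
    and [fine] is itself measurable. *)
Lemma measurable_Rintegral1 : measurable_fun setT f ->
  measurable_fun setT (fun x => \int[m2]_y f (x, y)).
Proof.
move=> mf; rewrite /Rintegral.
have mE : measurable_fun setT (EFin \o f) by exact/measurable_EFinP.
apply: (measurableT_comp (fine_measurable measurableT)).
have -> : (fun x => \int[m2]_y (f (x, y))%:E)%E =
   ((fun x => \int[m2]_y ((EFin \o f)^\+ (x, y))) \- (fun x => \int[m2]_y ((EFin \o f)^\- (x, y))))%E.
  apply/funext => x; rewrite -[LHS]/(\int[m2]_y ((EFin \o f) \o pair x) y)%E.
  by rewrite integralE funepos_comp funeneg_comp.
apply: emeasurable_funB; apply: measurable_fun_fubini_tonelli_F => //.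
  exact: measurable_funepos.
exact: measurable_funeneg.
Qed.

Hypothesis fi : (m1 \x m2)%E.-integrable setT (EFin \o f).

Lemma Rintegral12 : \int[m1]_x \int[m2]_y f (x, y) = \int[(m1 \x m2)%E]_z f z.
Proof.
rewrite /Rintegral -(integral12_prod_meas1 fi)/fubini_F/=; congr fine.
have iF := integrable_fubini_F fi.
(* The inner integral may be infinite on a null set, where [fine] replaces it by 0. *)
apply: ae_eq_integral => //.
- apply/measurable_EFinP; apply: measurable_Rintegral1.
  by apply/measurable_EFinP; exact: measurable_int fi.
- exact: measurable_int iF.
- have := integrable_ae measurableT iF; apply: filterS => x /(_ I) + _.
  by rewrite /fubini_F/= => h; rewrite fineK.
Qed.

Lemma integrable_Rintegral1 :
  m1.-integrable setT (fun x => (\int[m2]_y f (x, y))%:E).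
Proof.
have iF := integrable_fubini_F fi.
have mF : measurable_fun setT (fun x => (\int[m2]_y f (x, y))%:E).
  apply/measurable_EFinP; apply: measurable_Rintegral1.
  by apply/measurable_EFinP; exact: measurable_int fi.
apply: (le_integrable measurableT mF _ iF) => x _.
by rewrite /Rintegral/fubini_F/=; case: (integral _ _ _) => [r| |] //=; rewrite normr0 leey.
Qed.

End Rfubini.

Section Rfubini_swap.
Context d1 d2 (T1 : measurableType d1) (T2 : measurableType d2) (R : realType).
Variable m1 : {sigma_finite_measure set T1 -> \bar R}.
Variable m2 : {sigma_finite_measure set T2 -> \bar R}.
Variable f : T1 * T2 -> R.
Hypothesis fi : (m1 \x m2)%E.-integrable setT (EFin \o f).

Lemma integrable_swap :
  (m2 \x m1)%E.-integrable setT (EFin \o (fun z : T2 * T1 => f (z.2, z.1))).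
Proof.
have mf := measurable_int _ fi.
have ms : measurable_fun setT (EFin \o (fun z : T2 * T1 => f (z.2, z.1))).
  have msw : measurable_fun setT (fun z : T2 * T1 => (z.2, z.1)).
    exact: measurable_fun_pair.
  exact: (measurableT_comp mf msw).
apply/(integrable12ltyP m2 m1 ms) => /=.
exact: (integrable21ltyP m1 m2 mf).1 fi.
Qed.

Lemma Rintegral_swap :
  \int[m1]_x \int[m2]_y f (x, y) = \int[m2]_y \int[m1]_x f (x, y).
Proof.
rewrite (Rintegral12 fi) (Rintegral12 integrable_swap) /Rintegral.
by rewrite -(integral12_prod_meas1 fi) -(integral12_prod_meas1 integrable_swap) (Fubini fi).
Qed.

End Rfubini_swap.

Section integrable_tools.
Context d1 d2 (T1 : measurableType d1) (T2 : measurableType d2) (R : realType).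
Variable m1 : {sigma_finite_measure set T1 -> \bar R}.
Variable m2 : {sigma_finite_measure set T2 -> \bar R}.

Lemma integrable_prod_le (f : T1 * T2 -> R) (g : T1 -> \bar R) :
  measurable_fun setT f -> measurable_fun setT g ->
  (forall x, \int[m2]_y `|f (x, y)|%:E <= g x)%E ->
  (\int[m1]_x g x < +oo)%E ->
  (m1 \x m2)%E.-integrable setT (EFin \o f).
Proof.
move=> mf mg fg goo.
have mE : measurable_fun setT (EFin \o f) by exact/measurable_EFinP.
have mA : measurable_fun setT (fun z : T1 * T2 => `|f z|%:E).
  by apply/measurable_EFinP; exact: measurableT_comp.
apply/(integrable12ltyP m1 m2 mE); apply: le_lt_trans goo.
have mF := measurable_fun_fubini_tonelli_F (m2 := m2) _ mA (fun z => normr_ge0 (f z)).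
by apply: ge0_le_integral => // x _; [exact: integral_ge0|exact: fg].
Qed.

Lemma integrable_tensor (f : T1 -> R) (g : T2 -> R) :
  m1.-integrable setT (EFin \o f) -> m2.-integrable setT (EFin \o g) ->
  (m1 \x m2)%E.-integrable setT (EFin \o (fun z => f z.1 * g z.2)).
Proof.
move=> fi gi.
have mf : measurable_fun setT f by apply/measurable_EFinP; exact: measurable_int fi.
have mg : measurable_fun setT g by apply/measurable_EFinP; exact: measurable_int gi.
have [_ foo] := integrableP _ _ _ fi.
have [_ goo] := integrableP _ _ _ gi.
have G0 : (0 <= \int[m2]_y `|g y|%:E)%E by exact: integral_ge0.
have Gf : (\int[m2]_y `|g y|%:E)%E \is a fin_num by rewrite ge0_fin_numE.
apply: (@integrable_prod_le _ (fun x => `|f x|%:E * \int[m2]_y `|g y|%:E)%E).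
- by apply: measurable_funM; exact: measurableT_comp.
- apply: emeasurable_funM => //; apply/measurable_EFinP; exact: measurableT_comp.
- move=> x /=; rewrite -ge0_integralZl//.
    by under [leRHS]eq_integral do rewrite -EFinM -normrM.
  by apply/measurable_EFinP; exact: measurableT_comp.
- rewrite ge0_integralZr//; last first.
  by apply/measurable_EFinP; exact: measurableT_comp.
by rewrite muleC lte_mul_pinfty.
Qed.

End integrable_tools.

(** * Calculus and explicit integrals on the real line *)

Section derivatives.
Context {R : realType}.
Implicit Types (f g : R -> R) (x c : R).

Lemma der_eq f x (l l' : R) : is_derive x 1 f l -> l = l' -> is_derive x 1 f l'.
Proof. by move=> h <-. Qed.

Lemma der_cst c x : is_derive x 1 (fun _ : R => c) 0.
Proof. exact: is_derive_cst. Qed.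

Lemma der_id x : is_derive x 1 (fun y : R => y) 1.
Proof. exact: is_derive_id. Qed.

Lemma der_add f g x (a b : R) : is_derive x 1 f a -> is_derive x 1 g b ->
  is_derive x 1 (fun y => f y + g y) (a + b).
Proof. exact: is_deriveD. Qed.

Lemma der_opp f x (a : R) : is_derive x 1 f a ->
  is_derive x 1 (fun y => - f y) (- a).
Proof. exact: is_deriveN. Qed.

Lemma der_mul f g x (a b : R) : is_derive x 1 f a -> is_derive x 1 g b ->
  is_derive x 1 (fun y => f y * g y) (a * g x + f x * b).
Proof.
move=> fa gb; apply: der_eq (is_deriveM fa gb) _.
by rewrite /GRing.scale/= addrC mulrC.
Qed.

Lemma der_comp f g x (a b : R) : is_derive (g x) 1 f a -> is_derive x 1 g b ->
  is_derive x 1 (fun y => f (g y)) (a * b).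
Proof. move=> fa gb; apply: der_eq (is_derive1_comp fa gb) _; by rewrite ?[b * a]mulrC. Qed.

Lemma der_expR f x (a : R) : is_derive x 1 f a ->
  is_derive x 1 (fun y => expR (f y)) (expR (f x) * a).
Proof. by move=> fa; apply: der_comp. Qed.

Lemma der_cos f x (a : R) : is_derive x 1 f a ->
  is_derive x 1 (fun y => cos (f y)) (- sin (f x) * a).
Proof. by move=> fa; apply: (@der_comp cos). Qed.

Lemma der_sin f x (a : R) : is_derive x 1 f a ->
  is_derive x 1 (fun y => sin (f y)) (cos (f x) * a).
Proof. by move=> fa; apply: (@der_comp sin). Qed.

Lemma der_atan f x (a : R) : is_derive x 1 f a ->
  is_derive x 1 (fun y => atan (f y)) ((1 + f x ^+ 2)^-1 * a).
Proof. by move=> fa; apply: (@der_comp atan). Qed.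

Lemma der_inv f x (a : R) : f x != 0 -> is_derive x 1 f a ->
  is_derive x 1 (fun y => (f y)^-1) (- (f x)^-2 * a).
Proof.
by move=> f0 [df <-]; split; [exact: derivableV|rewrite deriveV].
Qed.

Lemma der_sqrt f x (a : R) : 0 < f x -> is_derive x 1 f a ->
  is_derive x 1 (fun y => Num.sqrt (f y)) ((2 * Num.sqrt (f x))^-1 * a).
Proof. by move=> f0 fa; apply: (@der_comp Num.sqrt) => //; exact: is_derive1_sqrt. Qed.

Lemma der_continuous f (df : R -> R) :
  (forall x : R, is_derive x 1 f (df x)) -> continuous f.
Proof.
by move=> h x; apply: differentiable_continuous; apply/derivable1_diffP; have := h x.
Qed.

End derivatives.

(** The rules synthesize some expression for the derivative; [der_tac] then leaves only its equality
    with the stated one, a matter for [ring] or [field]. *)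
Ltac der_step := first
  [ apply: der_cst | apply: der_id | assumption
  | apply: der_expR | apply: der_cos | apply: der_sin
  | apply: der_opp | apply: der_add | apply: der_mul ].
Ltac der_tac := eapply der_eq; [ repeat der_step | rewrite /GRing.scale/= ].

Section integrals_on_the_line.
Context {R : realType}.
Notation leb := (@lebesgue_measure R).

Lemma FTC_segment (f F : R -> R) (a b : R) : a < b ->
  continuous f -> (forall x : R, is_derive x 1 F (f x)) ->
  (\int[leb]_(x in `[a, b]) (f x)%:E = (F b - F a)%:E)%E.
Proof.
move=> ab cf dF; have cF := der_continuous dF.
rewrite (continuous_FTC2 ab (F := F)) ?EFinB//.
- exact: continuous_subspaceT.
- split; first by move=> x _; have := dF x.
  + by apply: cvg_at_right_filter; exact: cF.
  + by apply: cvg_at_left_filter; exact: cF.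
- by move=> x _; rewrite derive1E; case: (dF x).
Qed.

Definition segn (n : nat) : set (measurableTypeR R) := `[- n%:R, n%:R]%classic.

Lemma measurable_segn n : measurable (segn n).
Proof. exact: measurable_itv. Qed.

Lemma segnE n (x : R) : segn n x <-> `|x| <= n%:R.
Proof. by rewrite /segn/= in_itv/= -ler_norml. Qed.

Lemma cvg_integral_segments (f : R -> R) :
  leb.-integrable setT (EFin \o f) ->
  (\int[leb]_(x in segn n) (f x)%:E)%E @[n --> \oo] -->
    (\int[leb]_x (f x)%:E)%E.
Proof.
move=> fi; have mf := measurable_int _ fi.
pose fn (n : nat) := (EFin \o f) \_ (segn n).
have [] := @dominated_convergence _ _ _ leb setT measurableT fn (EFin \o f) (fun x => `|f x|%:E).
- move=> n; apply/(measurable_restrictT (EFin \o f) (measurable_segn n)).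
  exact: measurable_funTS.
- exact: mf.
- apply: aeW => x _; apply: cvg_near_cst; near=> n.
  rewrite /fn patchE mem_set//; apply/segnE.
  by near: n; exact: nbhs_infty_ger.
- by apply: integrable_abse fi.
- apply: aeW => x n _; rewrite /fn patchE; case: ifP => // _.
  by rewrite /= normr0 lee_fin.
move=> _ _ h; suff -> : (fun n => \int[leb]_(x in segn n) (f x)%:E)%E =
  (fun n => \int[leb]_x fn n x)%E by [].
by apply/funext => n; rewrite integral_mkcond.
Unshelve. all: by end_near. Qed.

(** By dominated convergence the integral is the limit over [[-n, n]]; given integrability, this
    symmetric limit identifies it. *)
Lemma integral_FTC_line (f F : R -> R) (l : R) :
  continuous f -> (forall x : R, is_derive x 1 F (f x)) ->
  leb.-integrable setT (EFin \o f) ->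
  F n%:R - F (- n%:R) @[n --> \oo] --> l ->
  (\int[leb]_x (f x)%:E = l%:E)%E.
Proof.
move=> cf dF fi Fl; have h := cvg_integral_segments fi.
have Fl' : (F n%:R - F (- n%:R))%:E @[n --> \oo] --> l%:E.
  by apply: cvg_EFin => //; exact: nearW.
apply: (cvg_unique _ h) => //; apply: cvg_trans Fl'; apply: near_eq_cvg; near=> n.
rewrite (FTC_segment _ cf dF)// gtrN// ltr0n; near: n; exact: nbhs_infty_gt.
Unshelve. all: by end_near. Qed.

(** Monotone convergence over [[-n, n]]: a bound read off a primitive on each segment passes to the
    whole line. *)
Lemma ge0_integral_line_le (f : R -> R) (M : R) :
  measurable_fun setT f -> (forall x, 0 <= f x) ->
  (forall n : nat, (0 < n)%N -> (\int[leb]_(x in segn n) (f x)%:E <= M%:E)%E) ->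
  (\int[leb]_x (f x)%:E <= M%:E)%E.
Proof.
move=> mf f0 fM.
have := @ge0_nondecreasing_set_cvg_integral _ _ R segn (EFin \o f) leb.
have -> : \bigcup_i segn i = setT.
  apply/seteqP; split => // x _; exists (Num.truncn `|x|).+1 => //=.
  by apply/segnE; rewrite ltW// truncnS_gt.
move=> h.
have {}h : (\int[leb]_(x in segn i) (f x)%:E)%E @[i --> \oo] --> (\int[leb]_x (f x)%:E)%E.
  apply: h.
  - apply/nondecreasing_seqP => n; apply/subsetPset; apply: subset_itv;
      by rewrite bnd_simp ?lerN2 ler_nat.
  - exact: measurable_segn.
  - by move=> n; apply/measurable_EFinP; exact: measurable_funTS.
  - by move=> n x _; rewrite lee_fin.
rewrite -(cvg_lim _ h)//; apply: lime_le; first exact: cvgP h.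
near=> n; apply: fM; near: n; exact: nbhs_infty_gt.
Unshelve. all: by end_near. Qed.

Lemma ge0_integrable_line (f : R -> R) (M : R) :
  measurable_fun setT f -> (forall x, 0 <= f x) ->
  (forall n : nat, (0 < n)%N -> (\int[leb]_(x in segn n) (f x)%:E <= M%:E)%E) ->
  leb.-integrable setT (EFin \o f).
Proof.
move=> mf f0 fM; apply/integrableP; split; first exact/measurable_EFinP.
under eq_integral do rewrite /= ger0_norm//.
by apply: le_lt_trans (ge0_integral_line_le mf f0 fM) _; rewrite ltry.
Qed.

Lemma continuous_addsq (e : R) : 0 < e -> continuous (fun s : R => e / (e ^+ 2 + s ^+ 2)).
Proof.
move=> e0 s; apply: cvgM; first exact: cvg_cst.
apply: cvgV; first by rewrite gt_eqF// ltr_wpDr ?sqr_ge0 ?exprn_gt0.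
by apply: cvgD; [exact: cvg_cst|exact: exprn_continuous].
Qed.

Lemma der_atan_scaled (e x : R) : 0 < e ->
  is_derive x 1 (fun s => atan (e^-1 * s)) (e / (e ^+ 2 + x ^+ 2)).
Proof.
move=> e0; eapply der_eq; first by apply: der_atan; repeat der_step.
have e1 : e != 0 by rewrite gt_eqF.
have e2 : e ^+ 2 + x ^+ 2 != 0 by rewrite gt_eqF// ltr_wpDr ?sqr_ge0 ?exprn_gt0.
by rewrite /GRing.scale/=; field; rewrite e1 e2.
Qed.

Lemma atan_scaled_cvg (e : R) : 0 < e ->
  atan (e^-1 * n%:R) - atan (e^-1 * - n%:R) @[n --> \oo] --> (pi : R).
Proof.
move=> e0; have e1 : 0 < e^-1 by rewrite invr_gt0.
have h : atan (e^-1 * n%:R) @[n --> \oo] --> (pi / 2 : R).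
  apply: (cvg_comp _ (fun y : R => atan (e^-1 * y)) (@cvgr_idn R)).
  exact: (cvg_comp _ _ (gt0_cvgMry e1 cvg_id) (@cvgy_atan R)).
have -> : (pi : R) = pi / 2 - - (pi / 2) by lra.
apply: cvgB => //; under eq_fun do rewrite mulrN atanN.
exact: cvgN.
Qed.

Lemma integrable_poisson (e : R) : 0 < e ->
  leb.-integrable setT (EFin \o (fun s : R => e / (e ^+ 2 + s ^+ 2))).
Proof.
move=> e0; have c := continuous_addsq e0.
apply: (@ge0_integrable_line _ pi).
- exact: continuous_measurable_fun.
- by move=> s; rewrite divr_ge0 ?addr_ge0 ?sqr_ge0// ltW.
- move=> n n0; rewrite (FTC_segment _ c (fun x => der_atan_scaled x e0))//.
  + rewrite lee_fin; have := atan_ltpi2 (e^-1 * n%:R).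
    have := atan_gtNpi2 (e^-1 * - n%:R); lra.
  + by rewrite gtrN// ltr0n.
Qed.

Lemma integral_poisson (e : R) : 0 < e ->
  (\int[leb]_s (e / (e ^+ 2 + s ^+ 2))%:E = (pi : R)%:E)%E.
Proof.
move=> e0; have c := continuous_addsq e0.
apply: (integral_FTC_line c (fun x => der_atan_scaled x e0)).
- exact: integrable_poisson.
- exact: atan_scaled_cvg.
Qed.


(** The primitive is the real part of [exp ((e + i a) s + i A) / (e + i a)]. *)
Lemma der_exp_cos (e A a x : R) : e ^+ 2 + a ^+ 2 != 0 -> is_derive x 1
  (fun s => expR (e * s) * (e * cos (A + a * s) + a * sin (A + a * s)) / (e ^+ 2 + a ^+ 2))
  (expR (e * x) * cos (A + a * x)).
Proof. move=> d0; der_tac.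
by field. Qed.

Lemma continuous_exp_cos (e A a : R) : continuous (fun s => expR (e * s) * cos (A + a * s)).
Proof.
pose df (x : R) := expR (e * x) * (e * 1) * cos (A + a * x) + expR (e * x) * (- sin (A + a * x) * (a * 1)).
apply: (@der_continuous _ _ df) => x; by der_tac; rewrite /df; ring.
Qed.

(** The phase [A] receives the contribution of the other coordinates when a cosine on [R^3] is
    integrated one coordinate at a time. *)
Definition damped (e A a s : R) := expR (- (e * `|s|)) * cos (A + a * s).

Lemma continuous_damped e A a : continuous (damped e A a).
Proof.
move=> s; apply: cvgM.
  apply: (@continuous_comp _ _ _ (fun s : R => - (e * `|s|)) expR); last exact: continuous_expR.
  by apply: cvgN; apply: cvgMr; exact: norm_continuous.
apply: (@continuous_comp _ _ _ (fun s : R => A + a * s) cos); last exact: continuous_cos.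
by apply: cvgD; [exact: cvg_cst|apply: cvgMr].
Qed.

Lemma integral_damped_segn (e A a : R) (n : nat) : 0 < e -> (0 < n)%N ->
  (\int[leb]_(s in segn n) (damped e A a s)%:E =
  ((2 * e * cos A
   + expR (- (e * n%:R)) * (- (e * cos (A + a * n%:R)) + a * sin (A + a * n%:R))
   - expR (- (e * n%:R)) * (e * cos (A + a * - n%:R) + a * sin (A + a * - n%:R)))
  / (e ^+ 2 + a ^+ 2))%:E)%E.
Proof.
move=> e0 n0; have nR : (0 : R) < n%:R by rewrite ltr0n.
have d0 : e ^+ 2 + a ^+ 2 != 0 by rewrite gt_eqF// ltr_wpDr ?sqr_ge0 ?exprn_gt0.
(* Splitting at 0 resolves [|s|]: the same primitive serves with [e] on the left and [- e] on the
   right. *)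
have -> : segn n = `[- n%:R, 0] `|` `]0, n%:R] :> set R.
  by rewrite /segn (@itv_bndbnd_setU _ _ _ (BRight 0))// bnd_simp ?oppr_le0// ltW.
have md D : measurable_fun D (damped e A a : measurableTypeR R -> R).
  by apply: measurable_funTS; apply: continuous_measurable_fun; exact: continuous_damped.
rewrite integral_setU_EFin//; last first.
  apply/disj_setPS => x [] /=; rewrite !in_itv/=; lra.
have -> : (\int[leb]_(s in `[(- n%:R)%R, 0%R]) (damped e A a s)%:E =
    \int[leb]_(s in `[(- n%:R)%R, 0%R]) (expR (e * s) * cos (A + a * s))%:E)%E.
  apply: eq_integral => s; rewrite inE/= in_itv/= => /andP[_ s0].
  by rewrite /damped ler0_norm// mulrN opprK.
rewrite integral_itv_obnd_cbnd; last by apply/measurable_EFinP; exact: md.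
have -> : (\int[leb]_(s in `[0%R, n%:R]) (damped e A a s)%:E =
    \int[leb]_(s in `[0%R, n%:R]) (expR (- e * s) * cos (A + a * s))%:E)%E.
  apply: eq_integral => s; rewrite inE/= in_itv/= => /andP[s0 _].
  by rewrite /damped ger0_norm// mulNr.
have D := fun e' => @der_exp_cos e' A a.
rewrite (FTC_segment _ _ (fun x => D e x d0)) ?oppr_lt0//; last exact: continuous_exp_cos.
rewrite (FTC_segment _ _ (fun x => D (- e) x _)) ?sqrrN//; last exact: continuous_exp_cos.
rewrite -EFinD; congr EFin; rewrite !mulr0 !expR0 !addr0 ?mulNr ?mulrN.
by field.
Qed.

Lemma integrable_exp_abs (e : R) : 0 < e ->
  leb.-integrable setT (EFin \o (fun s : R => expR (- (e * `|s|)))).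
Proof.
move=> e0; have E : (fun s : R => expR (- (e * `|s|))) = damped e 0 0.
  by apply/funext => s; rewrite /damped mul0r addr0 cos0 mulr1.
have c := @continuous_damped e 0 0.
rewrite E; apply: (@ge0_integrable_line _ (2 / e)).
- exact: continuous_measurable_fun.
- by move=> s; rewrite -E expR_ge0.
- move=> n n0; rewrite integral_damped_segn// lee_fin !mul0r !add0r cos0.
  rewrite expr0n/= !addr0 !mulr1.
  rewrite ler_pdivrMr ?exprn_gt0//.
  have := expR_ge0 (- (e * n%:R)); set X := expR _ => X0.
  have -> : 2 / e * e ^+ 2 = 2 * e by field; rewrite gt_eqF.
  nra.
Qed.

Lemma integrable_damped (e A a : R) : 0 < e ->
  leb.-integrable setT (EFin \o damped e A a).
Proof.
move=> e0; apply: le_integrable (integrable_exp_abs e0) => //.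
  by apply/measurable_EFinP; apply: continuous_measurable_fun; exact: continuous_damped.
move=> x _; rewrite /= lee_fin normrM ger0_norm ?expR_ge0//.
rewrite ler_piMr ?expR_ge0//.
by rewrite ler_norml cos_geN1 cos_le1.
Qed.

(** The [sin A] part is odd in [s] and cancels; the boundary terms at [n] and [- n] are bounded
    factors times [exp (- e n)]. *)
Lemma integral_damped (e A a : R) : 0 < e ->
  (\int[leb]_s (damped e A a s)%:E = (cos A * (2 * e / (e ^+ 2 + a ^+ 2)))%:E)%E.
Proof.
move=> e0; have h := cvg_integral_segments (@integrable_damped e A a e0).
apply: (cvg_unique _ h) => //.
set d := e ^+ 2 + a ^+ 2.
have d0 : d != 0 by rewrite gt_eqF// ltr_wpDr ?sqr_ge0 ?exprn_gt0.
pose X (n : nat) : R := expR (- (e * n%:R)).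
have X0 : X n @[n --> \oo] --> (0 : R).
  apply: (cvg_comp _ (fun y : R => expR (- (e * y))) (@cvgr_idn R)).
  exact: (cvg_comp _ _ (gt0_cvgMry e0 cvg_id) (@cvgr_expR R)).
have bnd (b : nat -> R) M : (forall n, `|b n| <= M) -> X n * b n @[n --> \oo] --> (0 : R).
  move=> bM; have XM : X n * M @[n --> \oo] --> (0 : R) by rewrite -(mul0r M); apply: cvgMl.
  apply/norm_cvg0P; apply: (squeeze_cvgr _ (cvg_cst 0) XM).
  apply: nearW => n; rewrite normr_ge0/= normrM [X in X * _]ger0_norm ?expR_ge0//.
  by rewrite ler_wpM2l ?expR_ge0.
have cb y : `|cos y| <= 1 :> R by rewrite ler_norml cos_geN1 cos_le1.
have sb y : `|sin y| <= 1 :> R by rewrite ler_norml sin_geN1 sin_le1.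
pose Y (n : nat) : R := (2 * e * cos A
   + X n * (- (e * cos (A + a * n%:R)) + a * sin (A + a * n%:R))
   - X n * (e * cos (A + a * - n%:R) + a * sin (A + a * - n%:R))) / d.
have F : Y n @[n --> \oo]
   --> (2 * e * cos A + 0 - 0) / d.
  apply: cvgMl; apply: cvgB; first apply: cvgD; first exact: cvg_cst.
  - apply: (bnd _ (e + `|a|)) => n.
    rewrite (le_trans (ler_normD _ _))// lerD// ?normrN normrM.
      by rewrite (gtr0_norm e0) ler_piMr// ltW.
    by rewrite ler_piMr.
  - apply: (bnd _ (e + `|a|)) => n.
    rewrite (le_trans (ler_normD _ _))// lerD// ?normrN normrM.
      by rewrite (gtr0_norm e0) ler_piMr// ltW.
    by rewrite ler_piMr.
have -> : cos A * (2 * e / d) = (2 * e * cos A + 0 - 0) / d by field.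
have {}F : (Y n)%:E @[n --> \oo] --> ((2 * e * cos A + 0 - 0) / d)%:E.
  by apply: cvg_EFin => //; exact: nearW.
apply: cvg_trans F; apply: near_eq_cvg; near=> n.
rewrite integral_damped_segn//; near: n; exact: nbhs_infty_gt.
Unshelve. all: by end_near. Qed.

End integrals_on_the_line.

(** * Fourier transforms and finite differences *)

Section finite_differences.
Context {R : realType}.
Implicit Types (m : mR3 R -> R) (a v x : mR3 R).

Definition scale3 (s : R) (v : mR3 R) : mR3 R := (s * v.1.1, s * v.1.2, s * v.2).

(** The difference is applied to the function before recursing, so that inductions on [n] generalize
    over [m]. *)
Fixpoint fdiff (a : mR3 R) (n : nat) (m : mR3 R -> R) : mR3 R -> R :=
  if n is n'.+1 then fdiff a n' (fun y => m (translate3 a y) - m y) else m.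

Fixpoint fdiff1 (h : R) (n : nat) (g : R -> R) : R -> R :=
  if n is n'.+1 then fdiff1 h n' (fun y => g (y + h) - g y) else g.

Lemma translate3_line v (s h : R) x :
  translate3 (scale3 h v) (translate3 (scale3 s v) x) = translate3 (scale3 (s + h) v) x.
Proof. by rewrite /translate3/scale3/=; congr (_, _, _); ring. Qed.

Lemma translate3_0 v x : translate3 (scale3 0 v) x = x.
Proof. by case: x => [[? ?] ?]; rewrite /translate3/scale3/= !mul0r !addr0. Qed.

Lemma fdiff_line n m v h x s :
  fdiff (scale3 h v) n m (translate3 (scale3 s v) x) =
  fdiff1 h n (fun s => m (translate3 (scale3 s v) x)) s.
Proof.
elim: n m s => [//|n IH] m s /=; rewrite IH; congr (fdiff1 _ _ _ _).
by apply/funext => y; rewrite translate3_line.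
Qed.

Lemma fdiff1_bound n (G : nat -> R -> R) (h x D : R) : 0 < h ->
  (forall k, (k < n)%N -> forall y : R, is_derive y 1 (G k) (G k.+1 y)) ->
  (forall y, x <= y <= x + n%:R * h -> `|G n y| <= D) ->
  `|fdiff1 h n (G 0%N) x| <= h ^+ n * D.
Proof.
move=> h0; elim: n G D => [|n IH] G D dG GD /=.
  by rewrite expr0 mul1r; apply: GD; rewrite mul0r addr0 lexx.
have -> : h ^+ n.+1 * D = h ^+ n * (h * D) by rewrite exprS; ring.
apply: (IH (fun k y => G k (y + h) - G k y) (h * D)).
  move=> k kn y; have kn' : (k < n.+1)%N by rewrite ltnS ltnW.
  apply: der_add; last by apply: der_opp; exact: dG.
  have h1 : is_derive y (1 : R) (fun z : R => z + h) 1.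
    by der_tac; rewrite ?addr0.
  by apply: der_eq (der_comp (dG k kn' _) h1) _; rewrite mulr1.
move=> y /andP[xy yn].
have [] := @MVT_segment R (G n) (G n.+1) y (y + h).
- by rewrite lerDl ltW.
- by move=> z _; exact: dG.
- by apply: continuous_subspaceT; exact: (der_continuous (dG n (ltnSn n))).
move=> c; rewrite in_itv/= => /andP[yc cy] ->.
rewrite (_ : y + h - y = h); last by ring.
rewrite normrM (gtr0_norm h0) mulrC ler_wpM2l//; first exact: ltW.
apply: GD; rewrite (le_trans xy yc)/= (le_trans cy)//.
by rewrite -natr1 mulrDl mul1r addrA lerD2r.
Qed.

Lemma measurable_fdiff a n m : measurable_fun setT m ->
  measurable_fun setT (fdiff a n m).
Proof.
elim: n m => [//|n IH] m mm /=; apply: IH; apply: measurable_funB => //.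
exact: (measurableT_comp mm (measurable_translate3 a)).
Qed.

Lemma integrable_translate a m : mu3.-integrable setT (EFin \o m) ->
  mu3.-integrable setT (EFin \o (fun y => m (translate3 a y))).
Proof. exact: (integrable_preserving (measurable_translate3 a) (mu3_translate a)). Qed.

Lemma integrable_fdiff a n m : mu3.-integrable setT (EFin \o m) ->
  mu3.-integrable setT (EFin \o fdiff a n m).
Proof.
elim: n m => [//|n IH] m mi /=; apply: IH.
have := integrableB measurableT (integrable_translate a mi) mi.
by apply: eq_integrable => // x _.
Qed.

Lemma Rintegral_translate a m : measurable_fun setT m ->
  \int[mu3]_x m (translate3 a x) = \int[mu3]_x m x.
Proof. exact: (Rintegral_preserving (measurable_translate3 a) (mu3_translate a)). Qed.

End finite_differences.

Section transforms.
Context {R : realType}.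
Implicit Types (m : mR3 R -> R) (a v x : mR3 R) (th : R).

(* [th = 0] and [th = - pi / 2] give the cosine and sine transforms. *)
Definition ctrans th m (x : mR3 R) : R :=
  \int[mu3]_xi (cos (dot3 xi x + th) * m xi).

Lemma norm_cos_le1 (y : R) : `|cos y| <= 1.
Proof. by rewrite ler_norml cos_geN1 cos_le1. Qed.

Lemma measurable_dot3 x : measurable_fun setT (fun xi : mR3 R => dot3 xi x).
Proof.
apply: measurable_funD; first apply: measurable_funD.
- by apply: measurable_funM => //; apply: measurableT_comp => //; exact: measurableT_comp.
- by apply: measurable_funM => //; apply: measurableT_comp => //; exact: measurableT_comp.
- by apply: measurable_funM => //; exact: measurableT_comp.
Qed.

Lemma measurable_cosR : measurable_fun setT (@cos R : measurableTypeR R -> measurableTypeR R).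
Proof. by apply: continuous_measurable_fun; exact: continuous_cos. Qed.

Lemma measurable_cos_dot3 x th :
  measurable_fun setT (fun xi : mR3 R => cos (dot3 xi x + th)).
Proof.
apply: (measurableT_comp measurable_cosR).
by apply: measurable_funD => //; exact: measurable_dot3.
Qed.

Lemma integrable_cosM d (T : measurableType d) (mu : {measure set T -> \bar R})
    (g m : T -> R) : measurable_fun setT g ->
  mu.-integrable setT (EFin \o m) ->
  mu.-integrable setT (EFin \o (fun y => cos (g y) * m y)).
Proof.
move=> mg mi; have mm : measurable_fun setT m by apply/measurable_EFinP; exact: measurable_int mi.
apply: le_integrable mi => //.
  apply/measurable_EFinP; apply: measurable_funM => //.
  exact: (measurableT_comp measurable_cosR).
by move=> x _; rewrite /= lee_fin normrM ler_piMl// norm_cos_le1.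
Qed.

Lemma integrable_ctrans th m x : mu3.-integrable setT (EFin \o m) ->
  mu3.-integrable setT (EFin \o (fun xi => cos (dot3 xi x + th) * m xi)).
Proof.
move=> mi; apply: (@integrable_cosM _ (mR3 R) mu3 (fun xi => dot3 xi x + th) m _ mi).
by apply: measurable_funD => //; exact: measurable_dot3.
Qed.

Lemma ctrans_le th m x : mu3.-integrable setT (EFin \o m) ->
  `|ctrans th m x| <= \int[mu3]_xi `|m xi|.
Proof.
move=> mi; apply: le_trans (le_normr_Rintegral measurableT (integrable_ctrans th x mi)) _.
apply: le_Rintegral => //.
- by apply: integrable_norm; exact: integrable_ctrans.
- exact: integrable_norm.
- by move=> xi _; rewrite normrM ler_piMl// norm_cos_le1.
Qed.

Lemma dot3_translate a xi x : dot3 (translate3 a xi) x = dot3 xi x + dot3 a x.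
Proof. by rewrite /dot3/translate3/=; ring. Qed.

Lemma dot3_scale h v x : dot3 (scale3 h v) x = h * dot3 v x.
Proof. by rewrite /dot3/scale3/=; ring. Qed.

(* Translating [m] by a vector [a] with [a . x = +- pi] shifts the phase by half a
   period; finite differences thus play the role of derivatives. *)
Lemma ctrans_translate th a m x : `|dot3 a x| = pi ->
  mu3.-integrable setT (EFin \o m) ->
  ctrans th (fun xi => m (translate3 a xi)) x = - ctrans th m x.
Proof.
move=> ax mi; have mm : measurable_fun setT m by apply/measurable_EFinP; exact: measurable_int mi.
rewrite /ctrans -[X in _ = - X](Rintegral_translate a); last first.
  by apply: measurable_funM => //; exact: measurable_cos_dot3.
rewrite -[RHS]mulN1r -RintegralZl//; last first.
  have := integrable_translate a (integrable_ctrans th x mi).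
  by apply: eq_integrable.
apply: eq_Rintegral => xi _; rewrite dot3_translate mulrA; congr (_ * _).
move: (dot3 xi x) (dot3 a x) ax => D A; case: (ger0P A) => _ => [->|Api].
  by rewrite addrAC cosDpi mulN1r opprK.
by rewrite (_ : D + th = D + A + th + pi); [rewrite cosDpi mulN1r|rewrite -Api; ring].
Qed.

(** In each difference the translated term contributes [-1], by [ctrans_translate], and the
    subtracted one another [-1]. *)
Lemma ctrans_fdiff th a n m x : `|dot3 a x| = pi ->
  mu3.-integrable setT (EFin \o m) ->
  ctrans th (fdiff a n m) x = (- 2) ^+ n * ctrans th m x.
Proof.
move=> ax; elim: n m => [|n IH] m mi /=; first by rewrite expr0 mul1r.
have mt := integrable_translate a mi.
rewrite IH; last first.
  by have := integrableB measurableT mt mi; exact: eq_integrable.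
suff -> : ctrans th (fun y => m (translate3 a y) - m y) x = - 2 * ctrans th m x.
  by rewrite exprSr mulrA.
rewrite /ctrans; under eq_Rintegral do rewrite mulrBr.
rewrite RintegralB//; [|exact: (integrable_ctrans th x mt)|exact: integrable_ctrans].
have := ctrans_translate th ax mi; rewrite /ctrans => ->; ring.
Qed.

Lemma le_cube_addr1_sqr (y : R) : 1 <= y ^+ 2 -> (1 + y ^+ 2) ^+ 3 <= 8 * y ^+ 6.
Proof.
rewrite (_ : y ^+ 6 = (y ^+ 2) ^+ 3); last by rewrite -exprM.
move: (y ^+ 2) => z z1; rewrite (_ : 8 * z ^+ 3 = (2 * z) ^+ 3); last by ring.
rewrite lerXn2r// ?nnegrE; lra.
Qed.

(* Take [h = pi / |x_v|]: the bound is [B * pi^6 <= 4^6 * B] on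
   [2^6 * |ctrans th m x| * (rho |x_v|)^6], and [(1 + y^2)^3 <= 8 * y^6] for
   [y >= 1], whence [512 = 8 * 4^6 / 2^6]. *)
Lemma ctrans_decay_direction th m v x (B rho : R) : 0 < rho -> 0 <= B ->
  mu3.-integrable setT (EFin \o m) ->
  \int[mu3]_xi `|m xi| <= B ->
  (forall h : R, 0 < h <= pi * rho ->
     \int[mu3]_xi `|fdiff (scale3 h v) 6 m xi| <= B * (h / rho) ^+ 6) ->
  `|ctrans th m x| * (1 + (rho * dot3 v x) ^+ 2) ^+ 3 <= 512 * B.
Proof.
move=> rho0 B0 mi mB dB; set d := dot3 v x.
have TB := le_trans (ctrans_le th x mi) mB.
have -> : (rho * d) ^+ 2 = (rho * `|d|) ^+ 2 by rewrite !exprMn real_normK// num_real.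
set T := `|ctrans th m x| in TB *; have T0 : 0 <= T by exact: normr_ge0.
have y0 : 0 <= rho * `|d| by rewrite mulr_ge0// ltW.
(* Below 1 the trivial bound [T <= B] is enough, the polynomial being at most 8; from 1 on, the step
   [pi / |d|] meets the constraint [h <= pi * rho]. *)
have [y1|y1] := ltP (rho * `|d|) 1.
  apply: (@le_trans _ _ (T * 8)); last by nra.
  rewrite ler_wpM2l//; have : 1 + (rho * `|d|) ^+ 2 <= 2 by rewrite (_ : 2 = 1 + 1)// lerD2l expr_le1// ltW.
  move=> h; have -> : 8 = 2 ^+ 3 :> R by rewrite -natrX.
  by rewrite lerXn2r// nnegrE ?addr_ge0 ?sqr_ge0.
have d0 : 0 < `|d| by rewrite -(pmulr_rgt0 _ rho0) (lt_le_trans _ y1).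
pose h : R := pi / `|d|.
have h0 : 0 < h by rewrite divr_gt0 ?pi_gt0.
have hp : `|dot3 (scale3 h v) x| = pi.
  by rewrite dot3_scale -/d normrM (gtr0_norm h0) /h mulfVK// gt_eqF.
have hr : h <= pi * rho.
  by rewrite /h ler_pM2l ?pi_gt0// -[leLHS]mul1r ler_pdivrMr.
have := ctrans_le th x (integrable_fdiff (scale3 h v) 6 mi).
rewrite ctrans_fdiff// normrM normrX normrN normr_nat -/T.
have hh : 0 < h <= pi * rho by rewrite h0 hr.
move=> /le_trans/(_ (dB h hh)) H.
have {H} : 64 * T * (rho * `|d|) ^+ 6 <= B * pi ^+ 6.
  have -> : B * pi ^+ 6 = B * (h / rho) ^+ 6 * (rho * `|d|) ^+ 6.
    rewrite -mulrA -exprMn /h; congr (_ * _ ^+ _); field.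
    by rewrite !gt_eqF.
  rewrite ler_wpM2r ?exprn_ge0//; apply: le_trans H.
  by rewrite -natrX.
set y := rho * `|d| in y1 *.
have p6 : (pi : R) ^+ 6 <= 4096.
  have -> : 4096 = 4 ^+ 6 :> R by rewrite -natrX.
  by rewrite lerXn2r ?nnegrE ?pi_ge0//; have := @pihalf_lt2 R; lra.
have y2 : 1 <= y ^+ 2 by rewrite exprn_ege1.
have y3 := le_cube_addr1_sqr y2.
move=> H; apply: (@le_trans _ _ (T * (8 * y ^+ 6))); first by rewrite ler_wpM2l.
have : B * pi ^+ 6 <= B * 4096 by rewrite ler_wpM2l.
move: H; rewrite (_ : 64 * T * y ^+ 6 = 64 * (T * y ^+ 6)); last by ring.
rewrite (_ : T * (8 * y ^+ 6) = 8 * (T * y ^+ 6)); last by ring.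
by move: (T * y ^+ 6) (B * pi ^+ 6) => Z W; clear; lra.
Qed.

Definition weight3 (rho : R) (x : mR3 R) : R :=
  (1 + (rho * x.1.1) ^+ 2)^-1 * (1 + (rho * x.1.2) ^+ 2)^-1 * (1 + (rho * x.2) ^+ 2)^-1.

Lemma addr1_sqr_gt0 (y : R) : 0 < 1 + y ^+ 2.
Proof. by rewrite ltr_wpDr ?sqr_ge0. Qed.

Lemma weight3_gt0 rho x : 0 < weight3 rho x.
Proof. by rewrite /weight3 !mulr_gt0// invr_gt0 addr1_sqr_gt0. Qed.

(** The three bounds are multiplied and a cube root is taken: decay of order six in each single
    coordinate becomes an integrable product over the three. *)
Lemma le_weight3 (T C a b c : R) : 0 <= T -> 0 <= C -> 0 < a -> 0 < b -> 0 < c ->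
  T * a ^+ 3 <= C -> T * b ^+ 3 <= C -> T * c ^+ 3 <= C ->
  T <= C * (a^-1 * b^-1 * c^-1).
Proof.
move=> T0 C0 a0 b0 c0 Ta Tb Tc.
rewrite -!invfM -[leRHS]/(C / _) ler_pdivlMr ?mulr_gt0//.
have p0 : 0 <= T * (a * b * c) by rewrite !mulr_ge0// ltW.
rewrite -(@ler_pXn2r _ 3)// ?nnegrE//.
have -> : (T * (a * b * c)) ^+ 3 = (T * a ^+ 3) * (T * b ^+ 3) * (T * c ^+ 3) by ring.
have -> : C ^+ 3 = C * C * C by ring.
have n (z : R) : 0 < z -> 0 <= T * z ^+ 3 by move=> z0; rewrite mulr_ge0 ?exprn_ge0// ltW.
apply: ler_pM => //; [|exact: n|]; last by apply: ler_pM => //; exact: n.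
by apply: mulr_ge0; exact: n.
Qed.

Definition e1 : mR3 R := (1, 0, 0).
Definition e2 : mR3 R := (0, 1, 0).
Definition e3 : mR3 R := (0, 0, 1).

Lemma ctrans_decay th m (B rho : R) : 0 < rho -> 0 <= B ->
  mu3.-integrable setT (EFin \o m) ->
  \int[mu3]_xi `|m xi| <= B ->
  (forall v, v \in [:: e1; e2; e3] -> forall h : R, 0 < h <= pi * rho ->
     \int[mu3]_xi `|fdiff (scale3 h v) 6 m xi| <= B * (h / rho) ^+ 6) ->
  forall x, `|ctrans th m x| <= 512 * B * weight3 rho x.
Proof.
move=> rho0 B0 mi mB dB x.
have D v vs := @ctrans_decay_direction th m v x B rho rho0 B0 mi mB (dB v vs).
rewrite /weight3; apply: (@le_weight3 _ _ (1 + (rho * x.1.1) ^+ 2)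
  (1 + (rho * x.1.2) ^+ 2) (1 + (rho * x.2) ^+ 2)); [exact: normr_ge0|
  exact: (mulr_ge0 (ler0n _ 512) B0)|
  exact: addr1_sqr_gt0|exact: addr1_sqr_gt0|exact: addr1_sqr_gt0| | | ].
- by have := D e1; rewrite /dot3/= mul1r !mul0r !addr0; apply; rewrite !inE eqxx.
- by have := D e2; rewrite /dot3/= mul1r !mul0r add0r !addr0; apply; rewrite !inE eqxx orbT.
- by have := D e3; rewrite /dot3/= mul1r !mul0r !add0r; apply; rewrite !inE eqxx !orbT.
Qed.

End transforms.

(** * Product integrals, Cauchy kernels and Fourier inversion *)

Section tensor_integrals.
Context {R : realType}.
Notation leb := (@lebesgue_measure R).
Notation mR := (measurableTypeR R).

Definition tensor3 (f1 f2 f3 : R -> R) (x : mR3 R) : R := f1 x.1.1 * f2 x.1.2 * f3 x.2.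

Lemma Rintegral_tensor d1 d2 (T1 : measurableType d1) (T2 : measurableType d2)
    (m1 : {sigma_finite_measure set T1 -> \bar R})
    (m2 : {sigma_finite_measure set T2 -> \bar R}) (f : T1 -> R) (g : T2 -> R) :
  m1.-integrable setT (EFin \o f) -> m2.-integrable setT (EFin \o g) ->
  \int[(m1 \x m2)%E]_z (f z.1 * g z.2) = \int[m1]_x f x * \int[m2]_y g y.
Proof.
move=> fi gi; rewrite -(Rintegral12 (integrable_tensor fi gi))/=.
rewrite -RintegralZr//; apply: eq_Rintegral => x _; exact: RintegralZl.
Qed.

Variables f1 f2 f3 : R -> R.
Hypothesis f1i : leb.-integrable setT (EFin \o f1).
Hypothesis f2i : leb.-integrable setT (EFin \o f2).
Hypothesis f3i : leb.-integrable setT (EFin \o f3).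

Lemma integrable_tensor3 : mu3.-integrable setT (EFin \o tensor3 f1 f2 f3).
Proof. exact: (@integrable_tensor _ _ _ _ _ mu2 leb _ _ (integrable_tensor f1i f2i) f3i). Qed.

Lemma Rintegral_tensor3 : \int[mu3]_x tensor3 f1 f2 f3 x =
  \int[leb]_s f1 s * \int[leb]_s f2 s * \int[leb]_s f3 s.
Proof.
rewrite -(Rintegral_tensor f1i f2i).
exact: (@Rintegral_tensor _ _ _ _ mu2 leb _ _ (integrable_tensor f1i f2i) f3i).
Qed.

End tensor_integrals.

Section weights.
Context {R : realType}.
Notation leb := (@lebesgue_measure R).
Notation mR := (measurableTypeR R).

(** The Fourier transform of [exp (- e |s|)], that is, [2 pi] times the Poisson kernel of width
    [e]. *)
Definition cauchy (e s : R) : R := 2 * e / (e ^+ 2 + s ^+ 2).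

Lemma cauchyE e : cauchy e = (fun s => 2 * (e / (e ^+ 2 + s ^+ 2))).
Proof. by apply/funext => s; rewrite /cauchy mulrA. Qed.

Lemma cauchy_ge0 e s : 0 < e -> 0 <= cauchy e s.
Proof. by move=> e0; rewrite /cauchy divr_ge0 ?addr_ge0 ?sqr_ge0// mulr_ge0// ltW. Qed.

Lemma integrable_cauchy e : 0 < e -> leb.-integrable setT (EFin \o cauchy e).
Proof.
move=> e0; rewrite cauchyE.
have := integrableZl measurableT 2 (integrable_poisson e0).
by apply: eq_integrable => // s _; rewrite /= EFinM.
Qed.

Lemma Rintegral_cauchy e : 0 < e -> \int[leb]_s cauchy e s = 2 * pi.
Proof.
move=> e0; rewrite cauchyE RintegralZl//; last exact: integrable_poisson.
by congr (_ * _); rewrite /Rintegral integral_poisson.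
Qed.

Lemma weight3E rho : weight3 rho = tensor3 (fun s : R => (1 + (rho * s) ^+ 2)^-1)
  (fun s : R => (1 + (rho * s) ^+ 2)^-1) (fun s : R => (1 + (rho * s) ^+ 2)^-1).
Proof. by []. Qed.

Lemma weight1E rho : 0 < rho -> (fun s : R => (1 + (rho * s) ^+ 2)^-1) =
  (fun s => (2 * rho)^-1 * cauchy rho^-1 s).
Proof.
move=> r0; apply/funext => s; rewrite /cauchy.
have r1 : rho != 0 by rewrite gt_eqF.
have h : rho^-1 ^+ 2 + s ^+ 2 = rho ^- 2 * (1 + (rho * s) ^+ 2) by field.
have p := addr1_sqr_gt0 (rho * s).
by rewrite h; field; rewrite r1 gt_eqF.
Qed.


Lemma integrable_weight1 rho : 0 < rho ->
  leb.-integrable setT (EFin \o (fun s : R => (1 + (rho * s) ^+ 2)^-1)).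
Proof.
move=> r0; rewrite weight1E//.
have r1 : 0 < rho^-1 by rewrite invr_gt0.
have := integrableZl measurableT (2 * rho)^-1 (integrable_cauchy r1).
by apply: eq_integrable => // s _; rewrite /= EFinM.
Qed.

Lemma Rintegral_weight1 rho : 0 < rho ->
  \int[leb]_s (1 + (rho * s) ^+ 2)^-1 = pi / rho.
Proof.
move=> r0; have r1 : 0 < rho^-1 by rewrite invr_gt0.
rewrite weight1E// RintegralZl//; last exact: integrable_cauchy.
by rewrite Rintegral_cauchy//; field; rewrite gt_eqF.
Qed.

Lemma integrable_weight3 rho : 0 < rho -> mu3.-integrable setT (EFin \o (@weight3 R rho)).
Proof.
by move=> r0; have w := integrable_weight1 r0; exact: (integrable_tensor3 w w w).
Qed.

Lemma Rintegral_weight3 rho : 0 < rho ->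
  \int[mu3]_x (@weight3 R rho x) = (pi / rho) ^+ 3.
Proof.
move=> r0; have w := integrable_weight1 r0; rewrite weight3E Rintegral_tensor3//.
by rewrite Rintegral_weight1//; ring.
Qed.

(** For [|s| <= t] the first factor is at most [t]. For [|s| > t] the kernel of width [e = t^3] is
    at most of order [e / t^2 = t] times the kernel of width 1; the cube is chosen for this linear
    rate. *)
Lemma min1_cauchy_le (t s : R) : 0 < t <= 1 ->
  Num.min 1 `|s| * cauchy (t ^+ 3) s <=
  t * cauchy (t ^+ 3) s + 2 * t * cauchy 1 s.
Proof.
move=> /andP[t0 t1]; have e0 : 0 < t ^+ 3 by rewrite exprn_gt0.
have c0 := cauchy_ge0 s e0; have c1 := cauchy_ge0 s (ltr01 : 0 < 1 :> R).
have [st|ts] := lerP `|s| t.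
  have h : Num.min 1 `|s| <= t by rewrite ge_min st orbT.
  by have := ler_wpM2r c0 h; have := mulr_ge0 (ltW t0) c1; lra.
have ts2 : t ^+ 2 <= s ^+ 2 by rewrite -[leRHS]real_normK ?num_real// lerXn2r ?nnegrE// ltW.
have h : Num.min 1 `|s| <= 1 by rewrite ge_min lexx.
apply: (@le_trans _ _ (cauchy (t ^+ 3) s)); first by rewrite ler_piMl.
have t2 : 0 < t ^+ 2 by rewrite exprn_gt0.
have t21 : t ^+ 2 <= 1 by rewrite expr_le1// ltW.
suff : cauchy (t ^+ 3) s <= 2 * t * cauchy 1 s by move: (mulr_ge0 (ltW t0) c0); lra.
rewrite /cauchy expr1n -exprM.
have d1 : 0 < 1 + s ^+ 2 by exact: addr1_sqr_gt0.
have d2 : 0 < t ^+ (3 * 2) + s ^+ 2 by rewrite ltr_wpDl ?exprn_ge0 1?ltW// (lt_le_trans t2).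
rewrite mulrA ler_pdivlMr// mulrAC ler_pdivrMr//.
have -> : t ^+ (3 * 2) = (t ^+ 2) ^+ 3 by rewrite -exprM.
have key : t ^+ 2 * (1 + s ^+ 2) <= 2 * ((t ^+ 2) ^+ 3 + s ^+ 2).
  have u3 : 0 <= (t ^+ 2) ^+ 3 by rewrite exprn_ge0// ltW.
  have := ler_wpM2r (sqr_ge0 s) t21.
  by move: u3 ts2; move: (t ^+ 2) (s ^+ 2) => u v; clear; lra.
rewrite [leLHS](_ : _ = 2 * t * (t ^+ 2 * (1 + s ^+ 2))); last by ring.
rewrite [leRHS](_ : _ = 2 * t * (2 * ((t ^+ 2) ^+ 3 + s ^+ 2))); last by ring.
by rewrite ler_wpM2l// mulr_ge0// ltW.
Qed.

Lemma measurable_min1 : measurable_fun setT (fun s : mR => Num.min 1 `|s| : mR).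
Proof. by apply: measurable_minr => //; exact: normr_measurable. Qed.

Lemma integrable_min1_cauchy (e : R) : 0 < e ->
  leb.-integrable setT (EFin \o (fun s => Num.min 1 `|s| * cauchy e s)).
Proof.
move=> e0; have ci := integrable_cauchy e0.
apply: le_integrable ci => //.
  apply/measurable_EFinP; apply: measurable_funM; first exact: measurable_min1.
  by apply/measurable_EFinP; exact: measurable_int (integrable_cauchy e0).
move=> s _; rewrite /= lee_fin normrM ler_piMl// ger0_norm ?ge_min ?lexx//.
Qed.

(** Each Cauchy kernel has mass [2 pi], whence [2 pi t + 4 pi t]. *)
Lemma Rintegral_min1_cauchy_le (t : R) : 0 < t <= 1 ->
  \int[leb]_s (Num.min 1 `|s| * cauchy (t ^+ 3) s) <= 6 * pi * t.
Proof.
move=> t01; have /andP[t0 t1] := t01; have e0 : 0 < t ^+ 3 by rewrite exprn_gt0.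
have i1 : leb.-integrable setT (EFin \o (fun s => t * cauchy (t ^+ 3) s)).
  have := integrableZl measurableT t (integrable_cauchy e0).
  by apply: eq_integrable => // s _; rewrite /= EFinM.
have i2 : leb.-integrable setT (EFin \o (fun s : R => 2 * t * cauchy 1 s)).
  have := integrableZl measurableT (2 * t) (integrable_cauchy (ltr01 : 0 < 1 :> R)).
  by apply: eq_integrable => // s _; rewrite /= EFinM.
apply: (@le_trans _ _ (\int[leb]_s (t * cauchy (t ^+ 3) s + 2 * t * cauchy 1 s))).
  apply: le_Rintegral => //.
  - exact: integrable_min1_cauchy.
  - by have := integrableD measurableT i1 i2; exact: eq_integrable.
  - by move=> s _; exact: min1_cauchy_le.
have c1 := integrable_cauchy e0; have c2 := integrable_cauchy (ltr01 : 0 < 1 :> R).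
have E1 : \int[leb]_s (t * cauchy (t ^+ 3) s) = t * \int[leb]_s cauchy (t ^+ 3) s.
  exact: RintegralZl.
have E2 : \int[leb]_s (2 * t * cauchy 1 s) = 2 * t * \int[leb]_s cauchy 1 s.
  exact: RintegralZl.
by rewrite RintegralD// E1 E2 !Rintegral_cauchy//; lra.
Qed.

End weights.


Section inversion.
Context {R : realType}.
Notation leb := (@lebesgue_measure R).
Notation mR := (measurableTypeR R).

(** A product over the coordinates rather than [exp (- e |x|)], so that its transform is the product
    of three Cauchy kernels. *)
Definition damping (e : R) : mR3 R -> R :=
  tensor3 (fun s => expR (- (e * `|s|))) (fun s => expR (- (e * `|s|)))
          (fun s => expR (- (e * `|s|))).

Definition cauchy3 (e : R) : mR3 R -> R := tensor3 (cauchy e) (cauchy e) (cauchy e).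

Lemma integrable_damping e : 0 < e -> mu3.-integrable setT (EFin \o damping e).
Proof.
by move=> e0; have w := integrable_exp_abs e0; exact: (integrable_tensor3 w w w).
Qed.

Lemma damping_ge0 e x : 0 <= damping e x.
Proof. by rewrite /damping /tensor3 !mulr_ge0// expR_ge0. Qed.

Lemma damping_le1 e x : 0 < e -> damping e x <= 1.
Proof.
move=> e0; have h (s : R) : expR (- (e * `|s|)) <= 1.
  by rewrite -expR0 ler_expR oppr_le0 mulr_ge0// ltW.
by rewrite /damping /tensor3 !mulr_ile1// ?mulr_ge0 ?expR_ge0.
Qed.

Lemma Rintegral_damped (e A a : R) : 0 < e ->
  \int[leb]_s damped e A a s = cos A * cauchy e a.
Proof. by move=> e0; rewrite /Rintegral integral_damped. Qed.

(** Coordinates are integrated from the last to the first, the others acting as a phase. Each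
    integration yields one Cauchy factor and, the damping being even, leaves the cosine of the
    remaining phase. *)
Lemma Rintegral_damping_cos e (z : mR3 R) th : 0 < e ->
  \int[mu3]_x (cos (dot3 x z + th) * damping e x) = cos th * cauchy3 e z.
Proof.
move=> e0.
have i3 : (mu2 \x leb)%E.-integrable setT
    (EFin \o (fun x : mR3 R => cos (dot3 x z + th) * damping e x)).
  exact: (integrable_ctrans th z (integrable_damping e0)).
have E3 := Rintegral12 i3; rewrite -[LHS]E3 {E3}/=.
pose E1 (s : R) : R := expR (- (e * `|s|)).
have E1i : leb.-integrable setT (EFin \o E1) by exact: integrable_exp_abs.
have i2 : (leb \x leb)%E.-integrable setT
   (EFin \o (fun y : mR * mR => cos (y.1 * z.1.1 + y.2 * z.1.2 + th) * (E1 y.1 * E1 y.2))).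
  apply: (integrable_cosM (g := fun y : mR * mR => y.1 * z.1.1 + y.2 * z.1.2 + th)).
    apply: measurable_funD => //; apply: measurable_funD => //.
      by apply: measurable_funM.
    by apply: measurable_funM.
  exact: (integrable_tensor E1i E1i).
transitivity (\int[mu2]_y (cauchy e z.2 * (cos (y.1 * z.1.1 + y.2 * z.1.2 + th) * (E1 y.1 * E1 y.2)))).
  apply: eq_Rintegral => y _.
  rewrite -[LHS]/(\int[leb]_s (cos (y.1 * z.1.1 + y.2 * z.1.2 + s * z.2 + th) *
     (E1 y.1 * E1 y.2 * E1 s))).
  transitivity (\int[leb]_s (E1 y.1 * E1 y.2 * damped e (y.1 * z.1.1 + y.2 * z.1.2 + th) z.2 s)).
    apply: eq_Rintegral => s _; rewrite /damped -/(E1 s).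
    rewrite (_ : y.1 * z.1.1 + y.2 * z.1.2 + s * z.2 + th =
       y.1 * z.1.1 + y.2 * z.1.2 + th + z.2 * s); last by ring.
    by ring.
  rewrite RintegralZl//; last exact: integrable_damped.
  by rewrite Rintegral_damped//; ring.
rewrite RintegralZl//.
have E2 := Rintegral12 i2; rewrite -[X in _ * X = _]E2 {E2}/=.
rewrite /cauchy3 /tensor3 [RHS]mulrA [RHS]mulrC; congr (_ * _).
transitivity (\int[leb]_y (cauchy e z.1.2 * damped e th z.1.1 y)).
  apply: eq_Rintegral => y _.
  transitivity (\int[leb]_s (E1 y * damped e (y * z.1.1 + th) z.1.2 s)).
    apply: eq_Rintegral => s _; rewrite /damped -/(E1 s).
    rewrite (_ : y * z.1.1 + s * z.1.2 + th = y * z.1.1 + th + z.1.2 * s); last by ring.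
    by ring.
  rewrite RintegralZl//; last exact: integrable_damped.
  rewrite Rintegral_damped// /damped -/(E1 y) [th + _]addrC [z.1.1 * y]mulrC; ring.
rewrite RintegralZl//; last exact: integrable_damped.
by rewrite Rintegral_damped//; ring.
Qed.

Lemma integrable_cauchy3 e : 0 < e -> mu3.-integrable setT (EFin \o cauchy3 e).
Proof.
by move=> e0; have w := integrable_cauchy e0; exact: (integrable_tensor3 w w w).
Qed.

Lemma Rintegral_cauchy3 e : 0 < e -> \int[mu3]_x cauchy3 e x = (2 * pi) ^+ 3.
Proof.
move=> e0; have w := integrable_cauchy e0; rewrite Rintegral_tensor3//.
by rewrite Rintegral_cauchy//; ring.
Qed.

Lemma cauchy3_ge0 e x : 0 < e -> 0 <= cauchy3 e x.
Proof.
move=> e0; have c s := cauchy_ge0 s e0.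
by rewrite /cauchy3 /tensor3 (mulr_ge0 (mulr_ge0 (c _) (c _)) (c _)).
Qed.

(* [min 1] keeps this integrable against the product of Cauchy kernels. *)
Definition modulus (x : mR3 R) : R :=
  Num.min 1 `|x.1.1| + Num.min 1 `|x.1.2| + Num.min 1 `|x.2|.

Lemma modulus_cauchy3E e : (fun x => modulus x * cauchy3 e x) =
  (fun x => tensor3 (fun s => Num.min 1 `|s| * cauchy e s) (cauchy e) (cauchy e) x +
    (tensor3 (cauchy e) (fun s => Num.min 1 `|s| * cauchy e s) (cauchy e) x +
    tensor3 (cauchy e) (cauchy e) (fun s => Num.min 1 `|s| * cauchy e s) x)).
Proof. by apply/funext => x; rewrite /modulus/cauchy3/tensor3; ring. Qed.

Lemma integrable_modulus_cauchy3 e : 0 < e ->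
  mu3.-integrable setT (EFin \o (fun x => modulus x * cauchy3 e x)).
Proof.
move=> e0; rewrite modulus_cauchy3E.
have c := integrable_cauchy e0; have mc := integrable_min1_cauchy e0.
have h := integrableD measurableT (integrable_tensor3 mc c c)
  (integrableD measurableT (integrable_tensor3 c mc c) (integrable_tensor3 c c mc)).
by move: h; exact: eq_integrable.
Qed.

Lemma Rintegral_modulus_cauchy3_le t : 0 < t <= 1 ->
  \int[mu3]_x (modulus x * cauchy3 (t ^+ 3) x) <= 3 * (2 * pi) ^+ 2 * (6 * pi * t).
Proof.
move=> t01; have /andP[t0 _] := t01; have e0 : 0 < t ^+ 3 by rewrite exprn_gt0.
have c := integrable_cauchy e0; have mc := integrable_min1_cauchy e0.
rewrite modulus_cauchy3E.
have i1 := integrable_tensor3 mc c c.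
have i2 := integrable_tensor3 c mc c.
have i3 := integrable_tensor3 c c mc.
have i23 : mu3.-integrable setT (EFin \o (fun x => tensor3 (cauchy (t ^+ 3)) (fun s => Num.min 1 `|s| * cauchy (t ^+ 3) s) (cauchy (t ^+ 3)) x +
    tensor3 (cauchy (t ^+ 3)) (cauchy (t ^+ 3)) (fun s => Num.min 1 `|s| * cauchy (t ^+ 3) s) x)).
  by have := integrableD measurableT i2 i3; exact: eq_integrable.
rewrite RintegralD// RintegralD// !Rintegral_tensor3// !Rintegral_cauchy//.
have := Rintegral_min1_cauchy_le t01.
set I := \int[leb]_s _ => Ih.
have -> : I * (2 * pi) * (2 * pi) + (2 * pi * I * (2 * pi) + 2 * pi * (2 * pi) * I) =
  3 * (2 * pi) ^+ 2 * I by ring.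
by apply: ler_wpM2l => //; rewrite mulr_ge0// sqr_ge0.
Qed.

Definition opp3 (x : mR3 R) : mR3 R := (- x.1.1, - x.1.2, - x.2).

Lemma measurable_opp3 : measurable_fun setT opp3.
Proof.
have mf : measurable_fun setT (fun x : mR => - x : mR) by exact: oppr_measurable.
apply/measurable_fun_pair; first apply/measurable_fun_pair.
- by apply: (measurableT_comp mf); apply: measurableT_comp.
- by apply: (measurableT_comp mf); apply: measurableT_comp.
- exact: (measurableT_comp mf).
Qed.

Lemma Rintegral_opp3 (f : mR3 R -> R) : measurable_fun setT f ->
  \int[mu3]_x f (opp3 x) = \int[mu3]_x f x.
Proof. exact: (Rintegral_preserving measurable_opp3 mu3_opp). Qed.

Variable m : mR3 R -> R.
Hypothesis mi : mu3.-integrable setT (EFin \o m).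
Hypothesis m_even : forall x, m (opp3 x) = m x.

Let mm : measurable_fun setT m.
Proof. by apply/measurable_EFinP; exact: measurable_int mi. Qed.

(** After the exchange of integrals, the product of two cosines is half the sum of the cosines of
    the sum and the difference of the phases. These give Cauchy kernels centred at [- xi0] and
    [xi0], whose integrals against the even [m] coincide. *)
Lemma Rintegral_damped_ctrans e (xi0 : mR3 R) th : 0 < e ->
  \int[mu3]_x (cos (dot3 x xi0 + th) * (ctrans 0 m x * damping e x)) =
  cos th * \int[mu3]_xi (m xi * cauchy3 e (translate3 (opp3 xi0) xi)).
Proof.
move=> e0; have di := integrable_damping e0.
pose F (z : mR3 R * mR3 R) : R :=
  cos (dot3 z.2 z.1 + 0) * (cos (dot3 z.1 xi0 + th) * (damping e z.1 * m z.2)).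
have mdot : measurable_fun setT (fun z : mR3 R * mR3 R => dot3 z.2 z.1).
  rewrite /dot3.
  apply: measurable_funD; first apply: measurable_funD.
  - by apply: measurable_funM; do 2 apply: measurableT_comp => //.
  - by apply: measurable_funM; do 2 apply: measurableT_comp => //.
  - by apply: measurable_funM; apply: measurableT_comp.
have Fi : (mu3 \x mu3)%E.-integrable setT (EFin \o F).
  apply: (integrable_cosM (g := fun z : mR3 R * mR3 R => dot3 z.2 z.1 + 0)).
    exact: measurable_funD.
  apply: (integrable_cosM (g := fun z : mR3 R * mR3 R => dot3 z.1 xi0 + th)).
    by apply: measurable_funD => //; apply: (measurableT_comp (measurable_dot3 xi0)).
  exact: (integrable_tensor di mi).
transitivity (\int[mu3]_x \int[mu3]_xi F (x, xi)).
  apply: eq_Rintegral => x _; rewrite /F/=.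
  transitivity (\int[mu3]_xi (cos (dot3 x xi0 + th) * damping e x * (cos (dot3 xi x + 0) * m xi))).
    rewrite RintegralZl//; last exact: integrable_ctrans.
    by rewrite -/(ctrans 0 m x); ring.
  by apply: eq_Rintegral => xi _; ring.
rewrite (Rintegral_swap Fi) /F/=.
have cs z : cauchy e (- z) = cauchy e z by rewrite /cauchy sqrrN.
have c3m z : measurable_fun setT (fun xi => cauchy3 e (translate3 z xi)).
  apply: (measurableT_comp _ (measurable_translate3 z)).
  by apply/measurable_EFinP; exact: measurable_int (integrable_cauchy3 e0).
(* The maximum, attained at [s = 0]; boundedness makes [m] times a translated kernel integrable. *)
have cb s : cauchy e s <= 2 / e.
  rewrite /cauchy ler_pdivlMr// mulrAC ler_pdivrMr; last first.
    by rewrite ltr_wpDr ?sqr_ge0 ?exprn_gt0.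
  by have := sqr_ge0 s; rewrite expr2; lra.
have cb3 x : `|cauchy3 e x| <= (2 / e) ^+ 3.
  rewrite ger0_norm ?cauchy3_ge0// /cauchy3/tensor3.
  have c0 s := cauchy_ge0 s e0.
  rewrite (_ : (2 / e) ^+ 3 = 2 / e * (2 / e) * (2 / e)); last by rewrite !exprS expr0; ring.
  exact: (ler_pM (mulr_ge0 (c0 _) (c0 _)) (c0 _) (ler_pM (c0 _) (c0 _) (cb _) (cb _)) (cb _)).
have mci z : mu3.-integrable setT (EFin \o (fun xi => m xi * cauchy3 e (translate3 z xi))).
  have h := integrableZl measurableT ((2 / e) ^+ 3) mi.
  apply: le_integrable h => //.
    by apply/measurable_EFinP; apply: measurable_funM.
  have kp : 0 <= (2 / e) ^+ 3 by rewrite exprn_ge0// divr_ge0// ltW.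
  by move=> x _; rewrite /= lee_fin normrM [leRHS]normrM (ger0_norm kp) mulrC ler_wpM2r.
transitivity (\int[mu3]_xi (cos th / 2 * (m xi * cauchy3 e (translate3 (opp3 xi0) xi)) +
    cos th / 2 * (m xi * cauchy3 e (translate3 xi0 xi)))).
  apply: eq_Rintegral => xi _.
  transitivity (\int[mu3]_x (m xi / 2 * (cos (dot3 x (translate3 xi0 xi) + th) * damping e x) +
     m xi / 2 * (cos (dot3 x (translate3 (opp3 xi0) xi) + (- th)) * damping e x))).
    apply: eq_Rintegral => x _; rewrite addr0.
    have -> : dot3 x (translate3 xi0 xi) + th = dot3 xi x + (dot3 x xi0 + th).
      by rewrite /dot3/translate3/=; ring.
    have -> : dot3 x (translate3 (opp3 xi0) xi) + - th = dot3 xi x - (dot3 x xi0 + th).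
      by rewrite /dot3/translate3/=; ring.
    by move: (dot3 xi x) (dot3 x xi0 + th) => A1 A2; rewrite cosD cosB; field.
  have i1 z ph : mu3.-integrable setT (EFin \o (fun x => cos (dot3 x z + ph) * damping e x)).
    exact: integrable_ctrans.
  rewrite RintegralD//; last 2 first.
  - by have := integrableZl measurableT (m xi / 2) (i1 (translate3 xi0 xi) th); exact: eq_integrable.
  - by have := integrableZl measurableT (m xi / 2) (i1 (translate3 (opp3 xi0) xi) (- th)); exact: eq_integrable.
  by rewrite !RintegralZl// !Rintegral_damping_cos// cosN; ring.
rewrite RintegralD//; last 2 first.
- by have := integrableZl measurableT (cos th / 2) (mci (opp3 xi0)); exact: eq_integrable.
- by have := integrableZl measurableT (cos th / 2) (mci xi0); exact: eq_integrable.
rewrite !RintegralZl//.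
have -> : \int[mu3]_xi (m xi * cauchy3 e (translate3 xi0 xi)) =
  \int[mu3]_xi (m xi * cauchy3 e (translate3 (opp3 xi0) xi)).
  rewrite -[RHS]Rintegral_opp3; last exact: measurable_funM.
  apply: eq_Rintegral => xi _; rewrite m_even; congr (_ * _).
  by rewrite /cauchy3/tensor3/translate3/=/opp3/= -!opprD !cs.
by field.
Qed.

Variable L : R.
Variable xi0 : mR3 R.
Hypothesis m_lip : forall xi, `|m (translate3 xi0 xi) - m xi0| <= L * modulus xi.

(** The kernel is an approximate identity of mass [(2 pi)^3]. The error is the integral of [modulus]
    against it: for each of the three coordinates, one small factor and two of mass [2 pi]. *)
Lemma Rintegral_mollified t : 0 < t <= 1 ->
  `| \int[mu3]_xi (m xi * cauchy3 (t ^+ 3) (translate3 (opp3 xi0) xi)) -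
     (2 * pi) ^+ 3 * m xi0 | <= L * (3 * (2 * pi) ^+ 2 * (6 * pi * t)).
Proof.
move=> t01; have /andP[t0 _] := t01; have e0 : 0 < t ^+ 3 by rewrite exprn_gt0.
set Q := cauchy3 (t ^+ 3); have Qi := integrable_cauchy3 e0.
have mQ : measurable_fun setT Q by apply/measurable_EFinP; exact: measurable_int Qi.
have trK x : translate3 (opp3 xi0) (translate3 xi0 x) = x.
  by case: x => [[a b] c]; rewrite /translate3/=; congr (_, _, _); ring.
have mt : measurable_fun setT (fun x => m (translate3 xi0 x)).
  exact: (measurableT_comp mm (measurable_translate3 xi0)).
have -> : \int[mu3]_xi (m xi * Q (translate3 (opp3 xi0) xi)) =
    \int[mu3]_xi (m (translate3 xi0 xi) * Q xi).
  rewrite -(Rintegral_translate xi0).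
    by apply: eq_Rintegral => xi _; rewrite trK.
  apply: measurable_funM => //.
  exact: (measurableT_comp mQ (measurable_translate3 _)).
have Li : mu3.-integrable setT (EFin \o (fun x => L * (modulus x * Q x))).
  have := integrableZl measurableT L (integrable_modulus_cauchy3 e0).
  by apply: eq_integrable.
have dle x : `|(m (translate3 xi0 x) - m xi0) * Q x| <= L * (modulus x * Q x).
  rewrite normrM [`|Q x|]ger0_norm ?cauchy3_ge0// mulrA ler_wpM2r ?cauchy3_ge0//.
have di : mu3.-integrable setT (EFin \o (fun x => (m (translate3 xi0 x) - m xi0) * Q x)).
  apply: le_integrable Li => //.
    by apply/measurable_EFinP; apply: measurable_funM => //; exact: measurable_funB.
  by move=> x _; rewrite /= lee_fin (le_trans (dle x))// ler_norm.
have ci : mu3.-integrable setT (EFin \o (fun x => m xi0 * Q x)).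
  by have := integrableZl measurableT (m xi0) Qi; exact: eq_integrable.
have -> : \int[mu3]_xi (m (translate3 xi0 xi) * Q xi) =
   \int[mu3]_xi ((m (translate3 xi0 xi) - m xi0) * Q xi) + \int[mu3]_xi (m xi0 * Q xi).
  by rewrite -RintegralD//; apply: eq_Rintegral => xi _; ring.
have -> : \int[mu3]_xi (m xi0 * Q xi) = (2 * pi) ^+ 3 * m xi0.
  rewrite [RHS]mulrC -(Rintegral_cauchy3 e0); exact: RintegralZl.
rewrite addrK; apply: le_trans (le_normr_Rintegral measurableT di) _.
apply: (@le_trans _ _ (\int[mu3]_x (L * (modulus x * Q x)))).
  by apply: le_Rintegral => //; exact: integrable_norm.
have -> : \int[mu3]_x (L * (modulus x * Q x)) = L * \int[mu3]_x (modulus x * Q x).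
  by apply: RintegralZl => //; exact: integrable_modulus_cauchy3.
(* [modulus] equals 1 at [(1, 0, 0)], so the Lipschitz hypothesis at that point forces the sign of
   [L]. *)
have L0 : 0 <= L.
  have := m_lip (1, 0, 0); rewrite /modulus/= normr1 normr0 minxx.
  have -> : Num.min (1 : R) 0 = 0 by apply/min_idPr.
  by rewrite !addr0 mulr1; apply: le_trans.
by rewrite ler_wpM2l// Rintegral_modulus_cauchy3_le.
Qed.

Lemma cvg_mollified :
  \int[mu3]_xi (m xi * cauchy3 (n.+1%:R^-1 ^+ 3) (translate3 (opp3 xi0) xi)) @[n --> \oo]
  --> (2 * pi) ^+ 3 * m xi0.
Proof.
pose C := L * (3 * (2 * pi) ^+ 2 * (6 * pi)).
have h0 : C * n.+1%:R^-1 @[n --> \oo] --> (0 : R).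
  by rewrite -(mulr0 C); apply: cvgMr; exact: cvg_harmonic.
set a := (2 * pi) ^+ 3 * m xi0.
have h1 : a - C / n.+1%:R @[n --> \oo] --> a.
  by rewrite -[X in _ --> X]subr0; apply: cvgB => //; exact: cvg_cst.
have h2 : a + C / n.+1%:R @[n --> \oo] --> a.
  by rewrite -[X in _ --> X]addr0; apply: cvgD => //; exact: cvg_cst.
apply: squeeze_cvgr h1 h2; apply: nearW => n; rewrite -ler_distl.
have n01 : 0 < (n.+1%:R : R)^-1 <= 1 by rewrite invr_gt0 ltr0n invf_le1 ?ler1n ?ltr0n.
by apply: le_trans (Rintegral_mollified n01) _; rewrite le_eqVlt; apply/orP; left; apply/eqP; rewrite /C; ring.
Qed.

(** Abel summation: with damping, the integral is a mollification of [m] at [xi0], and integrability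
    of the transform lets dominated convergence remove the damping. The width [(n + 1)^-3] is [t^3]
    at [t = 1 / (n + 1)]. *)
Theorem ctrans_inversion th : mu3.-integrable setT (EFin \o ctrans 0 m) ->
  \int[mu3]_x (cos (dot3 x xi0 + th) * ctrans 0 m x) = (2 * pi) ^+ 3 * (cos th * m xi0).
Proof.
move=> Ki; pose e n : R := n.+1%:R^-1 ^+ 3.
have e0 n : 0 < e n by rewrite exprn_gt0// invr_gt0 ltr0n.
have mK : measurable_fun setT (ctrans 0 m) by apply/measurable_EFinP; exact: measurable_int Ki.
have md n : measurable_fun setT (damping (e n)).
  by apply/measurable_EFinP; exact: measurable_int (integrable_damping (e0 n)).
have mc := measurable_cos_dot3 xi0 th.
pose F n (x : mR3 R) := cos (dot3 x xi0 + th) * (ctrans 0 m x * damping (e n) x).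
have Fle n x : `|F n x| <= `|ctrans 0 m x|.
  rewrite /F mulrCA normrM ler_piMr// normrM mulr_ile1//.
    exact: norm_cos_le1.
  by rewrite ger0_norm ?damping_ge0 ?damping_le1.
have mF n : measurable_fun setT (F n) by do 2 apply: measurable_funM => //.
have Fi n : mu3.-integrable setT (EFin \o F n).
  apply: le_integrable Ki => //; first exact/measurable_EFinP.
  by move=> x _; rewrite /= lee_fin.
have e_cvg : e n @[n --> \oo] --> (0 : R).
  have h := @cvg_harmonic R.
  have -> : e = (fun n => harmonic n * (harmonic n * harmonic n)).
    by apply/funext => n; rewrite /e /harmonic /= !exprS expr0 mulr1.
  have h0 : (0 : R) = 0 * (0 * 0) by rewrite !mulr0.
  by rewrite [X in _ --> X]h0; apply: cvgM => //; apply: cvgM.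
have [] := @dominated_convergence _ _ _ mu3 setT measurableT (fun n => EFin \o F n)
  (EFin \o (fun x => cos (dot3 x xi0 + th) * ctrans 0 m x)) (fun x => `|ctrans 0 m x|%:E).
- by move=> n; exact/measurable_EFinP.
- by apply/measurable_EFinP; exact: measurable_funM.
- apply: aeW => x _; apply: cvg_EFin; first exact: nearW.
  rewrite /=/F; apply: cvgMr; rewrite -[X in _ --> X]mulr1; apply: cvgMr.
  have E (s : R) : expR (- (e n * `|s|)) @[n --> \oo] --> (1 : R).
    have h : - (e n * `|s|) @[n --> \oo] --> (0 : R).
      by rewrite -oppr0 -(mul0r `|s|); apply: cvgN; apply: cvgMl.
    by have := cvg_comp _ _ h (@continuous_expR R 0); rewrite expR0.
  have -> : (1 : R) = 1 * 1 * 1 by rewrite !mulr1.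
  by apply: cvgM; [apply: cvgM|]; exact: E.
- exact: (integrable_abse Ki).
- by apply: aeW => x n _; rewrite /= lee_fin.
move=> _ _ h.
have FI n : (\int[mu3]_x (EFin \o F n) x)%E = (\int[mu3]_x F n x)%:E.
  by rewrite /Rintegral fineK//; exact: (integrable_fin_num measurableT (Fi n)).
have {}h : (\int[mu3]_x F n x)%:E @[n --> \oo] -->
   (\int[mu3]_x (cos (dot3 x xi0 + th) * ctrans 0 m x)%:E)%E.
  by apply: cvg_trans h; apply: near_eq_cvg; apply: nearW => n; rewrite -FI.
have h2 : (\int[mu3]_x F n x)%:E @[n --> \oo] --> ((2 * pi) ^+ 3 * (cos th * m xi0))%:E.
  apply: cvg_EFin; first exact: nearW.
  under eq_fun do rewrite /= /F Rintegral_damped_ctrans//.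
  by rewrite mulrCA; apply: cvgMr; exact: cvg_mollified.
by rewrite /Rintegral (cvg_unique _ h h2).
Qed.

End inversion.

(** * Young's inequality and the pairing of a convolution with a Fourier transform *)

Section weighted_jensen.
Local Open Scope ereal_scope.
Context d (T : measurableType d) (R : realType) (mu : {measure set T -> \bar R}).
Variables (w U : T -> R) (k p : R).
Hypotheses (mw : measurable_fun setT w) (mU : measurable_fun setT U).
Hypotheses (w0 : forall x, (0 <= w x)%R) (U0 : forall x, (0 <= U x)%R).
Hypotheses (k0 : (0 < k)%R) (p1 : (1 <= p)%R).
Hypothesis wk : \int[mu]_x (w x)%:E <= k%:E.

(** Hoelder's inequality for the splitting [w U = w^(1/q) * (w^(1/p) U)]; the case [p = 1], whose
    conjugate exponent is infinite, is immediate. *)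
Lemma weighted_jensen :
  (\int[mu]_x (w x * U x)%:E) `^ p <= (k `^ (p - 1))%:E * \int[mu]_x (w x * U x `^ p)%:E.
Proof.
have wU0 : 0 <= \int[mu]_x (w x * U x)%:E.
  by apply: integral_ge0 => x _; rewrite lee_fin mulr_ge0.
move: (p1); rewrite le_eqVlt => /predU1P[<-|p11].
  rewrite subrr powRr0 mul1e poweRe1//; under [leRHS]eq_integral do rewrite powRr1//.
  by [].
have p0 : (0 < p)%R by rewrite (lt_trans _ p11).
pose q := (p / (p - 1))%R.
have p10 : (0 < p - 1)%R by rewrite subr_gt0.
have q0 : (0 < q)%R by rewrite divr_gt0.
have pq : (q^-1 + p^-1 = 1)%R.
  by rewrite /q invf_div -[X in (_ + X)%R]div1r -mulrDl subrK divff// gt_eqF.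
have pN := gt_eqF p0; have qN := gt_eqF q0.
have mf : measurable_fun setT (fun x => w x `^ q^-1)%R.
  exact: (measurableT_comp (measurable_powR q^-1)).
have mg : measurable_fun setT (fun x => w x `^ p^-1 * U x)%R.
  by apply: measurable_funM => //; exact: (measurableT_comp (measurable_powR p^-1)).
have := hoelder mu mf mg q0 p0 pq.
rewrite Lnorm1 unlock /=.
under eq_integral => x _.
  rewrite mulrA -powRD; last by rewrite pq oner_eq0.
  rewrite pq powRr1// ger0_norm ?mulr_ge0//.
  over.
under [X in _ <= X `^ _ * _ -> _]eq_integral => x _.
  rewrite ger0_norm ?powR_ge0// -powRrM mulVf ?qN// powRr1//.
  over.
under [X in _ <= _ * X `^ _ -> _]eq_integral => x _.
  rewrite ger0_norm ?mulr_ge0 ?powR_ge0// powRM ?powR_ge0// -powRrM mulVf ?pN// powRr1//.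
  over.
set V := \int[mu]_x (w x * U x `^ p)%:E.
set W := \int[mu]_x (w x)%:E.
have W0 : 0 <= W by apply: integral_ge0 => x _; rewrite lee_fin.
have V0 : 0 <= V by apply: integral_ge0 => x _; rewrite lee_fin mulr_ge0// powR_ge0.
move=> h.
have {}h : (\int[mu]_x (w x * U x)%:E) `^ p <= (W `^ q^-1 * V `^ p^-1) `^ p.
  apply: (gt0_ler_poweR (ltW p0)) => //; rewrite in_itv/= leey andbT//.
  by rewrite mule_ge0// poweR_ge0.
apply: (le_trans h); rewrite poweRM ?poweR_ge0// -!poweRrM mulVf ?pN// poweRe1//.
rewrite lee_wpmul2r// (_ : q^-1 * p = p - 1)%R; last first.
  by rewrite /q invf_div mulrVK// unitfE pN.
rewrite -poweR_EFin; apply: (gt0_ler_poweR (ltW p10)) => //; rewrite in_itv/= leey andbT//.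
by rewrite lee_fin ltW.
Qed.

End weighted_jensen.

Section Rintegral_scaling.
Context d (T : measurableType d) (R : realType) (mu : {measure set T -> \bar R}).

(** The extended integral is finite only if the positive and negative parts both have finite
    integral; otherwise it is infinite and [fine] sends it to 0. *)
Lemma Rintegral_Nintegrable (f : T -> R) : measurable_fun setT f ->
  ~ mu.-integrable setT (EFin \o f) -> \int[mu]_x f x = 0.
Proof.
move=> mf nf; rewrite /Rintegral; have [If|] := boolP (\int[mu]_x (f x)%:E \is a fin_num)%E.
  exfalso; apply: nf; apply/integrableP; split; first exact/measurable_EFinP.
  have mE : measurable_fun setT (EFin \o f) by exact/measurable_EFinP.
  move: If; rewrite -[X in X \is a _]/(\int[mu]_x (EFin \o f) x)%E integralE.
  rewrite fin_numB => /andP[pf nf].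
  have -> : (fun x => `|(EFin \o f) x|)%E = ((EFin \o f)^\+ \+ (EFin \o f)^\-)%E.
    by rewrite -fune_abse.
  have mp := measurable_funepos mE; have mn := measurable_funeneg mE.
  rewrite ge0_integralD//.
  by rewrite lte_add_pinfty// -ge0_fin_numE//; apply: integral_ge0.
by case: (integral _ _ _).
Qed.

(* Unconditional because the integral of a non-integrable function is 0. *)
Lemma RintegralZr_total (f : T -> R) (c : R) : measurable_fun setT f ->
  \int[mu]_x (f x * c) = \int[mu]_x f x * c.
Proof.
move=> mf; have [->|c0] := eqVneq c 0.
  rewrite mulr0; under eq_Rintegral do rewrite mulr0.
  by rewrite /Rintegral integral0.
have [fi|nf] := pselect (mu.-integrable setT (EFin \o f)); first exact: RintegralZr.
rewrite (Rintegral_Nintegrable mf nf) mul0r Rintegral_Nintegrable//.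
  exact: measurable_funM.
move=> fci; apply: nf; have := integrableZr measurableT c^-1 fci.
by apply: eq_integrable => // x _; rewrite /= -EFinM mulfK.
Qed.

End Rintegral_scaling.

(** The norm of exponent [+oo] is the essential supremum only over a space of positive measure. On a
    null space [weight3 1] would have integral 0 instead of [pi^3]. *)
Lemma mu3_setT_gt0 {R : realType} : (0 < mu3 [set: mR3 R])%E.
Proof.
rewrite lt0e measure_ge0 andbT; apply/eqP => mu0.
have wi := integrable_weight3 (ltr01 : 0 < 1 :> R).
have := Rintegral_weight3 (ltr01 : 0 < 1 :> R).
rewrite /Rintegral (null_set_integral measurableT (measurable_int _ wi) mu0)/= => h.
by have := exprn_gt0 3 (pi_gt0 R); rewrite -[pi]divr1 -h ltxx.
Qed.

Lemma dot3C {R : realType} (x y : R3 R) : dot3 x y = dot3 y x.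
Proof. by rewrite /dot3; ring. Qed.

Lemma measurable_dot3_pair {R : realType} :
  measurable_fun setT (fun z : mR3 R * mR3 R => dot3 z.2 z.1).
Proof.
rewrite /dot3.
apply: measurable_funD; first apply: measurable_funD.
- by apply: measurable_funM; do 2 apply: measurableT_comp => //.
- by apply: measurable_funM; do 2 apply: measurableT_comp => //.
- by apply: measurable_funM; apply: measurableT_comp.
Qed.

Section convolution.
Context {R : realType}.
Implicit Types (K u v g U W : mR3 R -> R) (x y : mR3 R).

Definition sub3 x y : mR3 R := (x.1.1 - y.1.1, x.1.2 - y.1.2, x.2 - y.2).

Lemma opp3_sub x y : opp3 (sub3 x y) = sub3 y x.
Proof. by rewrite /opp3 /sub3 /= !opprB. Qed.

Lemma measurable_sub3 : measurable_fun setT (fun z : mR3 R * mR3 R => sub3 z.1 z.2).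
Proof.
have m11 : measurable_fun setT (fun z : mR3 R => z.1.1) by apply: measurableT_comp.
have m12 : measurable_fun setT (fun z : mR3 R => z.1.2) by apply: measurableT_comp.
have m2 : measurable_fun setT (fun z : mR3 R => z.2) by exact: measurable_snd.
apply/measurable_fun_pair; first apply/measurable_fun_pair.
- by apply: measurable_funB; [exact: (measurableT_comp m11 measurable_fst)|exact: (measurableT_comp m11 measurable_snd)].
- by apply: measurable_funB; [exact: (measurableT_comp m12 measurable_fst)|exact: (measurableT_comp m12 measurable_snd)].
- by apply: measurable_funB; [exact: (measurableT_comp m2 measurable_fst)|exact: (measurableT_comp m2 measurable_snd)].
Qed.

Definition conv K u x : R := \int[mu3]_y (K (sub3 x y) * u y).

Variable K : mR3 R -> R.
Hypothesis Ki : mu3.-integrable setT (EFin \o K).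
Hypothesis K_even : forall x, K (opp3 x) = K x.

Let mK : measurable_fun setT K.
Proof. by apply/measurable_EFinP; exact: measurable_int Ki. Qed.

Lemma kernel_sym x y : K (sub3 x y) = K (sub3 y x).
Proof. by rewrite -opp3_sub K_even. Qed.

Lemma measurable_kernel : measurable_fun setT (fun z : mR3 R * mR3 R => K (sub3 z.1 z.2)).
Proof. exact: (measurableT_comp mK measurable_sub3). Qed.

Lemma measurable_kernel1 y : measurable_fun setT (fun x => K (sub3 x y)).
Proof. exact: (measurableT_comp mK (measurable_translate3 (opp3 y))). Qed.

Lemma measurable_kernel2 x : measurable_fun setT (fun y => K (sub3 x y)).
Proof. by under eq_fun do rewrite kernel_sym; exact: measurable_kernel1. Qed.

Lemma integral_kernel1 y :
  (\int[mu3]_x `|K (sub3 x y)|%:E = \int[mu3]_x `|K x|%:E)%E.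
Proof.
have h : measurable_fun setT (fun x => `|K x|%:E).
  by apply/measurable_EFinP; exact: measurableT_comp.
exact: (integral_preserving (measurable_translate3 (opp3 y)) (mu3_translate (opp3 y)) h).
Qed.

Lemma integral_kernel2 x :
  (\int[mu3]_y `|K (sub3 x y)|%:E = \int[mu3]_y `|K y|%:E)%E.
Proof. by under eq_integral do rewrite kernel_sym; exact: integral_kernel1. Qed.

Lemma measurable_conv u : measurable_fun setT u -> measurable_fun setT (conv K u).
Proof.
move=> mu; apply: (@measurable_Rintegral1 _ _ _ _ _ mu3 (fun z => K (sub3 z.1 z.2) * u z.2)).
apply: measurable_funM; first exact: measurable_kernel.
exact: (measurableT_comp mu measurable_snd).
Qed.

Variable k : R.
Hypothesis k0 : 0 < k.
Hypothesis Kk : (\int[mu3]_x `|K x|%:E <= k%:E)%E.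

(** A pointwise majorant replaces the convolution itself so that moduli of complex functions can be
    inserted. For finite [p], Jensen's inequality with weight [|K (x - y)|] costs [k^(p - 1)], and
    Tonelli integration in [x] one more [k]. *)
Lemma young (p : \bar R) U v : (1 <= p)%E ->
  measurable_fun setT U -> (forall x, 0 <= U x) ->
  measurable_fun setT v ->
  (forall x, (`|v x|%:E <= \int[mu3]_y (`|K (sub3 x y)| * U y)%:E)%E) ->
  (Lnorm mu3 p (EFin \o v) <= k%:E * Lnorm mu3 p (EFin \o U))%E.
Proof.
move=> p1 mU U0 mv vU; rewrite unlock; case: p p1 => [p| |]//; last first.
  move=> _; case: ifPn => [muT|]; last by rewrite mule0.
  have mUE : measurable_fun setT (fun y : mR3 R => (U y)%:E) by exact/measurable_EFinP.
  have mKa x : measurable_fun setT (fun y => `|K (sub3 x y)|%:E).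
    by apply/measurable_EFinP; apply: measurableT_comp => //; exact: measurable_kernel2.
  set M := ess_sup _ (abse \o (EFin \o U)).
  have UM : \forall y \ae mu3, ((U y)%:E <= M)%E.
    have := ess_sup_ge mu3 (abse \o (EFin \o U)).
    by apply: filterS => y /=; rewrite ger0_norm.
  have M0 : (0 <= M)%E by apply: ess_sup_gee => //; apply: nearW => y /=; rewrite lee_fin.
  apply/ess_supP; apply: nearW => x; apply: le_trans (vU x) _.
  apply: (@le_trans _ _ (\int[mu3]_y (`|K (sub3 x y)|%:E * M))%E).
    apply: ae_ge0_le_integral => //.
    - by move=> y _; rewrite lee_fin mulr_ge0.
    - by under eq_fun do rewrite EFinM; exact: emeasurable_funM.
    - by move=> y _; rewrite mule_ge0.
    - exact: emeasurable_funM.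
    - by apply: filterS UM => y Uy _; rewrite EFinM lee_wpmul2l.
  rewrite ge0_integralZr// integral_kernel2.
  by rewrite lee_wpmul2r.
rewrite lee_fin => p1; have p0 : 0 < p by rewrite (lt_le_trans _ p1).
have mUp : measurable_fun setT (fun y => U y `^ p).
  exact: (measurableT_comp (measurable_powR p) mU).
have mF : measurable_fun setT (fun z : mR3 R * mR3 R => (`|K (sub3 z.1 z.2)| * U z.2 `^ p)%:E).
  apply/measurable_EFinP; apply: measurable_funM.
    by apply: measurableT_comp => //; exact: measurable_kernel.
  exact: (measurableT_comp mUp measurable_snd).
have F0 (z : mR3 R * mR3 R) : (0 <= (`|K (sub3 z.1 z.2)| * U z.2 `^ p)%:E)%E.
  by rewrite lee_fin mulr_ge0 ?powR_ge0.
have IU0 : (0 <= \int[mu3]_y (U y `^ p)%:E)%E.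
  by apply: integral_ge0 => y _; rewrite lee_fin powR_ge0.
have key : (\int[mu3]_x (`|v x| `^ p)%:E <= (k `^ p)%:E * \int[mu3]_y (U y `^ p)%:E)%E.
  have mG := measurable_fun_fubini_tonelli_F (m2 := mu3) _ mF F0.
  apply: (@le_trans _ _ (\int[mu3]_x ((k `^ (p - 1))%:E *
      \int[mu3]_y (`|K (sub3 x y)| * U y `^ p)%:E))%E).
    apply: ge0_le_integral => //.
    - apply/measurable_EFinP; apply: (measurableT_comp (measurable_powR p)).
      exact: measurableT_comp.
    - exact: emeasurable_funM.
    - move=> x _; apply: (@le_trans _ _ ((\int[mu3]_y (`|K (sub3 x y)| * U y)%:E) `^ p)%E).
        rewrite -poweR_EFin; apply: (gt0_ler_poweR (ltW p0)) => //;
          rewrite in_itv/= leey andbT//.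
        by apply: integral_ge0 => y _; rewrite lee_fin mulr_ge0.
      apply: weighted_jensen => //.
      + by apply: measurableT_comp => //; exact: measurable_kernel2.
      + by rewrite integral_kernel2.
  have I0 x : (0 <= \int[mu3]_y (`|K (sub3 x y)| * U y `^ p)%:E)%E.
    by apply: integral_ge0 => y _; exact: (F0 (x, y)).
  rewrite ge0_integralZl//; last by rewrite lee_fin powR_ge0.
  have -> : (\int[mu3]_x \int[mu3]_y (`|K (sub3 x y)| * U y `^ p)%:E =
     \int[mu3]_y \int[mu3]_x (`|K (sub3 x y)| * U y `^ p)%:E)%E.
    exact: (fubini_tonelli _ mF F0).
  under [X in (_ * X <= _)%E]eq_integral => y _.
    under eq_integral do rewrite EFinM.
    rewrite ge0_integralZr//=; last 2 first.
    - apply/measurable_EFinP; apply: measurableT_comp => //; exact: measurable_kernel1.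
    - by rewrite lee_fin powR_ge0.
    rewrite integral_kernel1.
    over.
  rewrite ge0_integralZl//=; last 3 first.
  - exact/measurable_EFinP.
  - by move=> y _; rewrite lee_fin powR_ge0.
  - exact: integral_ge0.
  rewrite muleA lee_wpmul2r//.
  apply: (@le_trans _ _ ((k `^ (p - 1))%:E * k%:E)%E).
    by rewrite lee_wpmul2l// lee_fin powR_ge0.
  rewrite -EFinM lee_fin -{2}(powRr1 (ltW k0)) -powRD ?subrK//.
  by rewrite gt_eqF// implybT.
rewrite /=; under [X in (_ <= _ * X `^ _)%E]eq_integral do rewrite ger0_norm//.
apply: (@le_trans _ _ (((k `^ p)%:E * \int[mu3]_y (U y `^ p)%:E) `^ p^-1)%E).
  have q0 : 0 <= p^-1 by rewrite invr_ge0 ltW.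
  apply: (gt0_ler_poweR q0) => //; rewrite in_itv/= leey andbT.
    by apply: integral_ge0 => y _; rewrite lee_fin powR_ge0.
  by apply: mule_ge0 => //; rewrite lee_fin powR_ge0.
rewrite poweRM//; last by rewrite lee_fin powR_ge0.
by rewrite poweR_EFin -powRrM divff ?gt_eqF// powRr1// ltW.
Qed.

(** In place of conjugate exponents: [U W <= W] where [U <= 1], and [U W <= c U^p] where [U > 1].
    For [p = +oo] the essential supremum of [U] comes out of the integral. *)
Lemma Lp_pairing_fin (p : \bar R) U W (c : R) : (1 <= p)%E ->
  measurable_fun setT U -> (forall x, 0 <= U x) ->
  (Lnorm mu3 p (EFin \o U) < +oo)%E ->
  measurable_fun setT W -> (forall x, 0 <= W x <= c) ->
  (\int[mu3]_x (W x)%:E < +oo)%E ->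
  (\int[mu3]_x (U x * W x)%:E < +oo)%E.
Proof.
move=> p1 mU U0 Up mW W0 Woo.
have mUW : measurable_fun setT (fun x => (U x * W x)%:E).
  by apply/measurable_EFinP; exact: measurable_funM.
have W00 x : 0 <= W x by have /andP[] := W0 x.
have mWE : measurable_fun setT (fun x => (W x)%:E) by exact/measurable_EFinP.
case: p p1 Up => [p| |]//; rewrite unlock.
- rewrite lee_fin => p1 Up; have p0 : 0 < p by rewrite (lt_le_trans _ p1).
  have {}Up : (\int[mu3]_x (U x `^ p)%:E < +oo)%E.
    move: Up => /(lty_poweRy (negbT _))-/(_ (gt_eqF _)).
    rewrite invr_gt0 => /(_ p0) /=.
    by under eq_integral do rewrite ger0_norm//.
  have mUp : measurable_fun setT (fun y => (U y `^ p)%:E).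
    by apply/measurable_EFinP; exact: (measurableT_comp (measurable_powR p) mU).
  have c0 : 0 <= c by have /andP[a b] := W0 point; exact: le_trans a b.
  have Up0 x : (0 <= (U x `^ p)%:E)%E by rewrite lee_fin powR_ge0.
  apply: (@le_lt_trans _ _ (\int[mu3]_x ((W x)%:E + c%:E * (U x `^ p)%:E))%E); last first.
    have h1 x : setT x -> (0 <= (W x)%:E)%E by rewrite lee_fin.
    have h2 x : setT x -> (0 <= c%:E * (U x `^ p)%:E)%E by move=> _; rewrite mule_ge0.
    have h3 : measurable_fun setT (fun x => c%:E * (U x `^ p)%:E)%E by exact: emeasurable_funM.
    rewrite (ge0_integralD mu3 measurableT h1 mWE h2 h3) ge0_integralZl//.
    by apply: lte_add_pinfty => //; exact: lte_mul_pinfty.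
  apply: ge0_le_integral => //.
  - by move=> x _; rewrite lee_fin mulr_ge0.
  - by apply: emeasurable_funD => //; exact: emeasurable_funM.
  move=> x _; rewrite -EFinM -EFinD lee_fin; have /andP[_ Wc] := W0 x.
  have [U1|U1] := leP (U x) 1.
    by rewrite -[leLHS]addr0 lerD ?mulr_ge0 ?powR_ge0// ler_piMl.
  rewrite -[leLHS]add0r lerD// mulrC ler_pM// -[leLHS](powRr1 (U0 x)).
  by rewrite ler_powR// ltW.
- have muT := @mu3_setT_gt0 R; rewrite muT => _.
  set M := ess_sup _ _ => Moo.
  have UM : \forall y \ae mu3, ((U y)%:E <= M)%E.
    have := ess_sup_ge mu3 (abse \o (EFin \o U)).
    by apply: filterS => y /=; rewrite ger0_norm.
  have M0 : (0 <= M)%E by apply: ess_sup_gee => //; apply: nearW => y /=; rewrite lee_fin.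
  apply: (@le_lt_trans _ _ (\int[mu3]_x (M * (W x)%:E))%E).
    apply: ae_ge0_le_integral => //.
    - by move=> y _; rewrite lee_fin mulr_ge0.
    - by move=> y _; rewrite mule_ge0// lee_fin.
    - exact: emeasurable_funM.
    - by apply: filterS UM => y Uy _; rewrite EFinM lee_wpmul2r// lee_fin.
  have h1 x : setT x -> (0 <= (W x)%:E)%E by rewrite lee_fin.
  rewrite (ge0_integralZl mu3 measurableT mWE h1 M0).
  by apply: lte_mul_pinfty => //; rewrite ge0_fin_numE.
Qed.

(* The absolute convergence behind the exchange of integrals below is that of
   [\int U (|K| * |g|)], whose weight [|K| * |g|] is bounded and integrable. *)
Lemma integrable_conv_pairing (p : \bar R) u g (c : R) : (1 <= p)%E ->
  measurable_fun setT u ->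
  (Lnorm mu3 p (EFin \o (fun x => `|u x|%R)) < +oo)%E ->
  mu3.-integrable setT (EFin \o g) -> (forall x, `|g x| <= c) ->
  (mu3 \x mu3)%E.-integrable setT
    (EFin \o (fun z : mR3 R * mR3 R => K (sub3 z.1 z.2) * u z.2 * g z.1)).
Proof.
move=> p1 mu up gi gc.
have mg : measurable_fun setT g by apply/measurable_EFinP; exact: measurable_int gi.
have mKa y : measurable_fun setT (fun x => `|K (sub3 x y)|%:E).
  by apply/measurable_EFinP; apply: measurableT_comp => //; exact: measurable_kernel1.
have mga : measurable_fun setT (fun x => `|g x|%:E).
  by apply/measurable_EFinP; exact: measurableT_comp.
pose G (z : mR3 R * mR3 R) : R := `|K (sub3 z.2 z.1)| * `|g z.2|.
have mG : measurable_fun setT (EFin \o G).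
  apply/measurable_EFinP; apply: measurable_funM.
    apply: measurableT_comp => //; under eq_fun do rewrite kernel_sym; exact: measurable_kernel.
  by apply: measurableT_comp => //; exact: (measurableT_comp mg measurable_snd).
have G0 z : (0 <= (EFin \o G) z)%E by rewrite lee_fin mulr_ge0.
pose WE y : \bar R := (\int[mu3]_x (G (y, x))%:E)%E.
have mWE : measurable_fun setT WE := measurable_fun_fubini_tonelli_F (m2 := mu3) _ mG G0.
have WE0 y : (0 <= WE y)%E by apply: integral_ge0 => x _; exact: G0 (y, x).
have c0 : 0 <= c by apply: le_trans (gc point).
have WEc y : (WE y <= (c * k)%:E)%E.
  apply: (@le_trans _ _ (\int[mu3]_x (c%:E * `|K (sub3 x y)|%:E))%E).
    apply: ge0_le_integral => //.
    - by move=> x _; exact: G0 (y, x).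
    - exact: (measurableT_comp mG (pair1_measurable y)).
    - exact: emeasurable_funM.
    - by move=> x _; rewrite -EFinM lee_fin /G/= mulrC ler_wpM2r.
  by rewrite ge0_integralZl// integral_kernel1 EFinM lee_wpmul2l.
have WEf y : WE y \is a fin_num by rewrite ge0_fin_numE// (le_lt_trans (WEc y))// ltry.
have IW : (\int[mu3]_y WE y < +oo)%E.
  have -> : (\int[mu3]_y WE y = \int[mu3]_x \int[mu3]_y (G (y, x))%:E)%E.
    exact: (fubini_tonelli _ mG G0).
  have E x : (\int[mu3]_y (G (y, x))%:E = (\int[mu3]_y `|K y|%:E) * `|g x|%:E)%E.
    rewrite -(integral_kernel2 x) -ge0_integralZr//.
    apply/measurable_EFinP; apply: measurableT_comp => //; exact: measurable_kernel2.
  under eq_integral do rewrite E.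
  have [_ goo] := integrableP _ _ _ gi.
  rewrite ge0_integralZl//; last exact: integral_ge0.
  apply: lte_mul_pinfty => //; first exact: integral_ge0.
  by rewrite ge0_fin_numE ?(le_lt_trans Kk) ?ltry//; exact: integral_ge0.
have mW : measurable_fun setT (fine \o WE).
  exact: (measurableT_comp (fine_measurable measurableT) mWE).
have mua : measurable_fun setT (fun x => `|u x|) by exact: measurableT_comp.
have h : (\int[mu3]_y (`|u y| * fine (WE y))%:E < +oo)%E.
  apply: (@Lp_pairing_fin p (fun x => `|u x|) (fine \o WE) (c * k)) => //.
    by move=> y; rewrite /= fine_ge0//= -lee_fin fineK.
  by under eq_integral do rewrite /= fineK//.
have mF : measurable_fun setT (fun z : mR3 R * mR3 R => K (sub3 z.2 z.1) * u z.1 * g z.2).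
  apply: measurable_funM; last exact: (measurableT_comp mg measurable_snd).
  apply: measurable_funM; last exact: (measurableT_comp mu measurable_fst).
  by under eq_fun do rewrite kernel_sym; exact: measurable_kernel.
(* The bound holds with [y], the variable of [u], outermost; hence the exchange of the two
   variables. *)
apply: (integrable_swap (f := fun z : mR3 R * mR3 R => K (sub3 z.2 z.1) * u z.1 * g z.2)).
apply: (integrable_prod_le mF _ _ h) => //.
  by apply/measurable_EFinP; exact: measurable_funM.
move=> y /=; rewrite EFinM fineK// /WE -ge0_integralZl//.
- by under [leRHS]eq_integral do rewrite -EFinM /G/= mulrA -!normrM [u y * _]mulrC.
- exact: (measurableT_comp mG (pair1_measurable y)).
- by move=> x _; exact: G0 (y, x).
Qed.

(** Convolution with an even kernel is symmetric for the bilinear pairing. [RintegralZr_total] takes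
    the outer factor out even at points where the inner integral diverges. *)
Lemma conv_pairing (p : \bar R) u g (c : R) : (1 <= p)%E ->
  measurable_fun setT u ->
  (Lnorm mu3 p (EFin \o (fun x => `|u x|%R)) < +oo)%E ->
  mu3.-integrable setT (EFin \o g) -> (forall x, `|g x| <= c) ->
  [/\ mu3.-integrable setT (EFin \o (fun x => conv K u x * g x)),
     mu3.-integrable setT (EFin \o (fun y => u y * conv K g y)) &
     \int[mu3]_x (conv K u x * g x) = \int[mu3]_y (u y * conv K g y)].
Proof.
move=> p1 mu up gi gc; have Fi := integrable_conv_pairing p1 mu up gi gc.
have mg : measurable_fun setT g by apply/measurable_EFinP; exact: measurable_int gi.
have E1 x : \int[mu3]_y (K (sub3 x y) * u y * g x) = conv K u x * g x.
  by apply: RintegralZr_total; apply: measurable_funM => //; exact: measurable_kernel2.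
have E2 y : \int[mu3]_x (K (sub3 x y) * u y * g x) = u y * conv K g y.
  rewrite mulrC /conv -RintegralZr_total; last first.
    by apply: measurable_funM => //; exact: measurable_kernel2.
  by apply: eq_Rintegral => x _; rewrite kernel_sym mulrAC.
split.
- have := integrable_Rintegral1 Fi.
  by apply: eq_integrable => // x _; rewrite /= E1.
- have := integrable_Rintegral1 (integrable_swap Fi).
  by apply: eq_integrable => // y _; rewrite /= E2.
- have := Rintegral_swap Fi => /=.
  under eq_Rintegral do rewrite E1.
  by under [X in _ = X -> _]eq_Rintegral do rewrite E2.
Qed.

(* With [K] the inverse transform of [m], convolution by [K] acts on Fourier
   transforms of integrable functions as multiplication by [m]. *)
Lemma conv_ctrans (m phi : mR3 R -> R) th y :
  (forall xi a, \int[mu3]_x (cos (dot3 x xi + a) * K x) = cos a * m xi) ->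
  mu3.-integrable setT (EFin \o phi) ->
  conv K (ctrans th phi) y = ctrans th (fun xi => m xi * phi xi) y.
Proof.
move=> Km phii; have mphi : measurable_fun setT phi.
  by apply/measurable_EFinP; exact: measurable_int phii.
have mK2 := measurable_kernel1 y.
have Kyi : mu3.-integrable setT (EFin \o (fun x => K (sub3 x y))).
  exact: (integrable_translate (opp3 y) Ki).
have mdot : measurable_fun setT (fun z : mR3 R * mR3 R => dot3 z.2 z.1 + th).
  exact: measurable_funD (measurable_dot3_pair) (measurable_cst _).
have Fi : (mu3 \x mu3)%E.-integrable setT (EFin \o (fun z : mR3 R * mR3 R =>
    cos (dot3 z.2 z.1 + th) * (K (sub3 z.1 y) * phi z.2))).
  apply: (integrable_cosM (g := fun z : mR3 R * mR3 R => dot3 z.2 z.1 + th)) => //.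
  exact: (integrable_tensor Kyi phii).
have := Rintegral_swap Fi => /=.
have -> : \int[mu3]_x \int[mu3]_xi (cos (dot3 xi x + th) * (K (sub3 x y) * phi xi)) =
    conv K (ctrans th phi) y.
  rewrite /conv; apply: eq_Rintegral => x _; rewrite kernel_sym mulrC -RintegralZr_total.
    by apply: eq_Rintegral => xi _; rewrite kernel_sym mulrA mulrAC.
  by apply: measurable_funM => //; exact: measurable_cos_dot3.
move=> ->; apply: eq_Rintegral => xi _.
transitivity ((\int[mu3]_x (cos (dot3 x xi + th) * K (sub3 x y))) * phi xi).
  rewrite -RintegralZr_total.
    by apply: eq_Rintegral => x _; rewrite dot3C mulrA.
  by apply: measurable_funM => //; exact: measurable_cos_dot3.
rewrite mulrA; congr (_ * _); rewrite -Km.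
rewrite -(Rintegral_translate y); last first.
  by apply: measurable_funM => //; exact: measurable_cos_dot3.
apply: eq_Rintegral => x _; congr (cos _ * K _).
  by rewrite /dot3/translate3/=; ring.
by case: x => [[a b] c]; rewrite /sub3/translate3/=; congr (_, _, _); ring.
Qed.

End convolution.

(** * Cutoff functions *)

Section smooth_functions_of_one_variable.
Context {R : realType}.
Implicit Types (f g : R -> R).

(** The derivative is an existential witness: each closure rule exhibits it, and the induction on
    [n] continues with that witness. *)
Fixpoint Cn (n : nat) f : Prop :=
  if n is n'.+1 then
    exists2 f', (forall x : R, is_derive x 1 f (f' x)) & Cn n' f'
  else continuous f.

Lemma Cn_continuous n f : Cn n f -> continuous f.
Proof. by case: n => [//|n] [f' df _]; exact: (der_continuous df). Qed.

Lemma CnW n f : Cn n.+1 f -> Cn n f.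
Proof.
elim: n f => [|n IH] f; first exact: Cn_continuous.
by move=> [f' df Cf']; exists f' => //; exact: IH.
Qed.

Lemma Cn_cst n (c : R) : Cn n (fun=> c).
Proof.
elim: n c => [|n IH] c /=; first exact: cst_continuous.
by exists (fun=> 0) => // x; exact: der_cst.
Qed.

Lemma Cn_add n f g : Cn n f -> Cn n g -> Cn n (fun x => f x + g x).
Proof.
elim: n f g => [|n IH] f g /=; first by move=> cf cg x; apply: cvgD; [exact: cf|exact: cg].
move=> [f' df Cf] [g' dg Cg]; exists (fun x => f' x + g' x); last exact: IH.
by move=> x; exact: der_add.
Qed.

Lemma Cn_mul n f g : Cn n f -> Cn n g -> Cn n (fun x => f x * g x).
Proof.
elim: n f g => [|n IH] f g; first by move=> /= cf cg x; apply: cvgM; [exact: cf|exact: cg].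
move=> Cf Cg; have [f' df Cf'] := Cf; have [g' dg Cg'] := Cg.
exists (fun x => f' x * g x + f x * g' x); first by move=> x; exact: der_mul.
by apply: Cn_add; apply: IH => //; exact: CnW.
Qed.

Lemma Cn_comp_affine n f (a b : R) : Cn n f -> Cn n (fun x => f (a * x + b)).
Proof.
elim: n f => [|n IH] f /=.
  move=> cf x; apply: (@continuous_comp _ _ _ (fun x : R => a * x + b) f); last exact: cf.
  by apply: cvgD; [apply: cvgMr|exact: cvg_cst].
move=> [f' df Cf]; exists (fun x => f' (a * x + b) * a).
  move=> x; have h : is_derive x 1 (fun y : R => a * y + b) a by der_tac; ring.
  exact: (@der_comp _ f (fun y => a * y + b) x _ _ (df _) h).
by apply: Cn_mul; [exact: IH|exact: Cn_cst].
Qed.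

Lemma Cn_inv n f : (forall x, f x != 0) -> Cn n f -> Cn n (fun x => (f x)^-1).
Proof.
move=> f0; elim: n => [|n IH].
  by move=> /= cf x; apply: cvgV => //; exact: cf.
move=> Cf; have [f' df Cf'] := Cf.
exists (fun x => - 1 * ((f x)^-1 * (f x)^-1) * f' x).
  by move=> x; apply: der_eq (der_inv (f0 x) (df x)) _; rewrite -exprVn expr2; ring.
have I := IH (CnW Cf).
by apply: Cn_mul => //; apply: Cn_mul; [exact: Cn_cst|exact: Cn_mul].
Qed.

Lemma der_near f g (x l : R) : (\forall y \near x, f y = g y) ->
  is_derive x 1 g l -> is_derive x 1 f l.
Proof.
move=> fg dg; apply: near_eq_is_derive dg.
by apply: filterS fg => y ->.
Qed.

Lemma der_exprn k (x : R) : is_derive x 1 (fun y => y ^+ k) (k%:R * x ^+ k.-1).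
Proof.
elim: k => [|k IH]; first by apply: der_eq (der_cst 1 x) _; rewrite mul0r.
have -> : (fun y : R => y ^+ k.+1) = (fun y => y * y ^+ k) by apply/funext => y; rewrite exprS.
apply: der_eq (der_mul (der_id x) IH) _.
by case: k {IH} => [|k] /=; rewrite ?expr0 ?exprS -?[in RHS]natr1; ring.
Qed.

(** The difference quotient at 0 is bounded by [C |x|]. This handles the point where a flat function
    is glued to 0. *)
Lemma der_flat f (C : R) : (forall x, `|f x| <= C * x ^+ 2) -> is_derive (0 : R) 1 f 0.
Proof.
move=> fC; apply/is_derive1_caratheodory; exists (fun z => f z * z^-1).
have f0 : f 0 = 0.
  by apply/eqP; rewrite -normr_le0; apply: le_trans (fC 0) _; rewrite expr0n mulr0.
split.
- move=> z; rewrite f0 !subr0; have [->|z0] := eqVneq z 0; first by rewrite mulr0.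
  by rewrite mulfVK.
- have E : f 0 / 0 = 0 by rewrite f0 mul0r.
  have -> : {for (0 : R), continuous (fun z => f z / z)} =
    (f z / z @[z --> (0 : R)] --> f 0 / 0) by [].
  rewrite E.
  apply/norm_cvg0P.
  have C0 : C * `|z| @[z --> (0 : R)] --> (0 : R).
    have h : `|z| @[z --> (0 : R)] --> (0 : R).
      by have := @norm_continuous _ R (0 : R); rewrite /continuous_at normr0.
    by rewrite -[X in _ --> X](mulr0 C); apply: cvgMr.
  apply: (squeeze_cvgr _ (cvg_cst 0) C0); apply: nearW => z.
  rewrite normr_ge0/= normrM; have [->|z0] := eqVneq z 0.
    by rewrite invr0 normr0 !mulr0.
  rewrite normfV ler_pdivrMr ?normr_gt0//; apply: le_trans (fC z) _.
  by rewrite -mulrA -expr2 real_normK// num_real.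
- by rewrite f0 mul0r.
Qed.

(** From [exp z >= 1 + z] at [z = y / (4 k)], raised to the power [k]. The estimate serves both the
    flat functions and the symbol. *)
Lemma powX_expR_le k (y : R) : 0 <= y -> y ^+ k * expR (- (y / 4)) <= (4 * k%:R) ^+ k.
Proof.
move=> y0; case: k => [|k].
  by rewrite !expr0 mul1r -expR0 ler_expR oppr_le0 divr_ge0.
have k0 : 0 < 4 * k.+1%:R :> R by rewrite mulr_gt0// ltr0n.
rewrite expRN ler_pdivrMr ?expR_gt0//.
have -> : expR (y / 4) = expR (y / (4 * k.+1%:R)) ^+ k.+1.
  have kn : k.+1%:R != 0 :> R by rewrite pnatr_eq0.
  by rewrite -expRM_natl; congr expR; move: (k.+1%:R : R) kn => K kn; field.
rewrite -exprMn; apply: lerXn2r => //; rewrite ?nnegrE ?(mulr_ge0 (ltW k0) (expR_ge0 _))//.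
rewrite -ler_pdivrMl// mulrC; apply: le_trans (expR_ge1Dx _).
by rewrite lerDr.
Qed.

(** With the powers [k] included, derivatives are linear combinations of members of the family, so
    all of them are shown to be smooth at once. *)
Definition flat (k : nat) (x : R) : R :=
  if 0 < x then x^-1 ^+ k * expR (- x^-1) else 0.

Lemma flat_ge0 k x : 0 <= flat k x.
Proof. by rewrite /flat; case: ifPn => // x0; rewrite mulr_ge0 ?expR_ge0// exprn_ge0// invr_ge0 ltW. Qed.

Lemma flat_gt0 k x : 0 < x -> 0 < flat k x.
Proof. by move=> x0; rewrite /flat x0 mulr_gt0 ?expR_gt0// exprn_gt0// invr_gt0. Qed.

Lemma flat0 k x : x <= 0 -> flat k x = 0.
Proof. by move=> x0; rewrite /flat ltNge x0. Qed.

(** The exponential absorbs two more powers of [1 / x] than are present, which frees the factor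
    [x^2] that [der_flat] asks for. *)
Lemma flat_le_sqr k x : `|flat k x| <= (4 * k.+2%:R) ^+ k.+2 * x ^+ 2.
Proof.
rewrite ger0_norm ?flat_ge0//; have [x0|x0] := leP x 0.
  by rewrite flat0// mulr_ge0 ?sqr_ge0// exprn_ge0// mulr_ge0.
have y0 : 0 <= x^-1 by rewrite invr_ge0 ltW.
rewrite /flat x0; have := powX_expR_le k.+2 y0 => h.
have e : expR (- x^-1) <= expR (- (x^-1 / 4)).
  by rewrite ler_expR lerN2 ler_piMr// invf_le1// ler1n.
apply: (@le_trans _ _ (x^-1 ^+ k.+2 * expR (- (x^-1 / 4)) * x ^+ 2)); last first.
  by rewrite ler_wpM2r// sqr_ge0.
have -> : x^-1 ^+ k.+2 * expR (- (x^-1 / 4)) * x ^+ 2 = x^-1 ^+ k * expR (- (x^-1 / 4)).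
  by rewrite !exprS; field; rewrite gt_eqF.
by rewrite ler_wpM2l// exprn_ge0.
Qed.

Lemma der_flat_k k (x : R) : is_derive x 1 (flat k) (flat k.+2 x + - k%:R * flat k.+1 x).
Proof.
case: (ltgtP x 0) => [x0|x0|->].
- rewrite !flat0 ?(ltW x0)// mulr0 addr0.
  refine (der_near _ (der_cst 0 x)).
  by near=> y; rewrite flat0// ltW//; near: y; exact: lt_nbhsl.
- have xN : x != 0 by rewrite gt_eqF.
  have dV : is_derive x 1 (fun y : R => y^-1) (- x ^- 2).
    by apply: der_eq (der_inv (f := fun y => y) xN (der_id x)) _; rewrite mulr1.
  have dE : is_derive x 1 (fun y : R => expR (- y^-1)) (expR (- x^-1) * - (- x ^- 2)).
    exact: der_expR (der_opp dV).
  have dX : is_derive x 1 (fun y : R => y^-1 ^+ k) (k%:R * x^-1 ^+ k.-1 * (- x ^- 2)).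
    have h := der_exprn k x^-1.
    exact: (der_comp h dV).
  refine (der_eq (der_near _ (der_mul dX dE)) _).
    by near=> y; rewrite /flat ifT//; near: y; exact: lt_nbhsr.
  rewrite /flat x0.
  case: k {dX} => [|k] /=; first by rewrite !exprS expr0; field.
  by rewrite !exprS; field.
- rewrite !flat0// mulr0 addr0; exact: der_flat (flat_le_sqr k).
Unshelve. all: by end_near. Qed.

Lemma Cn_flat n k : Cn n (flat k).
Proof.
elim: n k => [|n IH] k.
  have d := der_flat_k k; exact: (der_continuous d).
exists (fun x => flat k.+2 x + - k%:R * flat k.+1 x); first exact: der_flat_k.
by apply: Cn_add => //; apply: Cn_mul => //; exact: Cn_cst.
Qed.

Definition smoothstep (x : R) : R := flat 0 x * (flat 0 x + flat 0 (- 1 * x + 1))^-1.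

Lemma smoothstep_den_gt0 x : 0 < flat 0 x + flat 0 (- 1 * x + 1).
Proof.
have [x0|x0] := ltP 0 x; first by rewrite ltr_pwDl ?flat_gt0 ?flat_ge0.
by rewrite ltr_wpDl ?flat_ge0// flat_gt0//; lra.
Qed.

Lemma smoothstep0 x : x <= 0 -> smoothstep x = 0.
Proof. by move=> x0; rewrite /smoothstep flat0// mul0r. Qed.

Lemma smoothstep1 x : 1 <= x -> smoothstep x = 1.
Proof.
move=> x1; rewrite /smoothstep [flat 0 (_ + _)]flat0; last lra.
by rewrite addr0 divff// gt_eqF// flat_gt0//; lra.
Qed.

Lemma Cn_smoothstep n : Cn n smoothstep.
Proof.
apply: Cn_mul; first exact: Cn_flat.
apply: Cn_inv; first by move=> x; rewrite gt_eqF// smoothstep_den_gt0.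
by apply: Cn_add; [exact: Cn_flat|apply: Cn_comp_affine; exact: Cn_flat].
Qed.

(* Equal to 1 on [A / 2, 2 * B], supported in [A / 4, 4 * B]. *)
Definition plateau (A B : R) (r : R) : R :=
  smoothstep (4 / A * r + - 1) * smoothstep (- (2 * B)^-1 * r + 2).

Lemma Cn_plateau n A B : Cn n (plateau A B).
Proof. by apply: Cn_mul; apply: Cn_comp_affine; exact: Cn_smoothstep. Qed.

Lemma plateau1 A B r : 0 < A -> 0 < B -> A / 2 <= r <= 2 * B -> plateau A B r = 1.
Proof.
move=> A0 B0 /andP[Ar rB].
have h1 : (2 * B)^-1 * r <= 1 by rewrite mulrC ler_pdivrMr ?mul1r// mulr_gt0.
have h2 : 2 <= 4 / A * r by rewrite mulrAC ler_pdivlMr//; lra.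
rewrite /plateau !smoothstep1 ?mulr1//; last by move: (4 / A * r) h2 => X; lra.
by rewrite mulNr; move: ((2 * B)^-1 * r) h1 => X; lra.
Qed.

Lemma plateau0 A B r : 0 < A -> 0 < B -> ~~ (A / 4 <= r <= 4 * B) -> plateau A B r = 0.
Proof.
move=> A0 B0; rewrite negb_and -!ltNge => /orP[h|h]; rewrite /plateau.
  have h1 : 4 / A * r <= 1 by rewrite mulrAC ler_pdivrMr//; lra.
  by rewrite smoothstep0 ?mul0r//; move: (4 / A * r) h1 => X; lra.
have B2 : 0 < 2 * B by rewrite mulr_gt0.
have h1 : 2 <= (2 * B)^-1 * r by rewrite mulrC ler_pdivlMr//; lra.
by rewrite [X in _ * X]smoothstep0 ?mulr0// mulNr; move: ((2 * B)^-1 * r) h1 => X; lra.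
Qed.

End smooth_functions_of_one_variable.

(** * Uniform bounds for the symbol *)

Section uniformly_bounded_derivatives.
Context {R : realType} (P : Type).
Implicit Types (dom : P -> R -> Prop) (F G : P -> R -> R).

Definition ubounded dom F := exists C : R, forall p s, dom p s -> `|F p s| <= C.

(** At each order one constant serves all parameters [p]; the domain may itself vary with [p]. *)
Fixpoint bd (n : nat) dom F : Prop :=
  ubounded dom F /\
  (if n is n'.+1 then
     exists2 F', (forall p (s : R), dom p s -> is_derive s 1 (F p) (F' p s)) & bd n' dom F'
   else True).

Lemma bd_ubounded n dom F : bd n dom F -> ubounded dom F.
Proof. by case: n => [|n] []. Qed.

Lemma bdW n dom F : bd n.+1 dom F -> bd n dom F.
Proof.
elim: n F => [|n IH] F [bF [F' dF bF']]; first by split.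
by split=> //; exists F' => //; exact: IH.
Qed.

Lemma ubounded_add dom F G : ubounded dom F -> ubounded dom G ->
  ubounded dom (fun p s => F p s + G p s).
Proof.
move=> [C FC] [D GD]; exists (C + D) => p s ps.
by rewrite (le_trans (ler_normD _ _))// lerD ?FC ?GD.
Qed.

Lemma ubounded_mul dom F G : ubounded dom F -> ubounded dom G ->
  ubounded dom (fun p s => F p s * G p s).
Proof.
move=> [C FC] [D GD]; exists (C * D) => p s ps.
by rewrite normrM ler_pM ?FC ?GD.
Qed.

Lemma bd_add n dom F G : bd n dom F -> bd n dom G -> bd n dom (fun p s => F p s + G p s).
Proof.
elim: n F G => [|n IH] F G [bF dF] [bG dG]; first by split=> //; exact: ubounded_add.
move: dF dG => [F' dF bF'] [G' dG bG']; split; first exact: ubounded_add.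
exists (fun p s => F' p s + G' p s); last exact: IH.
by move=> p s ps; exact: (der_add (dF p s ps) (dG p s ps)).
Qed.

Lemma bd_mul n dom F G : bd n dom F -> bd n dom G -> bd n dom (fun p s => F p s * G p s).
Proof.
elim: n F G => [|n IH] F G BF BG; have [bF dF] := BF; have [bG dG] := BG.
  by split=> //; exact: ubounded_mul.
move: dF dG => [F' dF bF'] [G' dG bG']; split; first exact: ubounded_mul.
exists (fun p s => F' p s * G p s + F p s * G' p s).
  by move=> p s ps; exact: (der_mul (dF p s ps) (dG p s ps)).
by apply: bd_add; apply: IH => //; exact: bdW.
Qed.

Lemma bd_cst n dom (c : R) : bd n dom (fun _ _ => c).
Proof.
elim: n c => [|n IH] c; split=> //; try by exists `|c|.
by exists (fun _ _ => 0) => // p s _; exact: der_cst.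
Qed.

Lemma bd_ext n dom F G : (forall p s, dom p s -> \forall s' \near s, dom p s') ->
  (forall p s, dom p s -> F p s = G p s) -> bd n dom F -> bd n dom G.
Proof.
move=> dom_open FG bF; have [C FC] := bd_ubounded bF.
have bG : ubounded dom G by exists C => p s ps; rewrite -FG// FC.
case: n bF => [_|n [_ [F' dF bF']]]; first by split.
split=> //; exists F' => // p s ps; refine (der_near _ (dF p s ps)).
by apply: filterS (dom_open p s ps) => s' /FG ->.
Qed.

(* A family supported well inside [dom] keeps its bounds after extension by zero. *)
Lemma bd_glue n dom F :
  (forall p s, dom p s -> \forall s' \near s, dom p s') ->
  (forall p s, dom p s \/ \forall s' \near s, F p s' = 0) ->
  bd n dom F -> bd n (fun _ _ => True) F.
Proof.
move=> dom_open; elim: n F => [|n IH] F dF0 [[C FC] dF].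
  split=> //; exists (Num.max C 0) => p s _; have [ps|/nbhs_singleton ->] := dF0 p s.
    by rewrite le_max FC.
  by rewrite normr0 le_max lexx orbT.
have b0 : ubounded (fun _ _ => True) F.
  exists (Num.max C 0) => p s _; have [ps|/nbhs_singleton ->] := dF0 p s.
    by rewrite le_max FC.
  by rewrite normr0 le_max lexx orbT.
split=> //; move: dF => [F' dF bF'].
(* This derivative is set to 0 wherever [F] vanishes nearby, so it inherits the support property for
   the induction; on [dom] it equals [F'] by uniqueness of derivatives. *)
pose F'' p s := if pselect (\forall s' \near s, F p s' = 0) then 0 else F' p s.
exists F''.
  move=> p s _; rewrite /F''; case: pselect => [h|nh].
    refine (der_near _ (der_cst 0 s)); exact: h.
  by have [ps|//] := dF0 p s; exact: dF.
apply: IH.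
  move=> p s; have [ps|h] := dF0 p s; first by left.
  right; apply: filterS (near_join h) => s' hs'.
  by rewrite /F''; case: pselect.
apply: bd_ext bF' => // p s ps; rewrite /F''; case: pselect => // h.
have d0 : is_derive s (1 : R) (F p) 0 by refine (der_near _ (der_cst 0 s)); exact: h.
by case: (dF p s ps) => _ <-; case: d0.
Qed.

(** The nested existential derivatives are unrolled into a sequence [G], the form wanted by
    [fdiff1_bound], with one [D] for all orders and parameters. *)
Lemma bd_chain n F : bd n (fun _ _ => True) F ->
  exists2 D : R, 0 < D & forall p, exists G : nat -> R -> R, [/\ G 0%N = F p,
    (forall k, (k < n)%N -> forall s : R, is_derive s 1 (G k) (G k.+1 s)) &
    (forall k, (k <= n)%N -> forall s, `|G k s| <= D)].
Proof.
elim: n F => [|n IH] F [[C FC] dF].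
  exists (Num.max C 1); first by rewrite lt_max ltr01 orbT.
  move=> p; exists (fun _ => F p); split=> // k _ s.
  by rewrite le_max FC.
move: dF => [F' dF /IH[D D0 GD]].
exists (Num.max C D); first by rewrite lt_max D0 orbT.
move=> p; have [G [G0 dG GD']] := GD p.
exists (fun k => if k is k'.+1 then G k' else F p); split=> //.
  by move=> [|k] kn s; [rewrite G0; exact: dF|exact: dG].
by move=> [|k] kn s; rewrite le_max; [rewrite FC|rewrite GD' ?orbT].
Qed.

End uniformly_bounded_derivatives.

Section symbol.
Context {R : realType}.
Variables (a b : R).
Hypotheses (a0 : 0 < a) (ab : a < b).

(* Parameters of a slice of the rescaled symbol: the frequency scale [lam], the
   time [time], and the part [rest] of [|eta|^2] carried by the frozen
   coordinates, so that [|eta|^2 = s^2 + rest] along the slice. *)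
Record slice := Slice { lam : R; time : R; rest : R;
  lam_gt0 : 0 < lam; time_gt0 : 0 < time; rest_ge0 : 0 <= rest }.

Implicit Types (p : slice) (s : R).

Definition radius p s : R := s ^+ 2 + rest p.

Definition annulus p s : Prop := a < radius p s < b.

Lemma radius_continuous p : continuous (radius p).
Proof. by move=> s; apply: cvgD; [exact: exprn_continuous|exact: cvg_cst]. Qed.

Lemma annulus_open p s : annulus p s -> \forall s' \near s, annulus p s'.
Proof.
move=> /andP[h1 h2]; have c := @radius_continuous p s.
near=> s'; apply/andP; split.
  by near: s'; exact: (cvgr_gt _ c).
by near: s'; exact: (cvgr_lt _ c).
Unshelve. all: by end_near. Qed.

Lemma der_radius p s : is_derive s 1 (radius p) (2 * s).
Proof.
apply: der_eq (der_add (der_exprn 2 s) (der_cst (rest p) s)) _.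
by rewrite /= expr1 addr0.
Qed.

(* The derivatives of the functions below are polynomials in them with constant
   coefficients, so all their derivatives are bounded uniformly in the slice. *)
Definition absc p s : R := s.
Definition iradius p s : R := (radius p s)^-1.
Definition zeta p s : R := lam p ^+ 2 * radius p s.
Definition bracket p s : R := Num.sqrt (1 + zeta p s).
Definition ibracket p s : R := (bracket p s)^-1.
Definition ratio p s : R := lam p * Num.sqrt (radius p s) * ibracket p s.
(** The signs [sg = 1] and [sg = -1] give the two exponentials of [calA] and [calB], multiplied by
    [exp (- |xi|^2 t)] and by [exp ((a / 4) lam^2 t)], which compensates the rate that is factored
    out. Differentiation raises the power [k]. *)
Definition decay (sg : R) (k : nat) p s : R :=
  (time p * zeta p s) ^+ k *
  expR (- (1 + zeta p s + sg * bracket p s) * time p + a / 4 * lam p ^+ 2 * time p).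

Lemma zeta_gt0 p s : annulus p s -> 0 < zeta p s.
Proof.
move=> /andP[h _]; rewrite mulr_gt0 ?exprn_gt0 ?lam_gt0//; exact: lt_trans h.
Qed.

Lemma bracket_gt1 p s : annulus p s -> 1 < bracket p s.
Proof.
move=> /zeta_gt0 z0; rewrite -[X in X < _]sqrtr1 ltr_sqrt; first by rewrite ltrDl.
by rewrite addr_gt0.
Qed.

Lemma sqr_bracket p s : annulus p s -> bracket p s ^+ 2 = 1 + zeta p s.
Proof. by move=> /zeta_gt0 z0; rewrite sqr_sqrtr// addr_ge0// ltW. Qed.

Lemma sqr_ratio p s : annulus p s -> ratio p s ^+ 2 = 1 - ibracket p s ^+ 2.
Proof.
move=> ps; have b1 := bracket_gt1 ps; have /andP[r0 _] := ps.
rewrite /ratio /ibracket !exprMn sqr_sqrtr; last by rewrite ltW// (lt_trans a0).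
rewrite -/(zeta p s) exprVn sqr_bracket//.
have z0 := zeta_gt0 ps; field; rewrite gt_eqF//; lra.
Qed.

Lemma der_zeta p s : is_derive s 1 (zeta p) (lam p ^+ 2 * (2 * s)).
Proof.
by apply: der_eq (der_mul (der_cst (lam p ^+ 2) s) (der_radius p s)) _; rewrite mul0r add0r.
Qed.

Lemma der_iradius p s : annulus p s ->
  is_derive s 1 (iradius p) (- 2 * absc p s * (iradius p s * iradius p s)).
Proof.
move=> /andP[r0 _]; have rN : radius p s != 0 by rewrite gt_eqF// (lt_trans a0).
apply: der_eq (der_inv rN (der_radius p s)) _.
by rewrite /iradius /absc; field.
Qed.

Lemma der_bracket p s : annulus p s ->
  is_derive s 1 (bracket p) (lam p ^+ 2 * s * ibracket p s).
Proof.
move=> ps; have z0 := zeta_gt0 ps; have b1 := bracket_gt1 ps.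
have d : is_derive s (1 : R) (fun y => 1 + zeta p y) (0 + lam p ^+ 2 * (2 * s)).
  exact: (der_add (der_cst 1 s) (der_zeta p s)).
have z1 : 0 < 1 + zeta p s by rewrite addr_gt0.
apply: der_eq (@der_sqrt _ (fun y => 1 + zeta p y) s _ z1 d) _; rewrite -/(bracket p s) /ibracket; field.
by rewrite gt_eqF// (lt_trans _ b1).
Qed.

(** Differentiating the bracket brings out [lam^2], which is unbounded; here it is traded for the
    squared bracket, which cancels against inverse brackets. *)
Lemma lam2E p s : annulus p s ->
  lam p ^+ 2 = (bracket p s ^+ 2 - 1) * iradius p s.
Proof.
move=> ps; have /andP[r0 _] := ps; have rN : radius p s != 0 by rewrite gt_eqF// (lt_trans a0).
by rewrite sqr_bracket// /zeta /iradius; field.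
Qed.

Lemma der_ibracket p s : annulus p s ->
  is_derive s 1 (ibracket p) (- 1 * absc p s * iradius p s *
    (ibracket p s + - 1 * (ibracket p s * ibracket p s * ibracket p s))).
Proof.
move=> ps; have b1 := bracket_gt1 ps.
have bN : bracket p s != 0 by rewrite gt_eqF// (lt_trans _ b1).
apply: der_eq (der_inv bN (der_bracket ps)) _.
by rewrite (lam2E ps) /ibracket /absc; field.
Qed.

Lemma der_ratio p s : annulus p s ->
  is_derive s 1 (ratio p) (absc p s * iradius p s * (ratio p s * (ibracket p s * ibracket p s))).
Proof.
move=> ps; have b1 := bracket_gt1 ps; have /andP[r0 _] := ps.
have r1 : 0 < radius p s by rewrite (lt_trans a0).
have bN : bracket p s != 0 by rewrite gt_eqF// (lt_trans _ b1).
have sN : Num.sqrt (radius p s) != 0 by rewrite gt_eqF// sqrtr_gt0.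
have d := der_mul (der_mul (der_cst (lam p) s) (der_sqrt r1 (der_radius p s))) (der_ibracket ps).
apply: der_eq d _; rewrite /ratio /absc /ibracket.
have -> : iradius p s = Num.sqrt (radius p s) ^- 2 by rewrite sqr_sqrtr// ltW.
by field; rewrite bN sN.
Qed.

Lemma der_decay sg k p s : annulus p s ->
  is_derive s 1 (decay sg k p) (absc p s * iradius p s *
    ((2 * k%:R) * decay sg k p s + - 1 * (2 + sg * ibracket p s) * decay sg k.+1 p s)).
Proof.
move=> ps; have b1 := bracket_gt1 ps; have /andP[r0 _] := ps.
have rN : radius p s != 0 by rewrite gt_eqF// (lt_trans a0).
have bN : bracket p s != 0 by rewrite gt_eqF// (lt_trans _ b1).
have dy : is_derive s (1 : R) (fun y => time p * zeta p y) (0 * zeta p s + time p * (lam p ^+ 2 * (2 * s))).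
  exact: (der_mul (der_cst (time p) s) (der_zeta p s)).
have dyk := @der_comp _ (fun y : R => y ^+ k) (fun y => time p * zeta p y) s _ _ (der_exprn k _) dy.
have dS : is_derive s (1 : R) (fun y => sg * bracket p y) (0 * bracket p s + sg * (lam p ^+ 2 * s * ibracket p s)).
  exact: (der_mul (der_cst sg s) (der_bracket ps)).
have dz : is_derive s (1 : R) (fun y => 1 + zeta p y + sg * bracket p y) _ :=
  der_add (der_add (der_cst 1 s) (der_zeta p s)) dS.
have dE := der_expR (der_add (der_mul (der_opp dz) (der_cst (time p) s))
  (der_cst (a / 4 * lam p ^+ 2 * time p) s)).
apply: der_eq (der_mul dyk dE) _; rewrite /decay; set E := expR _.
rewrite /ibracket /iradius /absc /zeta.
case: k {dyk} => [|k] /=; rewrite ?expr0 ?exprS ?expr1 ?mul0r ?add0r; field; by rewrite ?rN ?bN.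
Qed.

(** With [B] the bracket, [B^2 - B - (B^2 - 1) / 2 = (B - 1)^2 / 2 >= 0]. The exponent is therefore
    at most [- t zeta / 2 + a lam^2 t / 4 <= - t zeta / 4], as [zeta >= a lam^2]: one quarter pays
    for the rate and one is left for the power. *)
Lemma decay_le sg k p s : -1 <= sg -> annulus p s ->
  `|decay sg k p s| <= (4 * k%:R) ^+ k.
Proof.
move=> sg1 ps; have z0 := zeta_gt0 ps; have b1 := bracket_gt1 ps.
have t0 := time_gt0 p; have l0 := lam_gt0 p; have /andP[r0 _] := ps.
have y0 : 0 <= time p * zeta p s by rewrite mulr_ge0// ltW.
rewrite ger0_norm; last by rewrite mulr_ge0 ?expR_ge0// exprn_ge0.
apply: le_trans (powX_expR_le k y0).
rewrite ler_wpM2l ?exprn_ge0// ler_expR.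
have h1 : a * lam p ^+ 2 * time p <= time p * zeta p s.
  by rewrite mulrC ler_pM2l// /zeta mulrC ler_pM2l ?exprn_gt0// ltW.
have h2 : zeta p s / 2 <= 1 + zeta p s + sg * bracket p s.
  have := sqr_bracket ps; move: (bracket p s) b1 => B b1 B2.
  have : - B <= sg * B by rewrite -mulN1r ler_wpM2r// ltW// (lt_trans _ b1).
  nra.
have h3 : time p * zeta p s / 2 <= (1 + zeta p s + sg * bracket p s) * time p.
  by rewrite -mulrA mulrC ler_wpM2r// ltW.
rewrite mulNr (_ : a / 4 * lam p ^+ 2 * time p = a * lam p ^+ 2 * time p / 4); last by field.
move: h1 h3; move: (time p * zeta p s) ((1 + zeta p s + sg * bracket p s) * time p)
  (a * lam p ^+ 2 * time p) => X Y Z h1 h3; lra.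
Qed.

Lemma ubounded_decay sg k : -1 <= sg -> ubounded annulus (decay sg k).
Proof. by move=> sg1; exists ((4 * k%:R) ^+ k) => p s ps; exact: decay_le. Qed.

Lemma ubounded_absc : ubounded annulus absc.
Proof.
exists (b + 1) => p s /andP[_ rb]; rewrite /absc.
have c0 := rest_ge0 p; have s2 : s ^+ 2 <= b by rewrite (le_trans _ (ltW rb))// lerDl.
have b0 : 0 < b by rewrite (lt_trans a0).
rewrite -(@ler_pXn2r _ 2)// ?nnegrE ?(addr_ge0 (ltW b0))//.
rewrite real_normK ?num_real//; apply: le_trans s2 _.
by rewrite sqrrD mulr1 expr1n; have := sqr_ge0 b; move: b b0 => B B0; lra.
Qed.

Lemma ubounded_iradius : ubounded annulus iradius.
Proof.
exists a^-1 => p s /andP[ra _]; have r0 := lt_trans a0 ra.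
by rewrite /iradius ger0_norm ?invr_ge0 1?ltW// ltf_pV2.
Qed.

Lemma ubounded_ibracket : ubounded annulus ibracket.
Proof.
exists 1 => p s ps; have b1 := bracket_gt1 ps; have b0 := lt_trans ltr01 b1.
by rewrite /ibracket ger0_norm ?invr_ge0 ?(ltW b0)// invf_le1// ltW.
Qed.

Lemma ubounded_ratio : ubounded annulus ratio.
Proof.
exists 1 => p s ps; rewrite -(@ler_pXn2r _ 2)// ?nnegrE// real_normK ?num_real//.
by rewrite sqr_ratio// expr1n lerBlDr lerDl sqr_ge0.
Qed.

(** The families are treated together because their derivatives involve one another; [sg] and [k]
    are quantified inside the induction, since differentiating [decay sg k] brings in
    [decay sg k.+1]. *)
Lemma bd_symbol_generators n :
  [/\ bd n annulus absc, bd n annulus iradius, bd n annulus ibracket,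
      bd n annulus ratio & forall sg k, -1 <= sg -> bd n annulus (decay sg k)].
Proof.
elim: n => [|n [Ba Bi Bb Br Bd]].
  split; try by split=> //; first [exact: ubounded_absc|exact: ubounded_iradius
    |exact: ubounded_ibracket|exact: ubounded_ratio].
  by move=> sg k sg1; split=> //; exact: ubounded_decay.
have C c := bd_cst n annulus c.
split.
- split; first exact: ubounded_absc.
  by exists (fun _ _ => 1); [move=> p s _; exact: der_id|exact: C].
- split; first exact: ubounded_iradius.
  exists (fun p s => - 2 * absc p s * (iradius p s * iradius p s)).
    exact: der_iradius.
  by apply: (bd_mul (F := fun p s => - 2 * absc p s)); [apply: bd_mul|apply: bd_mul].
- split; first exact: ubounded_ibracket.
  exists (fun p s => - 1 * absc p s * iradius p s *
    (ibracket p s + - 1 * (ibracket p s * ibracket p s * ibracket p s))).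
    exact: der_ibracket.
  apply: (bd_mul (F := fun p s => - 1 * absc p s * iradius p s)).
    by apply: (bd_mul (F := fun p s => - 1 * absc p s)) => //; exact: bd_mul.
  apply: bd_add => //; apply: bd_mul => //; apply: (bd_mul (F := fun p s => ibracket p s * ibracket p s)) => //.
  exact: bd_mul.
- split; first exact: ubounded_ratio.
  exists (fun p s => absc p s * iradius p s * (ratio p s * (ibracket p s * ibracket p s))).
    exact: der_ratio.
  by apply: (bd_mul (F := fun p s => absc p s * iradius p s)); [exact: bd_mul|apply: bd_mul => //; exact: bd_mul].
- move=> sg k sg1; split; first exact: ubounded_decay.
  exists (fun p s => absc p s * iradius p s *
    ((2 * k%:R) * decay sg k p s + - 1 * (2 + sg * ibracket p s) * decay sg k.+1 p s)).
    by move=> p s; exact: der_decay.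
  apply: (bd_mul (F := fun p s => absc p s * iradius p s)); first exact: bd_mul.
  apply: bd_add; first by apply: bd_mul => //; exact: Bd.
  apply: (bd_mul (F := fun p s => - 1 * (2 + sg * ibracket p s))); last exact: Bd.
  by apply: bd_mul => //; apply: bd_add => //; exact: bd_mul.
Qed.

Lemma ubounded_continuous (f : R -> R) : continuous f ->
  ubounded annulus (fun p s => f (radius p s)).
Proof.
move=> cf; have cn : {within `[a, b], continuous (fun x => `|f x|)}.
  apply: continuous_subspaceT => x; apply: continuous_comp; first exact: cf.
  exact: norm_continuous.
have [c _ fc] := EVT_max (ltW ab) cn.
exists `|f c| => p s /andP[h1 h2]; apply: fc.
by rewrite in_itv/= !ltW.
Qed.

Lemma bd_radius n (f : R -> R) : Cn n f -> bd n annulus (fun p s => f (radius p s)).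
Proof.
elim: n f => [|n IH] f Cf; first by split=> //; exact: ubounded_continuous.
split; first exact: ubounded_continuous (Cn_continuous Cf).
have [f' df Cf'] := Cf; have [Ba _ _ _ _] := bd_symbol_generators n.
exists (fun p s => f' (radius p s) * (2 * absc p s)).
  by move=> p s _; exact: (der_comp (df _) (der_radius p s)).
by apply: bd_mul; [exact: IH|apply: bd_mul => //; exact: bd_cst].
Qed.

(* [e^{(a/4) lam^2 t} e^{-|xi|^2 t}] times [A], [B] and [|xi| A]. *)
Definition symA p s : R := 2^-1 * (ibracket p s * (decay 1 0 p s + - 1 * decay (-1) 0 p s)).
Definition symB p s : R := 2^-1 * (decay 1 0 p s + decay (-1) 0 p s).
Definition symC p s : R := 2^-1 * (ratio p s * (decay 1 0 p s + - 1 * decay (-1) 0 p s)).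

Definition sym (i j : 'I_2) p s : R :=
  if i == j then (if i == 0 then - 1 else 1) * symA p s + symB p s else - 1 * symC p s.

Lemma bd_sym n i j : bd n annulus (sym i j).
Proof.
have [_ _ Bb Br Bd] := bd_symbol_generators n.
have C c := bd_cst n annulus c.
have d1 : bd n annulus (decay 1 0) by apply: Bd; lra.
have d2 : bd n annulus (decay (-1) 0) by apply: Bd.
have dd : bd n annulus (fun p s => decay 1 0 p s + - 1 * decay (-1) 0 p s).
  by apply: bd_add => //; exact: bd_mul.
rewrite /sym; case: (i == j); last by apply: bd_mul => //; apply: bd_mul => //; exact: bd_mul.
by apply: bd_add; apply: bd_mul => //; [apply: bd_mul => //; exact: bd_mul|exact: bd_add].
Qed.

End symbol.

(** * The symbol localized to the ring, and its restriction to lines *)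

Section localized_symbol.
Context {R : realType}.
Variables (A1 B1 : R).
Hypotheses (A0 : 0 < A1) (AB : A1 <= B1).

(** The annulus contains, with a margin, the interval [[A1 / 4, 4 * B1]] outside which the plateau
    vanishes; [bd_glue] needs that margin. The rate factored out is [a / 4]. *)
Let a := A1 / 8.
Let b := 8 * B1.

Definition locsym (i j : 'I_2) (p : @slice R) (s : R) : R :=
  plateau A1 B1 (radius p s) * sym a i j p s.

Lemma bd_locsym n i j : bd n (fun _ _ => True) (locsym i j).
Proof.
have B0 : 0 < B1 by exact: lt_le_trans AB.
have a0 : 0 < a by rewrite /a divr_gt0.
have ab : a < b.
  by rewrite /a /b; move: A0 AB => h1 h2; lra.
apply: (@bd_glue _ _ n (annulus a b)); first exact: annulus_open.
  move=> p s; have c := @radius_continuous R p s.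
  have [ps|ps] := pselect (annulus a b p s); [by left|right].
  have h : radius p s < A1 / 4 \/ 4 * B1 < radius p s.
    apply/orP; rewrite !ltNge -negb_and; apply/negP => /andP[h1 h2]; apply: ps.
    by rewrite /annulus /a /b; move: A0 AB h1 h2 => k1 k2 h1 h2; apply/andP; split; lra.
  have z r : r < A1 / 4 \/ 4 * B1 < r -> plateau A1 B1 r = 0.
    move=> [h'|h']; apply: plateau0 => //; rewrite negb_and -!ltNge h' ?orbT//.
  case: h => h.
    near=> s'; rewrite /locsym z ?mul0r//; left; near: s'; exact: (cvgr_lt _ c).
  near=> s'; rewrite /locsym z ?mul0r//; right; near: s'; exact: (cvgr_gt _ c).
apply: bd_mul; last exact: bd_sym.
by apply: bd_radius => //; exact: Cn_plateau.
Unshelve. all: by end_near. Qed.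

End localized_symbol.

Section multiplier.
Context {R : realType}.
Variables (A1 B1 : R).
Hypotheses (A0 : 0 < A1) (AB : A1 <= B1).
Implicit Types (i j : 'I_2) (t lam : R) (xi v : mR3 R).

Definition cutoff lam (xi : R3 R) : R := plateau A1 B1 (dot3 xi xi / lam ^+ 2).

Definition multiplier t lam i j (xi : R3 R) : R := cutoff lam xi * Ghat xi t i j.

Definition rate t lam : R := expR (- (A1 / 8 / 4 * lam ^+ 2 * t)).

Lemma dot3_ge0 (xi : R3 R) : 0 <= dot3 xi xi.
Proof. by rewrite /dot3 !addr_ge0// -expr2 sqr_ge0. Qed.

Lemma sqr_enorm (xi : R3 R) : enorm xi ^+ 2 = dot3 xi xi.
Proof. by rewrite sqr_sqrtr// dot3_ge0. Qed.

(** Completing the square: [dot3 xi xi - dot3 v xi ^+ 2] is the squared distance from the line to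
    the origin and, divided by [lam^2], becomes the [rest] of a slice. *)
Lemma dot3_line v (s : R) xi : dot3 v v = 1 ->
  dot3 (translate3 (scale3 s v) xi) (translate3 (scale3 s v) xi) =
  (s + dot3 v xi) ^+ 2 + (dot3 xi xi - dot3 v xi ^+ 2).
Proof.
move=> v1; have -> : (s + dot3 v xi) ^+ 2 + (dot3 xi xi - dot3 v xi ^+ 2) =
  s ^+ 2 * dot3 v v + 2 * s * dot3 v xi + dot3 xi xi by rewrite v1; ring.
by rewrite /dot3/translate3/scale3/=; ring.
Qed.

Lemma cauchy_schwarz3 (v xi : R3 R) : dot3 v xi ^+ 2 <= dot3 v v * dot3 xi xi.
Proof.
case: v => [[v1 v2] v3]; case: xi => [[x1 x2] x3]; rewrite /dot3/= -subr_ge0.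
have -> : (v1 * v1 + v2 * v2 + v3 * v3) * (x1 * x1 + x2 * x2 + x3 * x3) -
   (v1 * x1 + v2 * x2 + v3 * x3) ^+ 2 = (v1 * x2 - v2 * x1) ^+ 2 +
   (v1 * x3 - v3 * x1) ^+ 2 + (v2 * x3 - v3 * x2) ^+ 2 by ring.
by rewrite !addr_ge0// sqr_ge0.
Qed.

Lemma Ghat_sym (a : R) (p : @slice R) s xi i j :
  dot3 xi xi = zeta p s -> 0 <= radius p s ->
  Ghat xi (time p) i j = expR (- (a / 4 * lam p ^+ 2 * time p)) * sym a i j p s.
Proof.
move=> xz r0; have l0 := lam_gt0 p.
have e2 : enorm xi ^+ 2 = zeta p s by rewrite sqr_enorm.
have e1 : enorm xi = lam p * Num.sqrt (radius p s).
  by rewrite /enorm xz /zeta sqrtrM ?sqr_ge0// sqrtr_sqr gtr0_norm.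
have z0 : 0 <= zeta p s by rewrite -e2 sqr_ge0.
have b0 : bracket p s != 0 by rewrite gt_eqF// sqrtr_gt0 ltr_wpDr.
set t := time p; set K := a / 4 * lam p ^+ 2 * t.
have E sg : decay a sg 0 p s = expR K * (expR (- zeta p s * t) * expR ((-1 - sg * bracket p s) * t)).
  rewrite /decay expr0 mul1r -!expRD; congr expR; rewrite -/t -/K; ring.
have nz : expR K != 0 by rewrite gt_eqF// expR_gt0.
rewrite /Ghat !mxE /calA /calB e2 -/(bracket p s) expRN /sym /symA /symB /symC !E.
rewrite /ratio /ibracket e1 !mul1r !mulN1r.
rewrite !opprK.
set X := expR (- _ * _); set E1 := expR _; set E2 := expR _.
case: (i == j) => /=; last by field; rewrite nz b0.
by case: (i == 0); field; rewrite nz b0.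
Qed.

(** Scaled by [lam], every line in frequency space gives a slice, so one constant serves all lines,
    times and scales; each derivative in [s] costs [lam^-1]. *)
Lemma multiplier_slices n : exists2 D : R, 0 < D &
  forall i j t lam, 0 < t -> 0 < lam -> forall v xi, dot3 v v = 1 ->
  exists G : nat -> R -> R, [/\
    G 0%N = (fun s => multiplier t lam i j (translate3 (scale3 s v) xi)),
    (forall k, (k < n)%N -> forall s : R, is_derive s 1 (G k) (G k.+1 s)) &
    (forall k, (k <= n)%N -> forall s, `|G k s| <= lam^-1 ^+ k * (D * rate t lam))].
Proof.
have [D D0 DP] : exists2 D : R, 0 < D & forall i j p, exists G : nat -> R -> R,
    [/\ G 0%N = locsym A1 B1 i j p,
    (forall k, (k < n)%N -> forall s : R, is_derive s 1 (G k) (G k.+1 s)) &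
    (forall k, (k <= n)%N -> forall s, `|G k s| <= D)].
  have ij i j := bd_chain (bd_locsym A0 AB n i j).
  have [D00 p00 h00] := ij 0 0; have [D01 p01 h01] := ij 0 1.
  have [D10 p10 h10] := ij 1 0; have [D11 p11 h11] := ij 1 1.
  exists (D00 + D01 + D10 + D11); first by rewrite !addr_gt0.
  have o2 (k : 'I_2) : k = 0 \/ k = 1.
    by case: k => [[|[|//]] hk]; [left|right]; exact/val_inj.
  move=> i j p; have [->|->] := o2 i; have [->|->] := o2 j.
  - have [G [? ? Gb]] := h00 p; exists G; split=> // k kn s; apply: le_trans (Gb k kn s) _; lra.
  - have [G [? ? Gb]] := h01 p; exists G; split=> // k kn s; apply: le_trans (Gb k kn s) _; lra.
  - have [G [? ? Gb]] := h10 p; exists G; split=> // k kn s; apply: le_trans (Gb k kn s) _; lra.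
  - have [G [? ? Gb]] := h11 p; exists G; split=> // k kn s; apply: le_trans (Gb k kn s) _; lra.
exists D => // i j t lam t0 l0 v xi v1.
have c0 : 0 <= (dot3 xi xi - dot3 v xi ^+ 2) / lam ^+ 2.
  by rewrite divr_ge0 ?sqr_ge0// subr_ge0; have := cauchy_schwarz3 v xi; rewrite v1 mul1r.
pose p := Slice l0 t0 c0; have [G [G0 dG Gb]] := DP i j p.
exists (fun k s => lam^-1 ^+ k * (rate t lam * G k (lam^-1 * s + lam^-1 * dot3 v xi))).
have lN : lam != 0 by rewrite gt_eqF.
split.
- apply/funext => s; rewrite expr0 mul1r G0 /locsym.
  set s' := _ + _; set x := translate3 _ _.
  have zE : dot3 x x = zeta p s'.
    by rewrite /x dot3_line// /zeta /radius /= /s'; field.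
  have rE : dot3 x x / lam ^+ 2 = radius p s' by rewrite zE /zeta /=; field.
  have r0 : 0 <= radius p s' by rewrite -rE divr_ge0 ?sqr_ge0// dot3_ge0.
  by rewrite /multiplier /cutoff rE -[t]/(time p) (Ghat_sym (A1 / 8) i j zE r0) /rate mulrCA.
- move=> k kn s; have d : is_derive s (1 : R) (fun s => lam^-1 * s + lam^-1 * dot3 v xi) lam^-1.
    apply: der_eq (der_add (der_mul (der_cst lam^-1 s) (der_id s)) (der_cst _ s)) _.
    by rewrite mul0r mulr1 add0r addr0.
  have dc := der_comp (dG k kn _) d.
  apply: der_eq (der_mul (der_cst (lam^-1 ^+ k) s) (der_mul (der_cst (rate t lam) s) dc)) _.
  by rewrite exprS; ring.
- move=> k kn s; have li : 0 <= lam^-1 by rewrite invr_ge0 ltW.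
  rewrite normrM ger0_norm ?exprn_ge0// ler_wpM2l ?exprn_ge0//.
  by rewrite normrM ger0_norm ?expR_ge0// mulrC ler_wpM2r ?expR_ge0// Gb.
Qed.

Lemma multiplier_support t lam i j xi : 0 < lam ->
  4 * B1 * lam ^+ 2 < dot3 xi xi -> multiplier t lam i j xi = 0.
Proof.
move=> l0 h; rewrite /multiplier /cutoff plateau0 ?mul0r//; first exact: lt_le_trans AB.
by rewrite negb_and -!ltNge (ltr_pdivlMr _ _ (exprn_gt0 2 l0)) h orbT.
Qed.

(** The multiplier as a function of [y = |xi|^2]; evenness and measurability are inherited through
    [dot3 xi xi]. *)
Definition radial_multiplier t lam i j (y : R) : R :=
  plateau A1 B1 (y / lam ^+ 2) * (
  let e := Num.sqrt y in
  let s := Num.sqrt (1 + e ^+ 2) in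
  expR (- e ^+ 2 * t) * ((expR ((-1 - s) * t) - expR ((-1 + s) * t)) / (2 * s) *
   (if i == j then (if i == 0 then -1 else 1) else - e) +
   (expR ((-1 - s) * t) + expR ((-1 + s) * t)) / 2 *+ (i == j))).

Lemma multiplierE t lam i j xi : multiplier t lam i j xi = radial_multiplier t lam i j (dot3 xi xi).
Proof. by rewrite /multiplier /Ghat !mxE. Qed.

Lemma multiplier_even t lam i j xi : multiplier t lam i j (opp3 xi) = multiplier t lam i j xi.
Proof.
rewrite !multiplierE; congr radial_multiplier; rewrite /dot3/opp3/=; ring.
Qed.

Lemma measurable_radial_multiplier t lam i j : measurable_fun setT (radial_multiplier t lam i j).
Proof.
have me : measurable_fun setT (fun y : R => Num.sqrt y).
  exact: (continuous_measurable_fun (@sqrt_continuous R)).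
have me2 : measurable_fun setT (fun y : R => Num.sqrt y ^+ 2).
  exact: measurable_funX.
have ms : measurable_fun setT (fun y : R => Num.sqrt (1 + Num.sqrt y ^+ 2)).
  by apply: (measurableT_comp (continuous_measurable_fun (@sqrt_continuous R))); exact: measurable_funD.
have mE (sg : R) : measurable_fun setT (fun y : R => expR ((-1 + sg * Num.sqrt (1 + Num.sqrt y ^+ 2)) * t)).
  apply: (measurableT_comp (@measurable_expR R)); apply: measurable_funM => //.
  by apply: measurable_funD => //; exact: measurable_funM.
have mE1 : measurable_fun setT (fun y : R => expR ((-1 - Num.sqrt (1 + Num.sqrt y ^+ 2)) * t)).
  by have := mE (-1); under eq_fun do rewrite mulN1r.
have mE2 : measurable_fun setT (fun y : R => expR ((-1 + Num.sqrt (1 + Num.sqrt y ^+ 2)) * t)).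
  by have := mE 1; under eq_fun do rewrite mul1r.
apply: measurable_funM.
  apply: (@measurableT_comp _ _ _ _ _ _ (plateau A1 B1)); last exact: measurable_funM.
  exact: continuous_measurable_fun (Cn_continuous (Cn_plateau 0 A1 B1)).
apply: measurable_funM.
  apply: (measurableT_comp (@measurable_expR R)); apply: measurable_funM => //.
  exact: measurableT_comp.
apply: measurable_funD; last first.
  by case: (i == j); rewrite ?mulr1n ?mulr0n//; apply: measurable_funM => //; exact: measurable_funD.
apply: measurable_funM; last first.
  by case: (i == j) => //; exact: measurableT_comp.
apply: measurable_funM; first exact: measurable_funB.
(* The square root is positive, so its inverse is the exponential of minus its logarithm, a
   composition of measurable functions. *)
have -> : (fun y : R => (2 * Num.sqrt (1 + Num.sqrt y ^+ 2))^-1) =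
  (fun y : R => 2^-1 * expR (- ln (Num.sqrt (1 + Num.sqrt y ^+ 2)))).
  apply/funext => y; rewrite invfM expRN lnK// posrE sqrtr_gt0 ltr_wpDr// sqr_ge0//.
apply: measurable_funM => //; apply: (measurableT_comp (@measurable_expR R)).
by apply: measurableT_comp => //; exact: (measurableT_comp (@measurable_ln R)).
Qed.

Lemma measurable_multiplier t lam i j : measurable_fun setT (multiplier t lam i j : mR3 R -> R).
Proof.
have md : measurable_fun setT (fun xi : mR3 R => dot3 xi xi).
  apply: measurable_funD; first apply: measurable_funD.
  - by apply: measurable_funM; exact: measurableT_comp.
  - by apply: measurable_funM; exact: measurableT_comp.
  - by apply: measurable_funM; exact: measurable_snd.
have := measurableT_comp (measurable_radial_multiplier t lam i j) md.
by apply: eq_measurable_fun => xi _; rewrite multiplierE.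
Qed.

End multiplier.

(** * Weighted bounds for the multiplier and its differences *)

Section kernel.
Context {R : realType}.
Variables (A1 B1 : R).
Hypotheses (A0 : 0 < A1) (AB : A1 <= B1).
Implicit Types (i j : 'I_2) (t lam : R) (xi v : mR3 R).

Let mult t lam i j : mR3 R -> R := multiplier A1 B1 t lam i j.
Let rate t lam := rate A1 t lam.

Lemma fdiff_eq0 n (m : mR3 R -> R) h v xi :
  (forall k, (k <= n)%N -> m (translate3 (scale3 (k%:R * h) v) xi) = 0) ->
  fdiff (scale3 h v) n m xi = 0.
Proof.
elim: n m => [|n IH] m m0 /=.
  by have := m0 0%N isT; rewrite mul0r translate3_0.
apply: IH => k kn; rewrite translate3_line (m0 k) ?subr0 1?ltnW//.
by have := m0 k.+1 kn; rewrite -natr1 mulrDl mul1r.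
Qed.

(** The case [T = 1] of [le_weight3]: on the ball each coordinate satisfies [(x_i / rho)^2 <= M]. *)
Lemma weight3_ball (M rho : R) xi : 0 < rho -> 0 <= M -> dot3 xi xi <= M * rho ^+ 2 ->
  1 <= (1 + M) ^+ 3 * weight3 rho^-1 xi.
Proof.
move=> r0 M0 xM; have r2 : 0 < rho ^+ 2 by rewrite exprn_gt0.
have c x : x ^+ 2 <= M * rho ^+ 2 -> 1 * (1 + (rho^-1 * x) ^+ 2) ^+ 3 <= (1 + M) ^+ 3.
  move=> h; rewrite mul1r lerXn2r// ?nnegrE ?addr_ge0 ?sqr_ge0// lerD2l.
  by rewrite exprMn exprVn mulrC ler_pdivrMr.
have := sqr_ge0 xi.1.1; have := sqr_ge0 xi.1.2; have := sqr_ge0 xi.2.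
move: xM; rewrite /dot3 -!expr2 => xM h1 h2 h3.
by apply: le_weight3; rewrite ?addr1_sqr_gt0 ?exprn_ge0 ?addr_ge0//; apply: c; lra.
Qed.

(** The right side minus the left is [|xi + 2 a|^2]. *)
Lemma dot3_translate_le xi (a : mR3 R) :
  dot3 xi xi <= 2 * dot3 (translate3 a xi) (translate3 a xi) + 2 * dot3 a a.
Proof.
have := dot3_ge0 (translate3 a (translate3 a xi)).
move=> h; rewrite -subr_ge0; apply: le_trans h _; rewrite le_eqVlt; apply/orP; left.
by apply/eqP; rewrite /dot3/translate3/=; ring.
Qed.

Lemma multiplier_bounds : exists2 C : R, 0 < C &
  forall i j t lam, 0 < t -> 0 < lam ->
  [/\ (forall xi, `|mult t lam i j xi| <= C * rate t lam * weight3 lam^-1 xi),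
   (forall v h xi, dot3 v v = 1 -> 0 < h <= pi * lam ->
     `|fdiff (scale3 h v) 6 (mult t lam i j) xi| <=
     C * rate t lam * (h / lam) ^+ 6 * weight3 lam^-1 xi) &
   exists L : R, forall v (s : R) xi, dot3 v v = 1 ->
     `|mult t lam i j (translate3 (scale3 s v) xi) - mult t lam i j xi| <= L * Num.min 1 `|s|].
Proof.
have [D D0 DP] := multiplier_slices A0 AB 6.
have B0 : 0 < B1 by exact: lt_le_trans AB.
(* Six steps of length at most [pi * lam] move a point by at most [6 pi lam]. Together with the
   bound [4 * B1] on the support of the cutoff, this makes [M * lam^2] bound [|xi|^2] on the support
   of the sixth difference too. *)
pose M : R := 2 * (4 * B1) + 2 * (36 * pi ^+ 2).
have [M0 MB] : 0 <= M /\ 4 * B1 <= M.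
  have := sqr_ge0 (pi : R).
  by rewrite /M; move: (pi ^+ 2) B0 => X h1 h2; split; lra.
have M3 : 0 < (1 + M) ^+ 3 by rewrite exprn_gt0// ltr_wpDr.
exists (D * (1 + M) ^+ 3); first by rewrite mulr_gt0.
move=> i j t lam t0 l0; have r0 : 0 < rate t lam by exact: expR_gt0.
(* A bounded function that vanishes outside a ball of radius proportional to [lam] is dominated by
   the weight, at the price of [(1 + M)^3]. *)
have extend (F : mR3 R -> R) (c : R) : 0 <= c -> (forall xi, `|F xi| <= D * rate t lam * c) ->
    (forall xi, M * lam ^+ 2 < dot3 xi xi -> F xi = 0) ->
    forall xi, `|F xi| <= D * (1 + M) ^+ 3 * rate t lam * c * weight3 lam^-1 xi.
  move=> c0 Fc F0 xi; have w0 := weight3_gt0 lam^-1 xi.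
  have [h|h] := leP (dot3 xi xi) (M * lam ^+ 2); last first.
    rewrite F0// normr0; refine (mulr_ge0 (mulr_ge0 (mulr_ge0 _ (ltW r0)) c0) (ltW w0)).
    exact: mulr_ge0 (ltW D0) (ltW M3).
  apply: le_trans (Fc xi) _.
  have := weight3_ball l0 M0 h; rewrite -subr_ge0 => /(mulr_ge0 (mulr_ge0 (mulr_ge0 (ltW D0) (ltW r0)) c0)).
  by move: (weight3 _ _) (rate _ _) => w r; nra.
have bound v xi : dot3 v v = 1 -> `|mult t lam i j xi| <= D * rate t lam.
  move=> v1; have [G [G0 _ Gb]] := DP i j t lam t0 l0 v xi v1.
  by have := Gb 0%N isT 0; rewrite G0 translate3_0 expr0 mul1r.
have e1u : dot3 (e1 : mR3 R) e1 = 1 by rewrite /dot3/e1/= !mul0r mulr1 !addr0.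
split.
- move=> xi; rewrite -[D * _ * _]mulr1; apply: (extend (mult t lam i j) 1 ler01 _ _ xi).
    by move=> x; rewrite mulr1; exact: (bound _ _ e1u).
  move=> x h; apply: multiplier_support => //; apply: le_lt_trans h.
  by rewrite ler_wpM2r// sqr_ge0.
- move=> v h xi v1 /andP[h0 hl]; apply: (extend (fdiff (scale3 h v) 6 (mult t lam i j))).
  + by rewrite exprn_ge0// divr_ge0// ltW.
  + move=> x; have [G [G0 dG Gb]] := DP i j t lam t0 l0 v x v1.
    rewrite -[x](translate3_0 v) fdiff_line -/mult.
    have E : (fun s => mult t lam i j (translate3 (scale3 s v) x)) = G 0%N by rewrite G0.
    rewrite E; apply: (le_trans (fdiff1_bound (D := lam^-1 ^+ 6 * (D * rate t lam)) h0 dG _)).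
      by move=> y _; exact: Gb.
    by rewrite exprMn mulrA mulrC.
  + move=> x Mx; apply: fdiff_eq0 => k k6; apply: multiplier_support => //.
    have := dot3_translate_le x (scale3 (k%:R * h) v).
    have -> : dot3 (scale3 (k%:R * h) v) (scale3 (k%:R * h) v) = (k%:R * h) ^+ 2.
      by rewrite -[RHS]mulr1 -v1 /dot3/scale3/=; ring.
    have kh : (k%:R * h) ^+ 2 <= 36 * pi ^+ 2 * lam ^+ 2.
      have -> : 36 * pi ^+ 2 * lam ^+ 2 = (6 * (pi * lam)) ^+ 2 by ring.
      rewrite lerXn2r ?nnegrE ?mulr_ge0 ?pi_ge0// ?(ltW h0) ?(ltW l0)//.
      by rewrite ler_pM ?(ltW h0)// (ler_nat R k 6).
    move: Mx kh; rewrite /M; set N := dot3 (translate3 _ _) _; set a2 := (_ * h) ^+ 2.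
    have -> : (2 * (4 * B1) + 2 * (36 * pi ^+ 2)) * lam ^+ 2 =
      2 * (4 * B1 * lam ^+ 2) + 2 * (36 * pi ^+ 2 * lam ^+ 2) by ring.
    by move: (4 * B1 * lam ^+ 2) (36 * pi ^+ 2 * lam ^+ 2) => X Y h1 h2 h3; lra.
(* An increment is at most [2 c], and at most [lam^-1 c |s|] by the first derivative; the sum of the
   constants covers both cases of the minimum. [L] may depend on [t] and [lam], as it enters only
   the limit in the inversion formula. *)
pose c := D * rate t lam; exists (2 * c + lam^-1 * c) => v s xi v1.
have c0 : 0 <= c by rewrite mulr_ge0// ltW.
have lc0 : 0 <= lam^-1 * c by rewrite mulr_ge0// invr_ge0 ltW.
have step (h : R) x : 0 < h ->
    `|mult t lam i j (translate3 (scale3 h v) x) - mult t lam i j x| <= lam^-1 * c * h.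
  move=> h0; have [G [G0 dG Gb]] := DP i j t lam t0 l0 v x v1.
  have H : `|fdiff1 h 1 (G 0%N) 0| <= h ^+ 1 * (lam^-1 * c).
    apply: fdiff1_bound => //; first by case=> // _ y; exact: dG.
    by move=> y _; have := Gb 1%N isT y; rewrite expr1.
  have E : fdiff1 h 1 (G 0%N) 0 = G 0%N h - G 0%N 0 by rewrite /fdiff1 add0r.
  move: H; rewrite E expr1 mulrC G0 => H.
  by rewrite -[X in _ - mult _ _ _ _ X](translate3_0 v x); exact: H.
move: (mult t lam i j) bound step => m bound step {extend}.
have lip : `|m (translate3 (scale3 s v) xi) - m xi| <= lam^-1 * c * `|s|.
  have [s0|s0|->] := ltgtP s 0.
  - have sN : 0 < - s by rewrite oppr_gt0.
    have := step _ (translate3 (scale3 s v) xi) sN.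
    by rewrite translate3_line subrr translate3_0 distrC (ltr0_norm s0).
  - by rewrite (gtr0_norm s0); exact: step.
  - by rewrite translate3_0 subrr normr0 mulr0.
have two : `|m (translate3 (scale3 s v) xi) - m xi| <= 2 * c.
  apply: le_trans (ler_normB _ _) _.
  by rewrite mulr_natl mulr2n lerD// /c (bound _ _ v1).
have [h1|h1] := leP 1 `|s|; first by rewrite mulr1; lra.
by apply: le_trans lip _; rewrite ler_wpM2r// lerDr mulr_ge0.
Qed.

End kernel.

(** * The convolution kernels *)

Section decaying_transforms.
Context {R : realType}.
Implicit Types (m : mR3 R -> R).

Lemma measurable_ctrans th m : measurable_fun setT m -> measurable_fun setT (ctrans th m).
Proof.
move=> mm; apply: (@measurable_Rintegral1 _ _ _ _ _ mu3
  (fun z : mR3 R * mR3 R => cos (dot3 z.2 z.1 + th) * m z.2)).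
apply: measurable_funM; last exact: (measurableT_comp mm measurable_snd).
apply: (measurableT_comp measurable_cosR).
by apply: measurable_funD => //; exact: measurable_dot3_pair.
Qed.

Lemma integrable_le_weight3 m (c rho : R) : 0 < rho -> measurable_fun setT m ->
  (forall x, `|m x| <= c * weight3 rho x) ->
  mu3.-integrable setT (EFin \o m) /\ \int[mu3]_x `|m x| <= c * (pi / rho) ^+ 3.
Proof.
move=> r0 mm mc; have wi := integrable_weight3 r0.
have cwi : mu3.-integrable setT (EFin \o (fun x => c * weight3 rho x)).
  have := integrableZl measurableT c wi; apply: eq_integrable => //.
have mi : mu3.-integrable setT (EFin \o m).
  apply: (le_integrable measurableT _ _ cwi); first exact/measurable_EFinP.
  by move=> x _; rewrite /= lee_fin (le_trans (mc x))// ler_norm.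
split=> //; rewrite -(Rintegral_weight3 r0) -RintegralZl//.
apply: le_Rintegral => //; exact: integrable_norm.
Qed.

Lemma ctrans_le_weight3 th m (c rho : R) : 0 < rho -> 0 <= c -> measurable_fun setT m ->
  (forall x, `|m x| <= c * weight3 rho^-1 x) ->
  (forall v, v \in [:: e1; e2; e3] -> forall h, 0 < h <= pi * rho ->
    forall x, `|fdiff (scale3 h v) 6 m x| <= c * (h / rho) ^+ 6 * weight3 rho^-1 x) ->
  forall x, `|ctrans th m x| <= 512 * (c * (pi * rho) ^+ 3) * weight3 rho x.
Proof.
move=> r0 c0 mm mc fc; have ri : 0 < rho^-1 by rewrite invr_gt0.
have [mi im] := integrable_le_weight3 ri mm mc; rewrite invrK in im.
apply: ctrans_decay => //.
  by rewrite mulr_ge0// exprn_ge0// mulr_ge0 ?pi_ge0// ltW.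
move=> v v123 h h0.
have [_] := integrable_le_weight3 ri (measurable_fdiff (scale3 h v) 6 mm) (fc v v123 h h0).
by rewrite invrK mulrAC.
Qed.

(** The mass [c (pi rho)^3] of the majorant of [m] meets the integral [(pi / rho)^3] of the weight
    on the transform side, so [rho] cancels; hence the kernel bound is uniform in the scale. *)
Lemma integrable_ctrans_weight3 th m (c rho : R) : 0 < rho -> 0 <= c -> measurable_fun setT m ->
  (forall x, `|m x| <= c * weight3 rho^-1 x) ->
  (forall v, v \in [:: e1; e2; e3] -> forall h, 0 < h <= pi * rho ->
    forall x, `|fdiff (scale3 h v) 6 m x| <= c * (h / rho) ^+ 6 * weight3 rho^-1 x) ->
  mu3.-integrable setT (EFin \o ctrans th m) /\
  \int[mu3]_x `|ctrans th m x| <= 512 * c * pi ^+ 6.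
Proof.
move=> r0 c0 mm mc fc; have lN : rho != 0 by rewrite gt_eqF.
have [-> le] := integrable_le_weight3 r0 (measurable_ctrans th mm) (ctrans_le_weight3 th r0 c0 mm mc fc).
split=> //; apply: le_trans le _; rewrite le_eqVlt; apply/orP; left; apply/eqP.
by field.
Qed.

End decaying_transforms.

Section green_kernel.
Context {R : realType}.
Variables (A1 B1 : R).
Hypotheses (A0 : 0 < A1) (AB : A1 <= B1).

(** The points [xi0] and [xi0 + xi] are joined by three segments parallel to the axes. *)
Lemma lipschitz_axes (m : mR3 R -> R) (L : R) :
  (forall v (s : R) xi, dot3 v v = 1 ->
    `|m (translate3 (scale3 s v) xi) - m xi| <= L * Num.min 1 `|s|) ->
  forall xi0 xi, `|m (translate3 xi0 xi) - m xi0| <= L * modulus xi.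
Proof.
move=> lip xi0 xi.
pose y1 := translate3 (scale3 xi.1.1 e1) xi0; pose y2 := translate3 (scale3 xi.1.2 e2) y1.
have -> : translate3 xi0 xi = translate3 (scale3 xi.2 e3) y2.
  by rewrite /y2 /y1 /translate3/scale3/=; congr (_, _, _); ring.
have -> z : z - m xi0 = (z - m y2) + (m y2 - m y1) + (m y1 - m xi0) by ring.
apply: le_trans (ler_normD _ _) _; rewrite /modulus !mulrDr.
have h1 : dot3 (e1 : mR3 R) e1 = 1 by rewrite /dot3/=; ring.
have h2 : dot3 (e2 : mR3 R) e2 = 1 by rewrite /dot3/=; ring.
have h3 : dot3 (e3 : mR3 R) e3 = 1 by rewrite /dot3/=; ring.
have l1 := lip e1 xi.1.1 xi0 h1; have l2 := lip e2 xi.1.2 y1 h2.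
have l3 := lip e3 xi.2 y2 h3.
have := ler_normD (m (translate3 (scale3 xi.2 e3) y2) - m y2) (m y2 - m y1).
move: l1 l2 l3; rewrite -/y1 -/y2.
move: (L * Num.min _ _) (L * Num.min _ _) (L * Num.min _ _) => a b c h4 h5 h6.
by move/le_trans => h; apply: le_trans (lerD (h _ (lerD h6 h5)) h4) _; lra.
Qed.

(** [K] is [(2 pi)^-3] times the cosine transform of the multiplier. The phase [a] in the last
    clause lets one kernel serve the cosine and the sine part of a Fourier transform. *)
Lemma green_kernel : exists2 C : R, 0 < C &
  forall i j t lam, 0 < t -> 0 < lam -> exists K : mR3 R -> R,
  [/\ mu3.-integrable setT (EFin \o K), forall x, K (opp3 x) = K x,
    (\int[mu3]_x `|K x|%:E <= (C * rate A1 t lam)%:E)%E &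
    forall xi a, \int[mu3]_x (cos (dot3 x xi + a) * K x) = cos a * multiplier A1 B1 t lam i j xi].
Proof.
have [C C0 CP] := multiplier_bounds A0 AB.
have P0 : 0 < (2 * pi) ^+ 3 :> R by rewrite exprn_gt0// mulr_gt0// pi_gt0.
exists ((2 * pi) ^- 3 * (512 * C * pi ^+ 6)).
  have c512 : 0 < 512 :> R by rewrite ltr0n.
  have piR : 0 < pi :> R := pi_gt0 R.
  refine (mulr_gt0 _ (mulr_gt0 (mulr_gt0 c512 C0) (exprn_gt0 6 piR))).
  by rewrite invr_gt0.
move=> i j t lam t0 l0; have [mC fC [L lip]] := CP i j t lam t0 l0.
have r0 : 0 < rate A1 t lam by exact: expR_gt0.
have mm := @measurable_multiplier R A1 B1 t lam i j.
have me := @multiplier_even R A1 B1 t lam i j.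
move: (multiplier A1 B1 t lam i j) mC fC lip mm me => m mC fC lip mm me.
have C1 : 0 <= C * rate A1 t lam by rewrite mulr_ge0// ltW.
have fC' v : v \in [:: e1; e2; e3] -> forall h, 0 < h <= pi * lam ->
    forall x, `|fdiff (scale3 h v) 6 m x| <= C * rate A1 t lam * (h / lam) ^+ 6 * weight3 lam^-1 x.
  move=> v123 h h0 x; apply: fC => //; move: v123; rewrite !inE.
  by move=> /or3P[] /eqP ->; rewrite /dot3/=; ring.
have li : 0 < lam^-1 by rewrite invr_gt0.
have [mi _] := integrable_le_weight3 li mm mC.
have [ci cb] := integrable_ctrans_weight3 0 l0 C1 mm mC fC'.
exists (fun x => (2 * pi) ^- 3 * ctrans 0 m x); split.
- by have := integrableZl measurableT ((2 * pi) ^- 3) ci; apply: eq_integrable.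
- move=> x; congr (_ * _).
  rewrite /ctrans -[RHS]Rintegral_opp3; last first.
    by apply: measurable_funM => //; exact: measurable_cos_dot3.
  apply: eq_Rintegral => xi _; rewrite me !addr0; congr (cos _ * _).
  by rewrite /dot3/opp3/=; ring.
- have ni : mu3.-integrable setT (EFin \o (fun x => `|ctrans 0 m x|)) by exact: integrable_norm.
  have E : (\int[mu3]_x `|ctrans 0 m x|%:E)%E = (\int[mu3]_x `|ctrans 0 m x|)%:E.
    by rewrite /Rintegral fineK//; exact: integrable_fin_num ni.
  under eq_integral do rewrite normrM EFinM.
  rewrite ge0_integralZl//; last first.
    by apply/measurable_EFinP; apply: measurableT_comp => //; exact: measurable_ctrans.
  have q0 : 0 <= ((2 * pi) ^+ 3)^-1 :> R by rewrite invr_ge0 ltW.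
  rewrite E -EFinM lee_fin (ger0_norm q0); apply: le_trans (ler_wpM2l q0 cb) _.
  move: (_^-1) (pi ^+ 6) (rate A1 t lam) => q p6 r.
  by rewrite le_eqVlt; apply/orP; left; apply/eqP; ring.
- move=> xi a; transitivity ((2 * pi) ^- 3 * \int[mu3]_x (cos (dot3 x xi + a) * ctrans 0 m x)).
    rewrite -RintegralZl//; last exact: (integrable_ctrans a xi ci).
    by apply: eq_Rintegral => x _; rewrite mulrCA.
  rewrite (ctrans_inversion mi me (lipschitz_axes lip xi) a ci).
  by rewrite mulKf// gt_eqF.
Qed.

End green_kernel.

(** * Smoothness and support of the frequency cutoff *)

Section smooth_functions_of_three_variables.
Context {R : realType}.
Implicit Types (f g : R3 R -> R).

(** A version of [smooth] graded by the order, which makes induction through products and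
    compositions possible. *)
Fixpoint Dn (n : nat) f : Prop :=
  if n is n'.+1 then (forall x, differentiable f x) /\ (forall v, Dn n' (fun x => 'D_v f x))
  else True.

Lemma DnW n f : Dn n.+1 f -> Dn n f.
Proof.
elim: n f => [//|n IH] f [df Df]; split=> // v; exact: IH.
Qed.

Lemma Dn_iter_derive n (s : seq (R3 R)) f : Dn (size s + n) f -> Dn n (iter_derive s f).
Proof.
elim: s n => [//|v s IH] n h; have [_ H] : Dn n.+1 (iter_derive s f) by apply: IH; rewrite addnS.
exact: H.
Qed.

Lemma Dn_smooth f : (forall n, Dn n f) -> smooth f.
Proof. by move=> Df s x; have [] := @Dn_iter_derive 1 s f (Df _). Qed.

Lemma Dn_cst n (c : R) : Dn n (fun=> c).
Proof.
elim: n c => [//|n IH] c; split=> [x|v]; first exact: differentiable_cst.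
by under eq_fun do rewrite derive_cst; exact: IH.
Qed.

Lemma Dn_add n f g : Dn n f -> Dn n g -> Dn n (fun x => f x + g x).
Proof.
elim: n f g => [//|n IH] f g [df Df] [dg Dg]; split=> [x|v].
  exact: differentiableD.
have -> : (fun x => 'D_v (fun x => f x + g x) x) = (fun x => 'D_v f x + 'D_v g x).
  by apply/funext => x; rewrite -deriveD//; exact: diff_derivable.
exact: (IH _ _ (Df v) (Dg v)).
Qed.

Lemma Dn_mul n f g : Dn n f -> Dn n g -> Dn n (fun x => f x * g x).
Proof.
elim: n f g => [//|n IH] f g Df Dg; have [df Df'] := Df; have [dg Dg'] := Dg.
split=> [x|v]; first exact: differentiableM.
have -> : (fun x => 'D_v (fun x => f x * g x) x) = (fun x => f x * 'D_v g x + g x * 'D_v f x).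
  apply/funext => x; rewrite -[LHS]/('D_v (f * g) x) deriveM//; exact: diff_derivable.
exact: Dn_add (IH _ _ (DnW Df) (Dg' v)) (IH _ _ (DnW Dg) (Df' v)).
Qed.

Lemma Dn_comp n (g : R -> R) f : Cn n g -> Dn n f -> Dn n (fun x => g (f x)).
Proof.
elim: n g f => [//|n IH] g f [g' dg Cg'] Df; have [df Df'] := Df.
have dg' y : differentiable g y by apply/derivable1_diffP; have [] := dg y.
split=> [x|v]; first exact: (differentiable_comp (df x) (dg' (f x))).
have -> : (fun x => 'D_v (fun x => g (f x)) x) = (fun x => g' (f x) * 'D_v f x).
  apply/funext => x; rewrite deriveE; last exact: (differentiable_comp (df x) (dg' (f x))).
  rewrite (diff_comp (df x) (dg' (f x))) /= -(deriveE v (df x)).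
  rewrite -[X in 'd g _ X]mulr1 -[X in 'd g _ X]/('D_v f x *: 1) linearZ /=.
  by rewrite -(@deriveE _ _ _ g (f x) (1 : R) (dg' (f x))) [LHS]mulrC; have [_ ->] := dg (f x).
exact: Dn_mul (IH _ _ Cg' (DnW Df)) (Df' v).
Qed.

Lemma Dn_linear n (f : {linear R3 R -> R}) : continuous f -> Dn n f.
Proof.
case: n => [//|n] cf; have df x := @linear_differentiable _ _ _ f x cf.
split=> // v; have -> : (fun x => 'D_v f x) = (fun=> f v).
  by apply/funext => x; rewrite (deriveE v (df x)) diff_lin.
exact: Dn_cst.
Qed.

Lemma continuous_dot3 : continuous (fun x : R3 R => dot3 x x).
Proof.
have c1 (x : R3 R) : {for x, continuous (fun x : R3 R => x.1.1)}.
  by apply: (@continuous_comp _ _ _ fst fst); exact: cvg_fst.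
have c2 (x : R3 R) : {for x, continuous (fun x : R3 R => x.1.2)}.
  by apply: (@continuous_comp _ _ _ fst snd); [exact: cvg_fst|exact: cvg_snd].
have c3 (x : R3 R) : {for x, continuous (fun x : R3 R => x.2)} by exact: cvg_snd.
move=> x; rewrite /dot3; apply: cvgD; first apply: cvgD.
- by apply: cvgM; exact: c1.
- by apply: cvgM; exact: c2.
- by apply: cvgM; exact: c3.
Qed.

Lemma Dn_dot3 n : Dn n (fun x : R3 R => dot3 x x).
Proof.
have h1 : Dn n (fun x : R3 R => x.1.1).
  by apply: (@Dn_linear n (fst \o fst)) => x; apply: continuous_comp; exact: cvg_fst.
have h2 : Dn n (fun x : R3 R => x.1.2).
  by apply: (@Dn_linear n (snd \o fst)) => x; apply: continuous_comp; [exact: cvg_fst|exact: cvg_snd].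
have h3 : Dn n (fun x : R3 R => x.2).
  by apply: (@Dn_linear n snd) => x; exact: cvg_snd.
by apply: Dn_add; [apply: Dn_add|]; exact: Dn_mul.
Qed.

End smooth_functions_of_three_variables.

Section cutoff.
Context {R : realType}.
Variables (A1 B1 lam : R).
Hypotheses (A0 : 0 < A1) (AB : A1 <= B1) (l0 : 0 < lam).

Let B0 : 0 < B1 := lt_le_trans A0 AB.
Let l2 : 0 < lam ^+ 2 := exprn_gt0 2 l0.

Lemma smooth_cutoff : smooth (cutoff A1 B1 lam).
Proof.
apply: Dn_smooth => n; apply: (@Dn_comp _ n (plateau A1 B1) (fun x => dot3 x x / lam ^+ 2)).
  exact: Cn_plateau.
by apply: Dn_mul; [exact: Dn_dot3|exact: Dn_cst].
Qed.

Lemma supp_cutoff xi : supp (cutoff A1 B1 lam) xi ->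
  A1 / 4 * lam ^+ 2 <= dot3 xi xi <= 4 * B1 * lam ^+ 2.
Proof.
pose S := [set x : R3 R | A1 / 4 * lam ^+ 2 <= dot3 x x <= 4 * B1 * lam ^+ 2].
have cS : closed S.
  have -> : S = (fun x : R3 R => dot3 x x) @^-1` `[A1 / 4 * lam ^+ 2, 4 * B1 * lam ^+ 2]%classic.
    by apply/seteqP; split=> x /=; rewrite in_itv.
  apply: closed_comp => [x _|]; first exact: continuous_dot3.
  exact: itv_closed.
move=> sx; suff : S xi by []; rewrite (closure_id S).1//.
apply: (closureS _ sx) => x /=; rewrite /cutoff /S/=; apply: contraNP => /negP h.
rewrite plateau0//; apply: contra h.
by rewrite (ler_pdivlMr _ _ l2) (ler_pdivrMr _ _ l2).
Qed.

Lemma compact_supp_cutoff : compact (supp (cutoff A1 B1 lam)).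
Proof.
(* From [y^2 <= X] follows [|y| <= X + 1], so the support lies in a cube, a product of compact
   segments. *)
pose M := 4 * B1 * lam ^+ 2 + 1; pose I := `[(- M), M]%classic : set R.
have cI : compact I by exact: segment_compact.
apply: (subclosed_compact (B := (I `*` I) `*` I)).
- exact: closed_closure.
- by apply: compact_setX => //; exact: compact_setX.
move=> x /supp_cutoff/andP[_]; rewrite /dot3 -!expr2 => h.
have b (y : R) : y ^+ 2 <= 4 * B1 * lam ^+ 2 -> I y.
  move=> y2; rewrite /I /= in_itv /= -ler_norml.
  have := normr_ge0 y; have : `|y| ^+ 2 = y ^+ 2 by rewrite real_normK ?num_real.
  by rewrite /M; move: (4 * B1 * lam ^+ 2) y2 => X h1 h2 h3; nra.
have := sqr_ge0 x.1.1; have := sqr_ge0 x.1.2; have := sqr_ge0 x.2 => h1 h2 h3.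
by split; [split|]; apply: b; move: h; lra.
Qed.

Lemma cutoff_near_ring r1 r2 (K : set (R3 R)) : 0 < r1 -> A1 = r1 ^+ 2 -> B1 = r2 ^+ 2 ->
  K `<=` scale_set lam (ring3 r1 r2) -> cutoff_near K (cutoff A1 B1 lam).
Proof.
move=> r10 A1E B1E sK; split.
- exact: smooth_cutoff.
- exact: compact_supp_cutoff.
- move=> /supp_cutoff/andP[+ _]; rewrite /dot3 /= !mulr0 !addr0.
  by apply/negP; rewrite -ltNge mulr_gt0// divr_gt0.
move=> _ /sK[eta /= /andP[h1 h2] <-].
have E : dot3 (lam *: eta) (lam *: eta) = lam ^+ 2 * enorm eta ^+ 2.
  by rewrite sqr_enorm -[lam *: eta]/(scale3 lam eta) /dot3/scale3/=; ring.
have e1 : A1 <= enorm eta ^+ 2 by rewrite A1E lerXn2r// ?nnegrE ?sqrtr_ge0// ltW.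
have e2 : enorm eta ^+ 2 <= B1.
  by rewrite B1E lerXn2r// ?nnegrE ?sqrtr_ge0// (le_trans (ltW r10))// (le_trans h1).
have c := @continuous_dot3 R (lam *: eta).
(* The plateau equals 1 on [[A1 / 2, 2 * B1]], whose interior contains [[A1, B1]]; continuity of
   [|y|^2] then yields a whole neighbourhood. *)
near=> y; rewrite /cutoff plateau1// (ler_pdivlMr _ _ l2) (ler_pdivrMr _ _ l2).
apply/andP; split; apply: ltW; near: y.
  apply: (cvgr_gt _ c); rewrite E mulrC ltr_pM2l//; apply: lt_le_trans e1; move: A0 => h; lra.
apply: (cvgr_lt _ c); rewrite E mulrC ltr_pM2r//; apply: le_lt_trans e2 _; move: B0 => h; lra.
Unshelve. all: by end_near. Qed.

End cutoff.

(** * Schwartz functions *)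

Section continuous_functions_are_measurable.
Context {R : realType}.

(* Caratheodory functions: [f] is the limit of [f (x, floor (n y) / n)]. *)
Lemma measurable_caratheodory d (T : measurableType d) (f : T * measurableTypeR R -> R) :
  (forall y, measurable_fun setT (fun x => f (x, y))) ->
  (forall x, continuous (fun y : R => f (x, y))) ->
  measurable_fun setT f.
Proof.
move=> mf cf; pose q (n : nat) (y : R) : R := (Num.floor (n.+1%:R * y))%:~R / n.+1%:R.
have n0 n : (0 : R) < n.+1%:R by rewrite ltr0n.
apply: (@measurable_fun_cvg _ _ _ _ (fun n z => f (z.1, q n z.2))).
  move=> n _ B mB; rewrite setTI.
  have -> : (fun z : T * measurableTypeR R => f (z.1, q n z.2)) @^-1` B =
      \bigcup_(k : int) ((fun x => f (x, k%:~R / n.+1%:R)) @^-1` B `*`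
        (`[k%:~R / n.+1%:R, (k + 1)%:~R / n.+1%:R[%classic : set (measurableTypeR R))).
    apply/seteqP; split=> [[x y] /= fB|[x y] /= [k _ [/= fB]]].
      exists (Num.floor (n.+1%:R * y)) => //; split=> //=; rewrite in_itv/=.
      by rewrite ler_pdivrMr// ltr_pdivlMr// ![y * _]mulrC floor_itv.
    rewrite in_itv/= ler_pdivrMr// ltr_pdivlMr// ![y * _]mulrC => h.
    by rewrite /q (floor_def h).
  apply: countable_bigcupT_measurable => [|k]; first exact: countableP.
  apply: measurableX; last exact: measurable_itv.
  by rewrite -[X in measurable X]setTI; exact: mf.
move=> [x y] _ /=; apply: (@cvg_comp _ _ _ (fun n => q n y) (fun y => f (x, y)) _ (nbhs y)); last exact: cf.
apply: (@squeeze_cvgr _ _ _ _ (fun n => y - harmonic n) (fun=> y)).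
- apply: nearW => n; have := floor_itv (n.+1%:R * y); rewrite /q intrD => /andP[h1 h2].
  apply/andP; split; last by rewrite ler_pdivrMr// [y * _]mulrC.
  by rewrite /harmonic/= ler_pdivlMr// mulrBl mulVf ?gt_eqF// lerBlDr [y * _]mulrC ltW.
- by rewrite -[X in _ --> X]subr0; apply: cvgB; [exact: cvg_cst|exact: cvg_harmonic].
- exact: cvg_cst.
Qed.

Lemma continuous_pair (T U V : topologicalType) (f : T -> U) (g : T -> V) x :
  {for x, continuous f} -> {for x, continuous g} ->
  {for x, continuous (fun y => (f y, g y))}.
Proof. by move=> cf cg; apply: (@cvg_pair _ _ _ _ (nbhs (f x)) (nbhs (g x))). Qed.

(** The product sigma-algebra is reached one coordinate at a time: continuity in the last variable
    reduces the claim to the sections, and this is done twice. *)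
Lemma measurable_continuous3 (f : R3 R -> R) : continuous f ->
  measurable_fun setT (f : mR3 R -> R).
Proof.
move=> cf; apply: (@measurable_caratheodory _ (measurableTypeR R * measurableTypeR R)%type f).
  move=> z; apply: (@measurable_caratheodory _ (measurableTypeR R) (fun w => f (w, z))).
    move=> y; apply: continuous_measurable_fun => x.
    apply: (@continuous_comp _ _ _ (fun x : R => ((x, y), z) : R3 R) f); last exact: cf.
    by apply: continuous_pair; [apply: continuous_pair; [exact: cvg_id|exact: cvg_cst]|exact: cvg_cst].
  move=> x y; apply: (@continuous_comp _ _ _ (fun y : R => ((x, y), z) : R3 R) f); last exact: cf.
  by apply: continuous_pair; [apply: continuous_pair; [exact: cvg_cst|exact: cvg_id]|exact: cvg_cst].
move=> w z; apply: (@continuous_comp _ _ _ (fun z : R => (w, z) : R3 R) f); last exact: cf.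
by apply: continuous_pair; [exact: cvg_cst|exact: cvg_id].
Qed.

End continuous_functions_are_measurable.

Section schwartz_functions.
Context {R : realType}.
Variable g : R3 R -> R.
Hypotheses (sg : smooth g) (rg : rapidly_decreasing g).

Lemma measurable_smooth : measurable_fun setT (g : mR3 R -> R).
Proof.
apply: measurable_continuous3 => x; apply: differentiable_continuous; exact: (sg [::] x).
Qed.

Lemma der_line (f : R3 R -> R) (v x : R3 R) (s : R) :
  differentiable f (translate3 (scale3 s v) x) ->
  is_derive s (1 : R) (fun y => f (translate3 (scale3 y v) x)) ('D_v f (translate3 (scale3 s v) x)).
Proof.
move=> df; set z := translate3 (scale3 s v) x.
have E : (fun h : R => h^-1 *: (((fun y => f (translate3 (scale3 y v) x)) \o shift s) (h *: (1 : R)) -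
    (fun y => f (translate3 (scale3 y v) x)) s)) =
  (fun h : R => h^-1 *: ((f \o shift z) (h *: v) - f z)).
  apply/funext => h; rewrite /= /z; congr (_ *: (f _ - _)).
  rewrite -[h *: v]/(scale3 h v) -[_ + translate3 _ _]/(translate3 (translate3 (scale3 s v) x) (scale3 h v)).
  rewrite /translate3 /scale3 /=; rewrite -[h *: 1]/(h * 1) mulr1; congr (_, _, _); ring.
have dv : derivable f z v by exact: diff_derivable.
by split; [rewrite /derivable E|rewrite /derive E].
Qed.

(** Orders 0 and 6 of rapid decrease suffice: with [a = |x|^2], [4 (1 + a^3) - (1 + a)^3 = 3 (1 + a)
    (a - 1)^2]. *)
Lemma rapidly_decreasing_le (s : seq (R3 R)) : exists2 C : R, 0 <= C &
  forall x, `|iter_derive s g x| * (1 + dot3 x x) ^+ 3 <= C.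
Proof.
have [M0 h0] := rg s 0; have [M6 h6] := rg s 6.
have z0 := h0 0; have z6 := h6 0.
exists (4 * (M0 + M6)).
  by rewrite mulr_ge0// addr_ge0//; [apply: le_trans z0|apply: le_trans z6]; rewrite mulr_ge0// exprn_ge0// sqrtr_ge0.
move=> x; have := h0 x; have := h6 x; rewrite expr0 mul1r.
have -> : enorm x ^+ 6 = dot3 x x ^+ 3 by rewrite -sqr_enorm -exprM.
have := dot3_ge0 x; have := normr_ge0 (iter_derive s g x).
move: `|_| (dot3 x x) => T a T0 a0 h1 h2.
have h3 : (1 + a) ^+ 3 <= 4 * (1 + a ^+ 3).
  rewrite -subr_ge0; have -> : 4 * (1 + a ^+ 3) - (1 + a) ^+ 3 = 3 * (1 + a) * (a - 1) ^+ 2 by ring.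
  by rewrite mulr_ge0 ?sqr_ge0// mulr_ge0// addr_ge0.
apply: le_trans (ler_wpM2l T0 h3) _.
have -> : T * (4 * (1 + a ^+ 3)) = 4 * (T + a ^+ 3 * T) by ring.
by rewrite ler_wpM2l// lerD.
Qed.

Lemma le_weight3_dot3 (T C : R) (x : mR3 R) : 0 <= T -> 0 <= C ->
  T * (1 + dot3 x x) ^+ 3 <= C -> T <= C * weight3 1 x.
Proof.
move=> T0 C0 h; have h1 := sqr_ge0 x.1.1; have h2 := sqr_ge0 x.1.2; have h3 := sqr_ge0 x.2.
have c (y : R) : y ^+ 2 <= dot3 x x -> T * (1 + (1 * y) ^+ 2) ^+ 3 <= C.
  move=> yx; apply: le_trans h; rewrite ler_wpM2l// mul1r lerXn2r ?nnegrE ?addr_ge0 ?sqr_ge0 ?dot3_ge0//.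
  by rewrite lerD2l.
by apply: le_weight3; rewrite ?addr1_sqr_gt0//; apply: c; rewrite /dot3 -!expr2; lra.
Qed.

(** These are the hypotheses of the decay lemma for cosine transforms at scale 1. The sixth
    difference is controlled by sixth derivatives along the axis, at points within [6 pi] of [x]. *)
Lemma schwartz_bounds : exists2 C : R, 0 <= C &
  (forall x, `|g x| <= C * weight3 1 x) /\
  (forall v, v \in [:: e1; e2; e3] -> forall h, 0 < h <= pi ->
    forall x, `|fdiff (scale3 h v) 6 g x| <= C * h ^+ 6 * weight3 1 x).
Proof.
have [C0 C00 b0] := rapidly_decreasing_le [::].
have [C1 C10 b1] := rapidly_decreasing_le (nseq 6 (e1 : R3 R)).
have [C2 C20 b2] := rapidly_decreasing_le (nseq 6 (e2 : R3 R)).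
have [C3 C30 b3] := rapidly_decreasing_le (nseq 6 (e3 : R3 R)).
(* [1 + |x|^2 <= N (1 + |z|^2)] whenever [|x - z| <= 6 pi], which compares the decay at an
   intermediate point with that at [x]. *)
pose N : R := 2 * (1 + (6 * pi) ^+ 2).
have N0 : 0 < N by rewrite mulr_gt0// addr1_sqr_gt0.
pose C := C1 + C2 + C3.
have CC : 0 <= C by rewrite !addr_ge0.
exists (C0 + N ^+ 3 * C); first by rewrite addr_ge0// mulr_ge0// exprn_ge0// ltW.
split=> [x|v v123 h /andP[h0 hpi] x].
  apply: (@le_trans _ _ (C0 * weight3 1 x)); first exact: le_weight3_dot3 (b0 x).
  by rewrite ler_wpM2r ?(ltW (weight3_gt0 _ _))// lerDl mulr_ge0// exprn_ge0// ltW.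
have [vb vv] : (forall x, `|iter_derive (nseq 6 v) g x| * (1 + dot3 x x) ^+ 3 <= C) /\ dot3 v v = 1.
  move: v123; rewrite !inE /C => /or3P[] /eqP ->; (split; last by rewrite /dot3/=; ring) => y.
  - by apply: le_trans (b1 y) _; lra.
  - by apply: le_trans (b2 y) _; lra.
  - by apply: le_trans (b3 y) _; lra.
pose G k s := iter_derive (nseq k v) g (translate3 (scale3 s v) x).
have dG k (y : R) : is_derive y 1 (G k) (G k.+1 y).
  exact: der_line (sg (nseq k v) _).
have x0 : `|fdiff (scale3 h v) 6 g x| <= h ^+ 6 * (N ^+ 3 * C * weight3 1 x).
  rewrite -[X in fdiff _ _ _ X](translate3_0 v) fdiff_line.
  rewrite -[fun s => _]/(G 0%N); apply: (fdiff1_bound h0 (fun k _ => dG k)) => s.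
  rewrite add0r => /andP[s0 s6]; apply: le_weight3_dot3 => //.
    by rewrite mulr_ge0// exprn_ge0// ltW.
  have d := dot3_translate_le x (scale3 s v).
  set z := translate3 (scale3 s v) x in d *.
  have zz := dot3_ge0 z.
  have E : dot3 (scale3 s v) (scale3 s v) = s ^+ 2.
    by rewrite -[RHS]mulr1 -vv /dot3/scale3/=; ring.
  rewrite E in d.
  have s2 : s ^+ 2 <= (6 * pi) ^+ 2.
    by rewrite lerXn2r ?nnegrE ?mulr_ge0 ?pi_ge0// (le_trans s6)// ler_wpM2l.
  have le : 1 + dot3 x x <= N * (1 + dot3 z z).
    have P0 := sqr_ge0 (6 * pi : R); have Pz := mulr_ge0 P0 zz.
    have -> : N * (1 + dot3 z z) = 2 + 2 * dot3 z z + 2 * (6 * pi) ^+ 2 + 2 * ((6 * pi) ^+ 2 * dot3 z z).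
      by rewrite /N; ring.
    move: d s2 zz P0 Pz; move: (dot3 x x) (dot3 z z) (s ^+ 2) => X Z S.
    by move: ((6 * pi) ^+ 2) => P h1 h2 h3 h4 h5; lra.
  apply: (@le_trans _ _ (`|G 6%N s| * (N * (1 + dot3 z z)) ^+ 3)).
    have x1 : 0 <= 1 + dot3 x x := addr_ge0 ler01 (dot3_ge0 x).
    by rewrite ler_wpM2l// lerXn2r// nnegrE// (le_trans x1).
  by rewrite exprMn mulrCA ler_wpM2l ?exprn_ge0 ?(ltW N0)//; exact: vb.
apply: le_trans x0 _; have w0 := ltW (weight3_gt0 1 x); have h6 : 0 <= h ^+ 6 by rewrite exprn_ge0// ltW.
rewrite mulrA ler_wpM2r// mulrC ler_wpM2r// lerDr//.
Qed.

Lemma integrable_schwartz : mu3.-integrable setT (EFin \o (g : mR3 R -> R)).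
Proof.
have [C C0 [b _]] := schwartz_bounds.
by have [] := integrable_le_weight3 ltr01 measurable_smooth b.
Qed.

Lemma integrable_ctrans_schwartz th : mu3.-integrable setT (EFin \o ctrans th g).
Proof.
have [C C0 [b1 b2]] := schwartz_bounds.
have b1' x : `|g x| <= C * weight3 1^-1 x by rewrite invr1; exact: b1.
refine (integrable_ctrans_weight3 th ltr01 C0 measurable_smooth b1' _).1.
by move=> v v123 h h0 x; rewrite invr1 mulr1; apply: b2 => //; rewrite mulr1 in h0.
Qed.

End schwartz_functions.

(** * Convolution solution and norm estimate *)

Section lebesgue_norms.
Context {d} {T : measurableType d} {R : realType} (mu : {measure set T -> \bar R}).
Implicit Types (f g : T -> R).

Lemma integrable_add f g : mu.-integrable setT (EFin \o f) ->
  mu.-integrable setT (EFin \o g) -> mu.-integrable setT (EFin \o (fun x => f x + g x)).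
Proof. by move=> fi gi; have := integrableD measurableT fi gi; apply: eq_integrable. Qed.

Lemma integrable_sub f g : mu.-integrable setT (EFin \o f) ->
  mu.-integrable setT (EFin \o g) -> mu.-integrable setT (EFin \o (fun x => f x - g x)).
Proof. by move=> fi gi; have := integrableB measurableT fi gi; apply: eq_integrable. Qed.

Lemma abs_Rintegral_le f : measurable_fun setT f ->
  (`|\int[mu]_x f x|%:E <= \int[mu]_x `|f x|%:E)%E.
Proof.
move=> mf; have mE : measurable_fun setT (EFin \o f) by exact/measurable_EFinP.
apply: le_trans (le_abse_integral mu measurableT mE).
rewrite /Rintegral; case: (integral _ _ _) => [r| |] //=; by rewrite normr0 leey.
Qed.

Lemma le_Lnorm (p : \bar R) f g : (1 <= p)%E -> measurable_fun setT f ->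
  measurable_fun setT g -> (forall x, `|f x| <= `|g x|) ->
  (Lnorm mu p (EFin \o f) <= Lnorm mu p (EFin \o g))%E.
Proof.
move=> p1 mf mg fg; rewrite unlock; case: p p1 => [p| |]; last by [].
- rewrite lee_fin => p1; have p0 : 0 < p by rewrite (lt_le_trans _ p1).
  have q0 : 0 <= p^-1 by rewrite invr_ge0 ltW.
  have mp (h : T -> R) : measurable_fun setT h -> measurable_fun setT (fun x => (`|h x| `^ p)%:E).
    move=> mh; apply/measurable_EFinP; apply: (measurableT_comp (measurable_powR p)).
    exact: measurableT_comp.
  apply: (gt0_ler_poweR q0); rewrite ?in_itv/= ?leey ?andbT//;
    try by apply: integral_ge0 => y _; rewrite lee_fin powR_ge0.
  apply: ge0_le_integral => //.
  - exact: mp.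
  - exact: mp.
  - by move=> x _; rewrite lee_fin; apply: ge0_ler_powR; rewrite ?nnegrE// ltW.
- move=> _; case: ifPn => // _; apply/ess_supP.
  have := ess_sup_ge mu (abse \o (EFin \o g)).
  by apply: filterS => x /=; apply: le_trans; rewrite lee_fin.
Qed.

End lebesgue_norms.

Section complex_modulus.
Context {R : realType}.

Lemma norm_Re_le (z : R[i]) : `|complex.Re z| <= Normc.normc z.
Proof.
by case: z => a b /=; rewrite -sqrtr_sqr ler_wsqrtr// lerDl sqr_ge0.
Qed.

Lemma norm_Im_le (z : R[i]) : `|complex.Im z| <= Normc.normc z.
Proof.
by case: z => a b /=; rewrite -sqrtr_sqr ler_wsqrtr// lerDr sqr_ge0.
Qed.

Lemma normc_ge0 (z : R[i]) : 0 <= Normc.normc z.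
Proof. by case: z => a b; exact: sqrtr_ge0. Qed.

Lemma normc_le (a b : R) : Normc.normc (Complex a b) <= `|a| + `|b|.
Proof.
rewrite -[leRHS]ger0_norm ?addr_ge0// -sqrtr_sqr /= ler_wsqrtr//.
rewrite sqrrD !real_normK ?num_real//.
by rewrite addrAC lerDl mulrn_wge0// mulr_ge0.
Qed.

Lemma measurable_normc d (T : measurableType d) (f : T -> R[i]) :
  measurable_fun setT (fun x => complex.Re (f x)) ->
  measurable_fun setT (fun x => complex.Im (f x)) ->
  measurable_fun setT (fun x => Normc.normc (f x)).
Proof.
move=> mr mi; have -> : (fun x => Normc.normc (f x)) =
  (fun x => Num.sqrt (complex.Re (f x) ^+ 2 + complex.Im (f x) ^+ 2)).
  by apply/funext => x; case: (f x).
apply: (measurableT_comp (continuous_measurable_fun (@sqrt_continuous R))).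
by apply: measurable_funD; exact: measurable_funX.
Qed.

End complex_modulus.

Section fourier_transform.
Context {R : realType}.
Implicit Types (f : R3 R -> R[i]).

(** As [cos (s - pi / 2) = sin s], these are the real and imaginary parts of the integral of
    [exp (- i x . y) f y]. *)
Lemma fourierE f x :
  mu3.-integrable setT (EFin \o (fun y : mR3 R => complex.Re (f y))) ->
  mu3.-integrable setT (EFin \o (fun y : mR3 R => complex.Im (f y))) ->
  fourier f x = Complex
    (ctrans 0 (fun y => complex.Re (f y)) x + ctrans (- (pi / 2)) (fun y => complex.Im (f y)) x)
    (ctrans 0 (fun y => complex.Im (f y)) x - ctrans (- (pi / 2)) (fun y => complex.Re (f y)) x).
Proof.
move=> ir ii; rewrite /fourier /integralC; congr Complex.
- rewrite /ctrans -RintegralD//; [|exact: integrable_ctrans..].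
  apply: eq_Rintegral => y _; rewrite addr0 /expi; case: (f y) => a b /=.
  by rewrite cosN sinN -[- (pi / 2)]opprK opprK cosB cos_pihalf sin_pihalf mulr0 mulr1 add0r; ring.
- rewrite /ctrans -RintegralB//; [|exact: integrable_ctrans..].
  apply: eq_Rintegral => y _; rewrite addr0 /expi; case: (f y) => a b /=.
  by rewrite cosN sinN cosB cos_pihalf sin_pihalf mulr0 mulr1 add0r; ring.
Qed.

End fourier_transform.

Section convolution_with_a_kernel.
Context {R : realType}.
Variables (K m : mR3 R -> R) (k : R).
Hypothesis Ki : mu3.-integrable setT (EFin \o K).
Hypothesis K_even : forall x, K (opp3 x) = K x.
Hypothesis k0 : 0 < k.
Hypothesis Kk : (\int[mu3]_x `|K x|%:E <= k%:E)%E.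
Hypothesis Km : forall xi a, \int[mu3]_x (cos (dot3 x xi + a) * K x) = cos a * m xi.
Variable p : \bar R.
Hypothesis p1 : (1 <= p)%E.

Let mK : measurable_fun setT K.
Proof. by apply/measurable_EFinP; exact: measurable_int Ki. Qed.

(** The case [a = 0] of [Km]. It makes [m] measurable and bounded by the integral of [|K|]. *)
Lemma multiplier_ctrans : m = ctrans 0 K.
Proof. by apply/funext => xi; rewrite /ctrans Km cos0 mul1r. Qed.

Lemma integrable_multiplier_mul g : mu3.-integrable setT (EFin \o g) ->
  mu3.-integrable setT (EFin \o (fun xi => m xi * g xi)).
Proof.
move=> gi; have mg : measurable_fun setT g by apply/measurable_EFinP; exact: measurable_int gi.
have bi := integrableZl measurableT (\int[mu3]_x `|K x|) (integrable_norm gi).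
apply: (le_integrable measurableT _ _ bi).
  apply/measurable_EFinP; apply: measurable_funM => //.
  by rewrite multiplier_ctrans; exact: measurable_ctrans.
move=> x _; rewrite /= lee_fin normrM [leRHS]ger0_norm; last first.
  by rewrite mulr_ge0// Rintegral_ge0.
by rewrite ler_wpM2r// multiplier_ctrans; exact: ctrans_le.
Qed.

Lemma conv_ctrans_pairing (f g : mR3 R -> R) th : measurable_fun setT f ->
  (Lnorm mu3 p (EFin \o (fun x => `|f x|%R)) < +oo)%E ->
  mu3.-integrable setT (EFin \o g) -> mu3.-integrable setT (EFin \o ctrans th g) ->
  [/\ mu3.-integrable setT (EFin \o (fun x => conv K f x * ctrans th g x)),
    mu3.-integrable setT (EFin \o (fun x => f x * ctrans th (fun xi => m xi * g xi) x)) &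
    \int[mu3]_x (conv K f x * ctrans th g x) =
    \int[mu3]_x (f x * ctrans th (fun xi => m xi * g xi) x)].
Proof.
move=> mf fp gi ci.
have [h1 h2 h3] := conv_pairing Ki K_even Kk p1 mf fp ci (fun x => ctrans_le th x gi).
have E : conv K (ctrans th g) = ctrans th (fun xi => m xi * g xi).
  by apply/funext => y; apply: conv_ctrans.
by rewrite -E; split; [exact: h1|exact: h2|exact: h3].
Qed.

Lemma eq_combine (x y z w x' y' z' w' : R) : x = x' -> y = y' -> z = z' -> w = w' ->
  x + y - (z - w) = x' + y' - (z' - w').
Proof. by move=> -> -> -> ->. Qed.

Lemma hatE (f phi : R3 R -> R[i]) : hat f phi = integralC (fun x => f x * fourier phi x).
Proof. by []. Qed.

Lemma eq_integralC (f g : R3 R -> R[i]) :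
  \int[mu3]_x complex.Re (f x) = \int[mu3]_x complex.Re (g x) ->
  \int[mu3]_x complex.Im (f x) = \int[mu3]_x complex.Im (g x) ->
  integralC f = integralC g.
Proof. by rewrite /integralC => -> ->. Qed.

Definition convC (u : R3 R -> R[i]) (x : R3 R) : R[i] :=
  Complex (conv K (fun y => complex.Re (u y)) x) (conv K (fun y => complex.Im (u y)) x).

Lemma Rintegral_combine (x y z w : mR3 R -> R) :
  mu3.-integrable setT (EFin \o x) -> mu3.-integrable setT (EFin \o y) ->
  mu3.-integrable setT (EFin \o z) -> mu3.-integrable setT (EFin \o w) ->
  mu3.-integrable setT (EFin \o (fun v => x v + y v - (z v - w v))) /\
  \int[mu3]_v (x v + y v - (z v - w v)) =
  \int[mu3]_v x v + \int[mu3]_v y v - (\int[mu3]_v z v - \int[mu3]_v w v).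
Proof.
move=> xi yi zi wi; have h1 := integrable_add xi yi; have h2 := integrable_sub zi wi.
split; first exact: integrable_sub.
by rewrite RintegralB// RintegralD// RintegralB.
Qed.

Lemma Lnorm_Re_lt u : in_Lp p u -> (Lnorm mu3 p (EFin \o (fun x : mR3 R => `|complex.Re (u x)|%R)) < +oo)%E.
Proof.
move=> [mr mi]; apply: le_lt_trans; apply: le_Lnorm => //.
- exact: measurableT_comp.
- exact: measurable_normc.
- by move=> x; rewrite normr_id [leRHS]ger0_norm ?normc_ge0//; exact: norm_Re_le.
Qed.

Lemma Lnorm_Im_lt u : in_Lp p u -> (Lnorm mu3 p (EFin \o (fun x : mR3 R => `|complex.Im (u x)|%R)) < +oo)%E.
Proof.
move=> [mr mi]; apply: le_lt_trans; apply: le_Lnorm => //.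
- exact: measurableT_comp.
- exact: measurable_normc.
- by move=> x; rewrite normr_id [leRHS]ger0_norm ?normc_ge0//; exact: norm_Im_le.
Qed.

(** Each side splits into eight real integrals: real or imaginary part of [u], the same for [phi],
    cosine or sine transform. [conv_ctrans_pairing] matches them one by one and makes them
    integrable, so that they can be recombined. *)
Lemma hat_convC u phi : in_Lp p u -> schwartz phi ->
  [/\ mu3.-integrable setT (EFin \o (fun x : mR3 R => complex.Re (convC u x * fourier phi x))),
    mu3.-integrable setT (EFin \o (fun x : mR3 R => complex.Im (convC u x * fourier phi x))) &
    hat (convC u) phi = hat u (fun xi => (m xi)%:C%C * phi xi)].
Proof.
move=> up [[sr si] rr ri]; have ur := Lnorm_Re_lt up; have ui := Lnorm_Im_lt up.
have [mr mi _] := up.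
set a : mR3 R -> R := fun x => complex.Re (u x); set b : mR3 R -> R := fun x => complex.Im (u x).
pose f : mR3 R -> R := fun x => complex.Re (phi x); pose g : mR3 R -> R := fun x => complex.Im (phi x).
have fi : mu3.-integrable setT (EFin \o f) := integrable_schwartz sr rr.
have gi : mu3.-integrable setT (EFin \o g) := integrable_schwartz si ri.
have cf th : mu3.-integrable setT (EFin \o ctrans th f) := integrable_ctrans_schwartz sr rr th.
have cg th : mu3.-integrable setT (EFin \o ctrans th g) := integrable_ctrans_schwartz si ri th.
have [i1 j1 e1] := conv_ctrans_pairing (f := a) mr ur fi (cf 0).
have [i2 j2 e2] := conv_ctrans_pairing (f := a) mr ur gi (cg (- (pi / 2))).
have [i3 j3 e3] := conv_ctrans_pairing (f := b) mi ui gi (cg 0).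
have [i4 j4 e4] := conv_ctrans_pairing (f := b) mi ui fi (cf (- (pi / 2))).
have [i5 j5 e5] := conv_ctrans_pairing (f := a) mr ur gi (cg 0).
have [i6 j6 e6] := conv_ctrans_pairing (f := b) mi ui fi (cf 0).
have [i7 j7 e7] := conv_ctrans_pairing (f := b) mi ui gi (cg (- (pi / 2))).
have [i8 j8 e8] := conv_ctrans_pairing (f := a) mr ur fi (cf (- (pi / 2))).
have mfi := integrable_multiplier_mul fi; have mgi := integrable_multiplier_mul gi.
have F1 x : fourier phi x = Complex (ctrans 0 f x + ctrans (- (pi / 2)) g x)
    (ctrans 0 g x - ctrans (- (pi / 2)) f x) by exact: fourierE.
have F2 x : fourier (fun xi => (m xi)%:C%C * phi xi) x =
    Complex (ctrans 0 (fun xi => m xi * f xi) x + ctrans (- (pi / 2)) (fun xi => m xi * g xi) x)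
    (ctrans 0 (fun xi => m xi * g xi) x - ctrans (- (pi / 2)) (fun xi => m xi * f xi) x).
  have Ef : (fun y => complex.Re ((m y)%:C%C * phi y)) = (fun xi => m xi * f xi).
    by apply/funext => y; rewrite /f; case: (phi y) => c e /=; rewrite mul0r subr0.
  have Eg : (fun y => complex.Im ((m y)%:C%C * phi y)) = (fun xi => m xi * g xi).
    by apply/funext => y; rewrite /g; case: (phi y) => c e /=; rewrite mul0r addr0.
  by rewrite -Ef -Eg; apply: fourierE; [rewrite Ef; exact: mfi|rewrite Eg; exact: mgi].
have cplx (c e A B : R) : Complex c e * Complex A B = Complex (c * A - e * B) (c * B + e * A) by [].
have [ri1 re1] := Rintegral_combine i1 i2 i3 i4.
have [_ re2] := Rintegral_combine j1 j2 j3 j4.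
have [ii1 ie1] := Rintegral_combine i5 i6 i8 i7.
have [_ ie2] := Rintegral_combine j5 j6 j8 j7.
have R1 : (fun x => complex.Re (convC u x * fourier phi x)) = (fun x =>
    conv K a x * ctrans 0 f x + conv K a x * ctrans (- (pi / 2)) g x -
    (conv K b x * ctrans 0 g x - conv K b x * ctrans (- (pi / 2)) f x)).
  by apply/funext => x; rewrite F1 /convC cplx /=; ring.
have I1 : (fun x => complex.Im (convC u x * fourier phi x)) = (fun x =>
    conv K a x * ctrans 0 g x + conv K b x * ctrans 0 f x -
    (conv K a x * ctrans (- (pi / 2)) f x - conv K b x * ctrans (- (pi / 2)) g x)).
  by apply/funext => x; rewrite F1 /convC cplx /=; ring.
have R2 : (fun x => complex.Re (u x * fourier (fun xi => (m xi)%:C%C * phi xi) x)) = (fun x =>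
    a x * ctrans 0 (fun xi => m xi * f xi) x +
    a x * ctrans (- (pi / 2)) (fun xi => m xi * g xi) x -
    (b x * ctrans 0 (fun xi => m xi * g xi) x -
     b x * ctrans (- (pi / 2)) (fun xi => m xi * f xi) x)).
  by apply/funext => x; rewrite F2 /a /b; case: (u x) => c e; rewrite cplx /=; ring.
have I2 : (fun x => complex.Im (u x * fourier (fun xi => (m xi)%:C%C * phi xi) x)) = (fun x =>
    a x * ctrans 0 (fun xi => m xi * g xi) x +
    b x * ctrans 0 (fun xi => m xi * f xi) x -
    (a x * ctrans (- (pi / 2)) (fun xi => m xi * f xi) x -
     b x * ctrans (- (pi / 2)) (fun xi => m xi * g xi) x)).
  by apply/funext => x; rewrite F2 /a /b; case: (u x) => c e; rewrite cplx /=; ring.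
split; [by rewrite R1; exact: ri1|by rewrite I1; exact: ii1|].
rewrite !hatE; apply: eq_integralC.
  have L1 := etrans (congr1 (Rintegral mu3 setT) R1) re1.
  have L2 := etrans (congr1 (Rintegral mu3 setT) R2) re2.
  exact: (etrans L1 (etrans (eq_combine e1 e2 e3 e4) (esym L2))).
have L1 := etrans (congr1 (Rintegral mu3 setT) I1) ie1.
have L2 := etrans (congr1 (Rintegral mu3 setT) I2) ie2.
exact: (etrans L1 (etrans (eq_combine e5 e6 e8 e7) (esym L2))).
Qed.

(** The modulus of [convC u] is at most the sum of the absolute values of its two real parts, each
    bounded by the convolution of [|K|] with [|u|]; applying [young] to [2 * K] accounts for
    both. *)
Lemma normLp_convC u : in_Lp p u ->
  in_Lp p (convC u) /\ (normLp p (convC u) <= (2 * k)%:E * normLp p u)%E.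
Proof.
move=> up; have [mr mi uoo] := up.
have mcr := measurable_conv Ki mr; have mci := measurable_conv Ki mi.
have mn := measurable_normc mr mi.
have mcn : measurable_fun setT (fun x : mR3 R => Normc.normc (convC u x)).
  by apply: measurable_normc.
have K2i : mu3.-integrable setT (EFin \o (fun x => 2 * K x)).
  by have := integrableZl measurableT 2 Ki; apply: eq_integrable.
have K2e x : 2 * K (opp3 x) = 2 * K x by rewrite K_even.
have K2k : (\int[mu3]_x `|2 * K x|%:E <= (2 * k)%:E)%E.
  under eq_integral do rewrite normrM normr_nat EFinM.
  rewrite ge0_integralZl//; last by apply/measurable_EFinP; exact: measurableT_comp.
  by rewrite EFinM lee_wpmul2l.
have k20 : 0 < 2 * k by rewrite mulr_gt0.
have le : (normLp p (convC u) <= (2 * k)%:E * normLp p u)%E.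
  apply: (young K2i K2e k20 K2k p1 mn) => //; first by move=> x; exact: normc_ge0.
  move=> x; rewrite ger0_norm ?normc_ge0//.
  have b (f : mR3 R -> R) : measurable_fun setT f -> (forall y, `|f y| <= Normc.normc (u y)) ->
      (`|conv K f x|%:E <= \int[mu3]_y (`|K (sub3 x y)| * Normc.normc (u y))%:E)%E.
    move=> mf fu; have mk : measurable_fun setT (fun y => K (sub3 x y)) by exact: measurable_kernel2.
    apply: le_trans (abs_Rintegral_le mu3 (measurable_funM mk mf)) _.
    apply: ge0_le_integral => //.
    - by apply/measurable_EFinP; apply: measurableT_comp => //; exact: measurable_funM.
    - by apply/measurable_EFinP; apply: measurable_funM => //; exact: measurableT_comp.
    - by move=> y _; rewrite lee_fin normrM ler_wpM2l.
  have br := b _ mr (fun y => norm_Re_le (u y)); have bi := b _ mi (fun y => norm_Im_le (u y)).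
  apply: le_trans (_ : (_ <= `|conv K (fun y => complex.Re (u y)) x|%:E +
    `|conv K (fun y => complex.Im (u y)) x|%:E)%E) _; first by rewrite -EFinD lee_fin normc_le.
  apply: le_trans (leeD br bi) _.
  have mT : measurable_fun setT (fun y : mR3 R => (`|K (sub3 x y)| * Normc.normc (u y))%:E).
    apply/measurable_EFinP; apply: measurable_funM => //; apply: measurableT_comp => //.
    exact: measurable_kernel2.
  have T0 (y : mR3 R) : setT y -> (0 <= (`|K (sub3 x y)| * Normc.normc (u y))%:E)%E.
    by move=> _; rewrite lee_fin mulr_ge0 ?normc_ge0.
  have -> : (\int[mu3]_y (`|2 * K (sub3 x y)| * Normc.normc (u y))%:E =
      2%:E * \int[mu3]_y (`|K (sub3 x y)| * Normc.normc (u y))%:E)%E.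
    under eq_integral do rewrite normrM normr_nat -mulrA EFinM.
    exact: (ge0_integralZl mu3 measurableT mT T0).
  by rewrite mule_natl mule2n.
split=> //; split=> //; apply: le_lt_trans le _; rewrite lte_mul_pinfty//.
- by rewrite lee_fin ltW.
Qed.

End convolution_with_a_kernel.

Lemma sum_ord2 (V : nmodType) (F : 'I_2 -> V) : \sum_(j < 2) F j = F 0 + F 1.
Proof.
by rewrite big_ord_recl big_ord1; congr (F _ + F _); exact/val_inj.
Qed.

Section sums.
Context {R : realType}.
Implicit Types (f g phi : R3 R -> R[i]).

(** Integrals with conventional values at divergence are not additive in general; the four
    integrability conditions are those supplied by [hat_convC]. *)
Lemma hat_add f g phi :
  mu3.-integrable setT (EFin \o (fun x : mR3 R => complex.Re (f x * fourier phi x))) ->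
  mu3.-integrable setT (EFin \o (fun x : mR3 R => complex.Im (f x * fourier phi x))) ->
  mu3.-integrable setT (EFin \o (fun x : mR3 R => complex.Re (g x * fourier phi x))) ->
  mu3.-integrable setT (EFin \o (fun x : mR3 R => complex.Im (g x * fourier phi x))) ->
  hat (fun x => f x + g x) phi = hat f phi + hat g phi.
Proof.
move=> fr fi gr gi.
have Re_add (z w : R[i]) : complex.Re (z + w) = complex.Re z + complex.Re w by case: z; case: w.
have Im_add (z w : R[i]) : complex.Im (z + w) = complex.Im z + complex.Im w by case: z; case: w.
have E1 : (fun x => complex.Re ((f x + g x) * fourier phi x)) =
    (fun x => complex.Re (f x * fourier phi x) + complex.Re (g x * fourier phi x)).
  by apply/funext => x; rewrite mulrDl Re_add.
have E2 : (fun x => complex.Im ((f x + g x) * fourier phi x)) =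
    (fun x => complex.Im (f x * fourier phi x) + complex.Im (g x * fourier phi x)).
  by apply/funext => x; rewrite mulrDl Im_add.
have L1 := etrans (congr1 (Rintegral mu3 setT) E1) (RintegralD measurableT fr gr).
have L2 := etrans (congr1 (Rintegral mu3 setT) E2) (RintegralD measurableT fi gi).
exact: (congr2 (@Complex R) L1 L2).
Qed.

Lemma normLp_add (p : \bar R) f g : (1 <= p)%E -> in_Lp p f -> in_Lp p g ->
  in_Lp p (fun x => f x + g x) /\
  (normLp p (fun x => (f x + g x)%R) <= normLp p f + normLp p g)%E.
Proof.
move=> p1 [fr fi fp] [gr gi gp].
have mr : measurable_fun setT (fun x : mR3 R => complex.Re (f x + g x)).
  have := measurable_funD fr gr; apply: eq_measurable_fun => x _ /=.
  by case: (f x); case: (g x).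
have mi : measurable_fun setT (fun x : mR3 R => complex.Im (f x + g x)).
  have := measurable_funD fi gi; apply: eq_measurable_fun => x _ /=.
  by case: (f x); case: (g x).
have mf := measurable_normc fr fi; have mg := measurable_normc gr gi.
have le : (normLp p (fun x => (f x + g x)%R) <= normLp p f + normLp p g)%E.
  apply: le_trans (eminkowski mu3 mf mg p1); apply: le_Lnorm => //.
  - exact: measurable_normc.
  - exact: measurable_funD.
  - move=> x; rewrite !ger0_norm ?addr_ge0 ?normc_ge0//; exact: le_normcD.
by split=> //; split=> //; apply: le_lt_trans le _; exact: lte_add_pinfty.
Qed.

End sums.

Theorem proposition3p5 (R : realType) (r1 r2 : R) (hr1 : 0 < r1)
    (hr12 : r1 < r2) :
  exists c C : R, [/\ 0 < c, 0 < C &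
    forall (p : \bar R), (1 <= p)%E ->
    forall (t lambda : R), 0 < t -> 0 < lambda ->
    forall (m n : nat) (u : 'I_2 -> R3 R -> 'M[R[i]]_(m, n)),
      pair_in_Lp p u ->
      spectrum_in u (scale_set lambda (ring3 r1 r2)) ->
      exists v : 'I_2 -> R3 R -> 'M[R[i]]_(m, n),
        [/\ green t u v, pair_in_Lp p v &
          (pair_normLp p v
             <= (C * expR (- c * lambda ^+ 2 * t))%:E * pair_normLp p u)%E]].
Proof.
pose A1 := r1 ^+ 2; pose B1 := r2 ^+ 2.
have A0 : 0 < A1 by rewrite exprn_gt0.
have AB : A1 <= B1 by rewrite lerXn2r ?nnegrE ?ltW// (lt_trans hr1).
have [C0 C00 HK] := green_kernel A0 AB.
(* One factor 2 comes from the real and imaginary parts of a convolution, the other from the two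
   rows of the matrix; the exponent is that of [rate]. *)
exists (A1 / 8 / 4), (4 * C0); split; first by rewrite !divr_gt0.
  by rewrite mulr_gt0.
move=> p p1 t lam t0 l0 m n u up us.
pose K i j := sval (cid (HK i j t lam t0 l0)).
have Ki i j : mu3.-integrable setT (EFin \o K i j) by have [] := svalP (cid (HK i j t lam t0 l0)).
have Ke i j x : K i j (opp3 x) = K i j x by have [_ + _ _] := svalP (cid (HK i j t lam t0 l0)); exact.
have Kk i j : (\int[mu3]_x `|K i j x|%:E <= (C0 * rate A1 t lam)%:E)%E.
  by have [] := svalP (cid (HK i j t lam t0 l0)).
have Km i j xi a : \int[mu3]_x (cos (dot3 x xi + a) * K i j x) = cos a * multiplier A1 B1 t lam i j xi.
  by have [_ _ _] := svalP (cid (HK i j t lam t0 l0)); exact.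
have k0 : 0 < C0 * rate A1 t lam by rewrite mulr_gt0// expR_gt0.
set k := C0 * rate A1 t lam in k0 Kk.
pose w i j a b := convC (K i j) (entry u a b j).
pose v i x : 'M[R[i]]_(m, n) := \matrix_(a, b) (w i 0 a b x + w i 1 a b x).
have vE a b i : entry v a b i = (fun x => w i 0 a b x + w i 1 a b x).
  by apply/funext => x; rewrite /entry mxE.
have wp i j a b := normLp_convC (Ki i j) (Ke i j) k0 (Kk i j) p1 (up j a b).
have vp a b i := normLp_add p1 (wp i 0 a b).1 (wp i 1 a b).1.
exists v; split.
(* The cutoff from which the kernels were built serves as [chi], since the spectra of all entries of
   [u] lie in the scaled ring. *)
- move=> a b; exists (cutoff A1 B1 lam).
    by apply: (cutoff_near_ring A0 AB l0 hr1 erefl erefl) => xi [j _]; exact: us.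
  move=> i phi sphi; rewrite vE.
  have [r0 i0 h0] := hat_convC (Ki i 0) (Ke i 0) (Kk i 0) (Km i 0) p1 (up 0 a b) sphi.
  have [r1' i1 h1] := hat_convC (Ki i 1) (Ke i 1) (Kk i 1) (Km i 1) p1 (up 1 a b) sphi.
  rewrite sum_ord2 /dmul; rewrite /multiplier in h0 h1.
  exact: (etrans (hat_add r0 i0 r1' i1) (congr2 +%R h0 h1)).
- by move=> i a b; rewrite vE; exact: (vp a b i).1.
pose N j a b := normLp p (entry u a b j).
have N0 j a b : (0 <= N j a b)%E by exact: Lnorm_ge0.
pose S j := (\sum_(a < m) \sum_(b < n) N j a b)%E.
have S0 j : (0 <= S j)%E by apply: sume_ge0 => a _; exact: sume_ge0.
(* Minkowski's inequality for the two convolutions and the kernel estimate hold entry by entry with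
   a common constant, so they can be summed. *)
have row i : (\sum_(a < m) \sum_(b < n) normLp p (entry v a b i) <= (2 * k)%:E * (S 0%R + S 1%R))%E.
  rewrite /S -big_split/= ge0_sume_distrr; last first.
    by move=> a _; rewrite adde_ge0// sume_ge0.
  apply: lee_sum => a _; rewrite -big_split/= ge0_sume_distrr; last first.
    by move=> b _; rewrite adde_ge0.
  apply: lee_sum => b _; rewrite vE; apply: le_trans (vp a b i).2 _.
  rewrite ge0_muleDr//; apply: leeD; [exact: (wp i 0 a b).2|exact: (wp i 1 a b).2].
rewrite /pair_normLp !(@sum_ord2 (\bar R)).
apply: le_trans (leeD (row 0) (row 1)) _.
have -> : 4 * C0 * expR (- (A1 / 8 / 4) * lam ^+ 2 * t) = 2 * k + 2 * k.
  by rewrite /k /rate -!mulNr; ring.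
have k2 : (0 <= (2 * k)%:E)%E by rewrite lee_fin mulr_ge0// ltW.
by rewrite EFinD ge0_muleDl.
Qed.
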